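(* Let $A$ be a generalized Cartan matrix of affine type and $k\in\mathbb{N}$. Let $c_{\lambda\mu}^\nu$ ($\lambda,\mu,\nu\in P_k$) be the fusion coefficients of $R_k(A)$, i.e. the structure constants of $R_k(A)$ in the basis $\{\mathring{\chi}_\lambda\}_{\lambda\in P_k}$. For any $\lambda,\mu,\nu\in P_k$: (1) $c_{\lambda\mu}^\nu\in\mathbb{Z}$. (2) If $\langle\lambda+\mu+\nu,\check{\theta}\rangle\le 2k$, then $$c_{\lambda\mu}^\nu=\dim\mathrm{Hom}_{\mathring{\mathfrak{g}}}(\mathring{V}_\nu,\mathring{V}_\lambda\otimes\mathring{V}_\mu).$$
   Context: Affine types. $A=X_N^{(r)}$ is a generalized Cartan matrix of affine type in Kac's notation, with vertices $0,1,\dots,n$ in Kac's numbering (untwisted if $r=1$, twisted if $r>1$). $\mathring{\mathfrak{g}}$ is the complex simple Lie algebra generated by the Chevalley generators $e_i,f_i$ ($i=1,\dots,n$) of the Kac-Moody algebra $\mathfrak{g}(A)$ (delete vertex $0$), with Cartan subalgebra $\mathring{\mathfrak{h}}$, and $\check{h}$ is the dual Coxeter number of $\mathfrak{g}(A)$. The types, with (type of $\mathring{\mathfrak{g}}$; $\check{h}$), are: $A_n^{(1)}$, $n\ge1$: $(A_n;n+1)$; $B_n^{(1)}$, $n\ge3$: $(B_n;2n-1)$; $C_n^{(1)}$, $n\ge2$: $(C_n;n+1)$; $D_n^{(1)}$, $n\ge4$: $(D_n;2n-2)$; $E_6^{(1)}$: $(E_6;12)$; $E_7^{(1)}$: $(E_7;18)$;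 $E_8^{(1)}$: $(E_8;30)$; $F_4^{(1)}$: $(F_4;9)$; $G_2^{(1)}$: $(G_2;4)$; $A_{2n}^{(2)}$, $n\ge2$: $(C_n;2n+1)$; $A_{2n-1}^{(2)}$, $n\ge3$: $(C_n;2n)$; $D_{n+1}^{(2)}$, $n\ge3$: $(B_n;2n)$; $E_6^{(2)}$: $(F_4;12)$; $D_4^{(3)}$: $(G_2;6)$. Finite root data of $\mathring{\mathfrak{g}}$. $\mathring{P}$ and $\mathring{Q}$ are the weight and root lattices in $\mathring{\mathfrak{h}}^*$; $\check{\mathring{P}}\subset\mathring{\mathfrak{h}}$ is the dual lattice of $\mathring{Q}$ (coweight lattice); $\mathring{P}^+$, $\check{\mathring{P}}^+$ are the dominant weights and coweights; $\mathring{\rho}$, $\check{\mathring{\rho}}$ are the sums of the fundamental weights and of the fundamental coweights; $\theta$ is the highest root; $\mathring{W}$ is the Weyl group with length function $\ell$; $\mathring{V}_\lambda$ is the irreducible representation of $\mathring{\mathfrak{g}}$ of highest weight $\lambda\in\mathring{P}^+$. Form. When $A=X_N^{(1)}$ or $A=A_{2n}^{(2)}$, $(\cdot|\cdot)$ is the restriction of Kac's normalized invariant form to $\mathring{\mathfrak{h}}$, $\kappa:\mathring{\mathfrak{h}}\to\mathring{\mathfrak{h}}^*$ is the induced isomorphism, and $(\cdot|\cdot)$ also denotes the form transported to $\mathring{\mathfrak{h}}^*$. Concretely it is the $\mathring{W}$-invariant form with $(\theta|\theta)=2$ if $A=X_N^{(1)}$ and $(\theta|\theta)=4$ if $A=A_{2n}^{(2)}$.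 $\check{\theta}$. If $A=X_N^{(1)}$ or $A=A_{2n}^{(2)}$, $\check{\theta}=\kappa^{-1}(\theta)$; otherwise $\check{\theta}$ is the highest coroot of $\mathring{\mathfrak{g}}$ (the highest root of the dual root system). Level $k$. $P_k=\{\lambda\in\mathring{P}^+ : \langle\lambda,\check{\theta}\rangle\le k\}$ and $\check{P}_k=\{\check{\lambda}\in\check{\mathring{P}}^+ : \langle\check{\lambda},\theta\rangle\le k\}$. Let $\mathring{T}=\mathrm{Hom}(\mathring{P},\mathbb{C}^\times)$; for $\mu\in\mathring{P}$, $t\in\mathring{T}$ write $\mu(t):=t(\mu)$. If $A=X_N^{(1)}$ or $A=A_{2n}^{(2)}$, $\Sigma_k=\{e^{\frac{2\pi i}{k+\check{h}}(\mathring{\rho}+\lambda|\cdot)}\in\mathring{T} : \lambda\in P_k\}$; otherwise $\Sigma_k=\{e^{\frac{2\pi i}{k+\check{h}}\langle\check{\mathring{\rho}}+\check{\lambda},\cdot\rangle}\in\mathring{T} : \check{\lambda}\in\check{P}_k\}$. Fusion ring. $R_k(A)$ is the commutative ring of $\mathbb{C}$-valued functions on the finite set $\Sigma_k$. For $\lambda\in P_k$, $t\in\Sigma_k$: $J_\lambda(t)=\sum_{w\in\mathring{W}}(-1)^{\ell(w)}\,w(\lambda+\mathring{\rho})(t)$ and $\mathring{\chi}_\lambda(t)=J_\lambda(t)/J_0(t)$ (by the Weyl character formula, the trace of $t$ on $\mathring{V}_\lambda$). The functions $\mathring{\chi}_\lambda$, $\lambda\in P_k$, form a $\mathbb{C}$-basis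 of $R_k(A)$, and $c_{\lambda\mu}^\nu\in\mathbb{C}$ are the unique coefficients with $\mathring{\chi}_\lambda\cdot\mathring{\chi}_\mu=\sum_{\nu\in P_k}c_{\lambda\mu}^\nu\,\mathring{\chi}_\nu$ in $R_k(A)$. *)

(* Defs.v *)
From HB Require Import structures.
From mathcomp Require Import all_boot all_order all_algebra.
From mathcomp Require Import all_classical all_reals.
From mathcomp Require Import topology normedtype trigo.
From mathcomp Require Import complex mxtens ring.

Set Implicit Arguments.
Unset Strict Implicit.
Unset Printing Implicit Defensive.
Import Order.TTheory GRing.Theory Num.Theory.

Local Open Scope ring_scope.
Local Open Scope classical_set_scope.
Local Open Scope complex_scope.

(* The parameter n is always the affine_rank, i.e. the vertices are 0, ..., n;
   Aff_A2_even n is A_{2n}^(2), Aff_A2_odd n is A_{2n-1}^(2) and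
   Aff_D2 n is D_{n+1}^(2). *)
Inductive affine_type : Type :=
  | Aff_A1 of nat | Aff_B1 of nat | Aff_C1 of nat | Aff_D1 of nat
  | Aff_E61 | Aff_E71 | Aff_E81 | Aff_F41 | Aff_G21
  | Aff_A2_even of nat | Aff_A2_odd of nat | Aff_D2 of nat
  | Aff_E62 | Aff_D43.

Definition admissible (X : affine_type) : bool :=
  match X with
  | Aff_A1 n => (1 <= n)%N
  | Aff_B1 n => (3 <= n)%N
  | Aff_C1 n => (2 <= n)%N
  | Aff_D1 n => (4 <= n)%N
  | Aff_A2_even n => (2 <= n)%N
  | Aff_A2_odd n => (3 <= n)%N
  | Aff_D2 n => (3 <= n)%N
  | _ => true
  end.

Definition affine_rank (X : affine_type) : nat :=
  match X with
  | Aff_A1 n | Aff_B1 n | Aff_C1 n | Aff_D1 n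
  | Aff_A2_even n | Aff_A2_odd n | Aff_D2 n => n
  | Aff_E61 => 6 | Aff_E71 => 7 | Aff_E81 => 8
  | Aff_F41 => 4 | Aff_G21 => 2 | Aff_E62 => 4 | Aff_D43 => 2
  end%N.

Definition dual_coxeter (X : affine_type) : nat :=
  match X with
  | Aff_A1 n => n + 1
  | Aff_B1 n => 2 * n - 1
  | Aff_C1 n => n + 1
  | Aff_D1 n => 2 * n - 2
  | Aff_E61 => 12 | Aff_E71 => 18 | Aff_E81 => 30
  | Aff_F41 => 9 | Aff_G21 => 4
  | Aff_A2_even n => 2 * n + 1
  | Aff_A2_odd n => 2 * n
  | Aff_D2 n => 2 * n
  | Aff_E62 => 12 | Aff_D43 => 6
  end%N.

(* Vertices are numbered as in Kac.  A bond (i, j, p, q) of the Dynkin diagram means a_ij = - p, a_ji = - q,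
   where a_ij = <alpha_j, alpha_i^vee>. *)
Definition bond : Type := (nat * nat * nat * nat)%type.

Definition chain (i m : nat) : seq bond := [seq (j, j.+1, 1, 1)%N | j <- iota i m].

Definition affine_bonds (X : affine_type) : seq bond :=
  match X with
  | Aff_A1 n => if n == 1 then [:: (0, 1, 2, 2)]
                else (0, n, 1, 1) :: chain 0 n
  | Aff_B1 n => (0, 2, 1, 1) :: (n - 1, n, 1, 2) :: chain 1 (n - 2)
  | Aff_C1 n => (0, 1, 1, 2) :: (n - 1, n, 2, 1) :: chain 1 (n - 2)
  | Aff_D1 n => (0, 2, 1, 1) :: (n - 2, n, 1, 1) :: chain 1 (n - 2)
  | Aff_E61 => (0, 6, 1, 1) :: (3, 6, 1, 1) :: chain 1 4
  | Aff_E71 => (3, 7, 1, 1) :: chain 0 6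
  | Aff_E81 => (5, 8, 1, 1) :: chain 0 7
  | Aff_F41 => [:: (0, 1, 1, 1); (1, 2, 1, 1); (2, 3, 1, 2); (3, 4, 1, 1)]
  | Aff_G21 => [:: (0, 1, 1, 1); (1, 2, 1, 3)]
  | Aff_A2_even n => (0, 1, 2, 1) :: (n - 1, n, 2, 1) :: chain 1 (n - 2)
  | Aff_A2_odd n => (0, 2, 1, 1) :: (n - 1, n, 2, 1) :: chain 1 (n - 2)
  | Aff_D2 n => (0, 1, 2, 1) :: (n - 1, n, 1, 2) :: chain 1 (n - 2)
  | Aff_E62 => [:: (0, 1, 1, 1); (1, 2, 1, 1); (2, 3, 2, 1); (3, 4, 1, 1)]
  | Aff_D43 => [:: (0, 1, 1, 1); (1, 2, 3, 1)]
  end%N.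

Definition bond_entry (i j : nat) (b : bond) : nat :=
  let: (u, v, p, q) := b in
  if (u == i) && (v == j) then p else if (u == j) && (v == i) then q else 0%N.

Definition affine_entry (X : affine_type) (i j : nat) : int :=
  if i == j then 2 else - (sumn [seq bond_entry i j b | b <- affine_bonds X])%:Z.

Definition affine_cartan (X : affine_type) : 'M[int]_((affine_rank X).+1) :=
  \matrix_(i, j) affine_entry X i j.

Definition finite_cartan (X : affine_type) : 'M[int]_(affine_rank X) :=
  row' ord0 (col' ord0 (affine_cartan X)).

(* X_N^(1) and A_{2n}^(2) *)
Definition form_case (X : affine_type) : bool :=
  match X with
  | Aff_A2_odd _ | Aff_D2 _ | Aff_E62 | Aff_D43 => false
  | _ => true
  end.

Definition theta_norm (X : affine_type) : nat :=
  if X is Aff_A2_even _ then 4 else 2.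

(* Elements of the dual Cartan subalgebra are row vectors of coordinates in the
   basis of fundamental weights, so that P is 'rV[int]_n; the simple root
   alpha_i is then the i-th column of the Cartan matrix. *)
Section RootData.
Variables (n : nat) (A : 'M[int]_n).

Definition simple_root (i : 'I_n) : 'rV[int]_n := \row_j A j i.

(* v *m simple_reflection i = v - <v, alpha_i^vee> alpha_i *)
Definition simple_reflection (i : 'I_n) : 'M[int]_n :=
  1%:M - delta_mx i (@ord0 0) *m simple_root i.

Definition weyl_word (s : seq 'I_n) : 'M[int]_n :=
  \big[mulmx/1%:M]_(i <- s) simple_reflection i.

Definition weyl_group : set 'M[int]_n := range weyl_word.

Definition weyl_length (w : 'M[int]_n) : nat :=
  xget 0%N [set m | (exists2 s, size s = m & weyl_word s = w) /\
                    forall s, weyl_word s = w -> (m <= size s)%N].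

Definition is_root (b : 'rV[int]_n) : Prop :=
  exists i, exists2 w, weyl_group w & b = simple_root i *m w.

(* Conversion from coordinates in the simple roots to coordinates in the
   fundamental weights. *)
Definition root_lattice (b : 'rV[int]_n) : 'rV[int]_n := b *m A^T.

(* b is the vector of coordinates in the simple roots. *)
Definition is_highest_root (b : 'rV[int]_n) : Prop :=
  is_root (root_lattice b) /\
  forall c, is_root (root_lattice c) -> forall i, c 0 i <= b 0 i.

End RootData.

Definition dominant (n : nat) (v : 'rV[int]_n) : Prop := forall i, 0 <= v 0 i.

(* rho in fundamental weights, rho^vee in fundamental coweights *)
Definition rho (n : nat) : 'rV[int]_n := const_mx 1.

Section RealCoordinates.
Variables (R : realType) (n : nat).

Definition real_vec (v : 'rV[int]_n) : 'rV[R]_n := map_mx intr v.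

(* Pairing of h^* (coordinates in fundamental weights) with h (coordinates in
   simple coroots). *)
Definition pairing (x h : 'rV[R]_n) : R := (x *m h^T) 0 0.

(* The bilinear form on h^* with Gram matrix G in fundamental weights. *)
Definition bform (G : 'M[R]_n) (x y : 'rV[R]_n) : R := (x *m G *m y^T) 0 0.

(* Conversion from coordinates in the fundamental coweights (the basis dual to
   the simple roots) to coordinates in the simple coroots. *)
Definition coweight (A : 'M[int]_n) (m : 'rV[int]_n) : 'rV[R]_n :=
  real_vec m *m invmx (map_mx intr A).

Definition expi (x : R) : R[i] := cos x +i* sin x.

End RealCoordinates.

Lemma expiD (R : realType) (x y : R) : expi (x + y) = expi x * expi y.
Proof.
by rewrite /expi cosD sinD; congr Complex; rewrite addrC [sin x * _]mulrC.
Qed.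

Lemma expi_neq0 (R : realType) (x : R) : expi x != 0.
Proof.
apply/eqP => -[c0 s0]; have := cos2Dsin2 x.
by rewrite c0 s0 expr0n /= addr0 => /eqP; rewrite eq_sym oner_eq0.
Qed.

(* The highest root theta (in simple roots), the highest coroot (in simple
   coroots) and, where it is used, the normalized invariant form. *)
Record root_datum (R : realType) (X : affine_type) := RootDatum {
  theta : 'rV[int]_(affine_rank X);
  theta_highest : is_highest_root (finite_cartan X) theta;
  highest_coroot : 'rV[int]_(affine_rank X);
  highest_corootP : is_highest_root (finite_cartan X)^T highest_coroot;
  form : 'M[R]_(affine_rank X);
  form_sym : form_case X -> form^T = form;
  form_invariant : form_case X ->
    forall w, weyl_group (finite_cartan X) w -> forall x y : 'rV[R]_(affine_rank X),
      bform form (x *m map_mx intr w) (y *m map_mx intr w) = bform form x y;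
  form_normalized : form_case X ->
    let th := real_vec R (root_lattice (finite_cartan X) theta) in
    bform form th th = (theta_norm X)%:R
}.

Section Fusion.
Variables (R : realType) (X : affine_type) (D : root_datum R X) (k : nat).
Let A := finite_cartan X.
Let n := affine_rank X.

(* theta^vee in simple coroots; kappa^-1 (theta) is the vector h such that
   <x, h> = (x | theta) for all x. *)
Definition theta_check : 'rV[R]_n :=
  if form_case X then real_vec R (root_lattice A (theta D)) *m form D
  else real_vec R (highest_coroot D).

Definition level (lam : 'rV[int]_n) : R := pairing (real_vec R lam) theta_check.

Definition P_level : set 'rV[int]_n :=
  [set lam | dominant lam /\ level lam <= k%:R].

(* in coordinates in the fundamental coweights *)
Definition coP_level : set 'rV[int]_n :=
  [set m | dominant m /\ \sum_i m 0 i * theta D 0 i <= k%:Z].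

Definition torus : set ('rV[int]_n -> R[i]) :=
  [set t | (forall mu, t mu != 0) /\
           (forall mu nu, t (mu + nu) = t mu * t nu)].

Definition two_pi_over : R := 2 * pi / (k + dual_coxeter X)%:R.

Definition form_point (lam mu : 'rV[int]_n) : R[i] :=
  expi (two_pi_over *
        bform (form D) (real_vec R (rho n + lam)) (real_vec R mu)).

Definition coweight_point (m mu : 'rV[int]_n) : R[i] :=
  expi (two_pi_over * pairing (real_vec R mu) (coweight R A (rho n + m))).

Definition Sigma : set ('rV[int]_n -> R[i]) :=
  if form_case X then form_point @` P_level else coweight_point @` coP_level.

Lemma Sigma_torus : Sigma `<=` torus.
Proof.
have rD (mu nu : 'rV[int]_n) :
    real_vec R (mu + nu) = real_vec R mu + real_vec R nu by exact: map_mxD.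
rewrite /Sigma; case: ifP => _ _ [v _ <-]; split => [mu|mu nu].
- exact: expi_neq0.
- rewrite /form_point -expiD -mulrDr; congr (expi (_ * _)).
  by rewrite /bform (rD mu) linearD mulmxDr [LHS]mxE.
- exact: expi_neq0.
- rewrite /coweight_point -expiD -mulrDr; congr (expi (_ * _)).
  by rewrite /pairing (rD mu) mulmxDl [LHS]mxE.
Qed.

(* The sum ranges over the support, so it is the sum over weyl_group as soon as
   that group is finite, which it is for the Cartan matrices considered. *)
Definition alternant (lam : 'rV[int]_n) (t : 'rV[int]_n -> R[i]) : R[i] :=
  \sum_(w \in weyl_group A)
    ((-1) ^+ weyl_length A w * t ((lam + rho n) *m w)).

Definition chi (lam : 'rV[int]_n) (t : 'rV[int]_n -> R[i]) : R[i] :=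
  alternant lam t / alternant 0 t.

(* The structure constants, in the basis chi, of the ring of functions on
   Sigma; values of c outside P_level are irrelevant. *)
Definition fusion_coefficients
    (c : 'rV[int]_n -> 'rV[int]_n -> 'rV[int]_n -> R[i]) : Prop :=
  forall lam mu, P_level lam -> P_level mu -> forall t, Sigma t ->
    chi lam t * chi mu t = \sum_(nu \in P_level) (c lam mu nu * chi nu t).

End Fusion.

Record lieAlgebra (F : fieldType) := LieAlgebra {
  lie_sort :> vectType F;
  lie_bracket : lie_sort -> lie_sort -> lie_sort;
  lie_bracket_linearl : forall y, linear (lie_bracket^~ y);
  lie_bracket_linearr : forall x, linear (lie_bracket x);
  lie_bracketxx : forall x, lie_bracket x x = 0;
  lie_jacobi : forall x y z,
    lie_bracket x (lie_bracket y z) + lie_bracket y (lie_bracket z x)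
      + lie_bracket z (lie_bracket x y) = 0
}.

Section Lie.
Variables (F : fieldType) (L : lieAlgebra F).
Local Notation "[[ x , y ]]" := (@lie_bracket F L x y) (at level 0).

Definition lie_ideal (I : {vspace L}) : Prop :=
  forall x y, y \in I -> [[x, y]] \in I.

Definition lie_subalgebra (S : {vspace L}) : Prop :=
  forall x y, x \in S -> y \in S -> [[x, y]] \in S.

Definition simple_lie : Prop :=
  (exists x y, [[x, y]] != 0) /\
  forall I : {vspace L}, lie_ideal I -> I = 0%VS \/ I = fullv.

(* Together with simple_lie this determines L up to isomorphism: L is then the
   quotient of the Lie algebra with these generators and relations by its
   largest proper ideal (A being indecomposable and invertible). *)
Record chevalley_generators (n : nat) (A : 'M[int]_n) (e f : 'I_n -> L) : Prop :=
  ChevalleyGenerators {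
  chev_ef : forall i j, i != j -> [[e i, f j]] = 0;
  chev_hh : forall i j, [[ [[e i, f i]], [[e j, f j]] ]] = 0;
  chev_he : forall i j, [[ [[e i, f i]], e j ]] = (A i j)%:~R *: e j;
  chev_hf : forall i j, [[ [[e i, f i]], f j ]] = - ((A i j)%:~R *: f j);
  chev_gen : forall S : {vspace L}, lie_subalgebra S ->
    (forall i, e i \in S /\ f i \in S) -> S = fullv
}.

(* L acts on F^d = 'cV[F]_d on the left. *)
Record lie_rep (d : nat) := LieRep {
  rep_fun :> L -> 'M[F]_d;
  rep_linear : linear rep_fun;
  rep_bracket : forall x y,
    rep_fun [[x, y]] = rep_fun x *m rep_fun y - rep_fun y *m rep_fun x
}.

Definition irreducible_rep (d : nat) (V : lie_rep d) : Prop :=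
  (0 < d)%N /\
  forall U : {vspace 'cV[F]_d},
    (forall x v, v \in U -> V x *m v \in U) -> U = 0%VS \/ U = fullv.

Definition is_irrep (n : nat) (e f : 'I_n -> L) (lam : 'rV[int]_n)
    (d : nat) (V : lie_rep d) : Prop :=
  irreducible_rep V /\
  exists2 v : 'cV[F]_d, v != 0 &
    forall i, V (e i) *m v = 0 /\ V [[e i, f i]] *m v = (lam 0 i)%:~R *: v.

Section Tensor.
Variables (d1 d2 : nat) (V : lie_rep d1) (W : lie_rep d2).

Definition tensor_fun (x : L) : 'M[F]_(d1 * d2) := V x *t 1%:M + 1%:M *t W x.

Fact tensor_linear : linear tensor_fun.
Proof.
move=> a x y; apply/matrixP => i j; rewrite /tensor_fun !rep_linear !mxE; ring.
Qed.

Fact tensor_bracket (x y : L) :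
  tensor_fun [[x, y]] =
    tensor_fun x *m tensor_fun y - tensor_fun y *m tensor_fun x.
Proof.
rewrite /tensor_fun !mulmxDl !mulmxDr !tensmx_mul !mul1mx !mulmx1 !rep_bracket.
by apply/matrixP => i j; rewrite !mxE; ring.
Qed.

Definition tensor_rep : lie_rep (d1 * d2) :=
  LieRep tensor_linear tensor_bracket.

Definition intertwining_defect (x : L) (phi : 'M[F]_(d2, d1)) : 'M[F]_(d2, d1) :=
  W x *m phi - phi *m V x.

Definition rep_hom : {vspace 'M[F]_(d2, d1)} :=
  (\bigcap_(i < \dim {:L})
     lker (linfun (intertwining_defect (vbasis {:L})`_i)))%VS.

Fact intertwining_defect_linear (x : L) : linear (intertwining_defect x).
Proof.
move=> a phi psi; rewrite /intertwining_defect.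
by rewrite mulmxDr mulmxDl -scalemxAr -scalemxAl scalerBr opprD addrACA.
Qed.

HB.instance Definition _ (x : L) :=
  GRing.isLinear.Build F _ _ _ (intertwining_defect x)
    (intertwining_defect_linear x).

Lemma mem_rep_hom (phi : 'M[F]_(d2, d1)) :
  phi \in rep_hom <-> forall x, W x *m phi = phi *m V x.
Proof.
split=> [phiP x|phiP].
  have bP (i : 'I_(\dim {:L})) :
      W (vbasis {:L})`_i *m phi = phi *m V (vbasis {:L})`_i.
    have := subvP (bigcapv_inf i isT (subvv _)) phi phiP.
    by rewrite memv_ker lfunE /= subr_eq0 => /eqP.
  pose dft y := intertwining_defect y phi.
  have dft_lin : linear dft.
    move=> a y z; rewrite /dft /intertwining_defect !rep_linear.
    by rewrite mulmxDl mulmxDr -scalemxAl -scalemxAr scalerBr opprD addrACA.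
  pose dftL := GRing.isLinear.Build F _ _ _ dft dft_lin.
  pose g : {linear L -> 'M[F]_(d2, d1)} := HB.pack dft dftL.
  suff : g x = 0 by move/eqP; rewrite subr_eq0 => /eqP.
  rewrite (coord_vbasis (memvf x)) linear_sum big1 // => i _.
  by rewrite linearZ /= /dft /intertwining_defect bP subrr scaler0.
rewrite /rep_hom; elim/big_ind: _ => [|U1 U2 ? ?|i _].
- exact: memvf.
- by rewrite memv_cap; apply/andP.
- by rewrite memv_ker lfunE /= /intertwining_defect phiP subrr.
Qed.

End Tensor.
End Lie.

(* Main.v *)
(* Let N = k + h.  Evaluated at a point of Sigma, the alternating sum J_x of the
   characters e^(xw) depends only on x up to sign under the affine Weyl group
   W |x N M, where M is the lattice spanned by the coroots (or, for the twisted
   types, the roots), so J_x is 0 or J_(nu + rho) up to sign for some nu in P_k.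
   By independence of characters on the dual lattice, the J_(nu + rho) with nu in
   P_k are linearly independent on Sigma, which determines c.  Since
   J_(lam + rho) / J_rho is an integral combination of Weyl orbit sums,
   multiplication by it sends J_(mu + rho) to an integral combination of J_x's,
   and (1) follows.

   For (2), J_rho times the character of V_lam (x) V_mu is the sum over dominant
   nu' of r(nu') J_(nu' + rho), where r(nu') is the dimension of the space of
   singular vectors of weight nu'; this is Weyl's character formula applied to
   tensor products, obtained as in Freudenthal's argument from the trace of the
   Casimir operator on weight spaces, and the same operator gives
   r(nu') = dim Hom(V_nu', V_lam (x) V_mu).  If nu' <> nu has the same affine
   orbit as nu in P_k (after adding rho), then
   level(nu' + rho) + level(nu + rho) >= 2N, which the bound on
   level(lam + mu + nu) excludes; so c is r(nu).

   Finiteness of the Weyl group, coherence of the signs of roots and the facts on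
   dominant weights follow from the Cartan matrix and the existence of a highest
   root alone; the type enters only through the coordinates of theta. *)

Require Import Defs.
From mathcomp Require Import all_boot all_order all_algebra.
From mathcomp Require Import all_classical all_reals.
From mathcomp Require Import complex.
From mathcomp Require Import zify ring lra.
From mathcomp Require Import topology normedtype trigo mxtens.
Set Implicit Arguments.
Unset Strict Implicit.
Unset Printing Implicit Defensive.
Import Order.TTheory GRing.Theory Num.Theory.
Local Open Scope ring_scope.
Local Open Scope classical_set_scope.

(** * Words in the simple reflections *)

(** Complete reducibility of modules is replaced by a polynomial in the Casimir operator, the
    projector on a generalized eigenspace. It maps the weight space of [nu] onto the singular
    vectors and vanishes on weight spaces above [nu], since a dominant weight above [nu] has another
    eigenvalue; so its trace counts singular vectors. Freudenthal's identity, which holds for the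
    trace of any operator commuting with the action, exchanges this projector for the identity, and
    weight multiplicities remain. In an irreducible module the singular vectors form a line, and the
    count becomes Weyl's character formula. The roots of the Lie algebra are weights of iterated
    brackets, taken with multiplicity; the denominator identity asks only that each s_i permute the
    positive ones after one alpha_i is removed. On the torus, weights and points play symmetric
    roles: both carry an affine Weyl group, a pairing [e y x] connects them, and J is alternating in
    both variables. Untwisted and twisted types then differ only in the pairing and in the two
    alcoves. *)

Section IntRows.
Variable n : nat.
Implicit Types (x y : 'rV[int]_n) (l : 'I_n).

Lemma rowDE x y l : (x + y) 0 l = x 0 l + y 0 l.
Proof. by rewrite mxE. Qed.

Lemma rowNE x l : (- x) 0 l = - x 0 l.
Proof. by rewrite mxE. Qed.

Lemma rowBE x y l : (x - y) 0 l = x 0 l - y 0 l.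
Proof. by rewrite !mxE. Qed.

Lemma rowZE (k : int) x l : (k *: x) 0 l = k * x 0 l.
Proof. by rewrite mxE. Qed.

Lemma row0E l : (0 : 'rV[int]_n) 0 l = 0.
Proof. by rewrite mxE. Qed.

Lemma rowdE l l' : (delta_mx 0 l : 'rV[int]_n) 0 l' = (l' == l)%:R.
Proof. by rewrite mxE. Qed.

Definition rowE_ := (rowBE, rowDE, rowNE, rowZE, row0E, rowdE).
End IntRows.

Section WeylWords.
Variables (n : nat) (A : 'M[int]_n).
Implicit Types (s : seq 'I_n) (i j : 'I_n) (x c : 'rV[int]_n).

Lemma mulmx_reflection i x :
  x *m simple_reflection A i = x - x 0 i *: simple_root A i.
Proof.
rewrite /simple_reflection mulmxBr mulmx1 mulmxA; congr (_ - _).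
have -> : x *m delta_mx i 0 = (x 0 i)%:M :> 'M_1.
  apply/matrixP=> a b; rewrite !ord1 !mxE (bigD1 i) //= !mxE !eqxx mulr1.
  by rewrite big1 ?addr0 // => j /negPf ji; rewrite mxE ji mulr0.
by rewrite mul_scalar_mx.
Qed.

Lemma weyl_word_nil : weyl_word A [::] = 1%:M.
Proof. by rewrite /weyl_word big_nil. Qed.

Lemma weyl_word_cons i s :
  weyl_word A (i :: s) = simple_reflection A i *m weyl_word A s.
Proof. by rewrite /weyl_word big_cons. Qed.

Lemma weyl_word1 i : weyl_word A [:: i] = simple_reflection A i.
Proof. by rewrite weyl_word_cons weyl_word_nil mulmx1. Qed.

Lemma weyl_word_cat s1 s2 :
  weyl_word A (s1 ++ s2) = weyl_word A s1 *m weyl_word A s2.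
Proof.
elim: s1 => [|i s1 IH] /=; first by rewrite weyl_word_nil mul1mx.
by rewrite !weyl_word_cons IH mulmxA.
Qed.

Lemma weyl_word_rcons s i :
  weyl_word A (rcons s i) = weyl_word A s *m simple_reflection A i.
Proof. by rewrite -cats1 weyl_word_cat weyl_word1. Qed.

Lemma weyl_group1 : weyl_group A 1%:M.
Proof. by exists [::]; rewrite ?weyl_word_nil. Qed.

Lemma weyl_group_word s : weyl_group A (weyl_word A s).
Proof. by exists s. Qed.

Lemma weyl_group_reflection i : weyl_group A (simple_reflection A i).
Proof. by exists [:: i]; rewrite ?weyl_word1. Qed.

Lemma weyl_groupM w1 w2 :
  weyl_group A w1 -> weyl_group A w2 -> weyl_group A (w1 *m w2).
Proof.
by move=> [s1 _ <-] [s2 _ <-]; exists (s1 ++ s2); rewrite ?weyl_word_cat.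
Qed.

Lemma simple_rootE i j : simple_root A i 0 j = A j i.
Proof. by rewrite mxE. Qed.

Lemma root_lattice_delta i : root_lattice A (delta_mx 0 i) = simple_root A i.
Proof. by apply/rowP => j; rewrite /root_lattice -rowE !mxE. Qed.

Lemma root_latticeE c : root_lattice A c = \sum_i c 0 i *: simple_root A i.
Proof.
rewrite {1}[c]row_sum_delta /root_lattice mulmx_suml; apply: eq_bigr => i _.
by rewrite -scalemxAl -[delta_mx 0 i *m _]/(root_lattice A _) root_lattice_delta.
Qed.

Lemma root_latticeD c1 c2 :
  root_lattice A (c1 + c2) = root_lattice A c1 + root_lattice A c2.
Proof. by rewrite /root_lattice mulmxDl. Qed.

Lemma root_latticeB c1 c2 :
  root_lattice A (c1 - c2) = root_lattice A c1 - root_lattice A c2.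
Proof. by rewrite /root_lattice mulmxBl. Qed.

Lemma root_latticeN c : root_lattice A (- c) = - root_lattice A c.
Proof. by rewrite /root_lattice mulNmx. Qed.

Lemma root_latticeZ k c : root_lattice A (k *: c) = k *: root_lattice A c.
Proof. by rewrite /root_lattice -scalemxAl. Qed.

Lemma root_lattice0 : root_lattice A 0 = 0.
Proof. by rewrite /root_lattice mul0mx. Qed.

Lemma root_lattice_coord c j : root_lattice A c 0 j = \sum_i A j i * c 0 i.
Proof. by rewrite !mxE; apply: eq_bigr => i _; rewrite mxE mulrC. Qed.

Lemma is_root_simple i : is_root A (simple_root A i).
Proof. by exists i, 1%:M; rewrite ?mulmx1 //; exact: weyl_group1. Qed.

Lemma is_rootM b w : is_root A b -> weyl_group A w -> is_root A (b *m w).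
Proof.
move=> [i [v Wv ->] ] Ww; exists i, (v *m w); last by rewrite mulmxA.
exact: weyl_groupM.
Qed.

End WeylWords.

Section Transpose.
Variables (n : nat) (A : 'M[int]_n).

(** Multiplication by [A^T] turns root coordinates into weight coordinates, and it intertwines the
    reflections of [A] with the transposed reflections of [A^T]: root coordinates are governed by
    the dual system. *)
Lemma simple_reflection_tr i :
  A^T *m simple_reflection A i = (simple_reflection A^T i)^T *m A^T.
Proof.
have -> : (simple_reflection A^T i)^T =
    1%:M - (simple_root A^T i)^T *m (delta_mx 0 i : 'rV_n).
  apply/matrixP => a b; rewrite !mxE !big_ord1 !mxE !eqxx andbT /=.
  by rewrite eq_sym [X in _ - X]mulrC.
rewrite mulmxBr mulmxBl mulmx1 mul1mx mulmxA -[in RHS]mulmxA.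
congr (_ - _ *m _).
  by rewrite -colE; apply/matrixP => a b; rewrite !mxE.
by rewrite -root_lattice_delta.
Qed.

Lemma weyl_word_tr s :
  A^T *m weyl_word A s = (weyl_word A^T (rev s))^T *m A^T.
Proof.
elim: s => [|i s IH]; first by rewrite !weyl_word_nil trmx1 mulmx1 mul1mx.
rewrite weyl_word_cons mulmxA simple_reflection_tr -mulmxA IH mulmxA.
by rewrite rev_cons weyl_word_rcons trmx_mul.
Qed.

Lemma root_lattice_word c s :
  root_lattice A c *m weyl_word A s =
  root_lattice A (c *m (weyl_word A^T (rev s))^T).
Proof. by rewrite /root_lattice -!mulmxA weyl_word_tr. Qed.

Lemma root_lattice_reflection c i :
  root_lattice A c *m simple_reflection A i =
  root_lattice A (c - root_lattice A c 0 i *: delta_mx 0 i).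
Proof.
by rewrite mulmx_reflection root_latticeB root_latticeZ root_lattice_delta.
Qed.

Lemma root_lattice_weyl c w : weyl_group A w ->
  exists c', root_lattice A c *m w = root_lattice A c'.
Proof. by case=> s _ <-; rewrite root_lattice_word; eexists. Qed.

End Transpose.

Section DiagTwo.
Variables (n : nat) (A : 'M[int]_n).
Hypothesis A2 : forall i, A i i = 2.

Lemma simple_reflectionK i : simple_reflection A i *m simple_reflection A i = 1%:M.
Proof.
apply/row_matrixP => k; rewrite !rowE mulmx1 mulmxA !mulmx_reflection.
rewrite mxE [X in _ - _ + X]/(-_) !mxE A2; apply/rowP => l; rewrite !mxE; ring.
Qed.

Lemma weyl_word_rev s : weyl_word A s *m weyl_word A (rev s) = 1%:M.
Proof.
elim: s => [|i s IH]; first by rewrite !weyl_word_nil mul1mx.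
rewrite weyl_word_cons rev_cons weyl_word_rcons mulmxA -(mulmxA (simple_reflection A i)).
by rewrite IH mulmx1 simple_reflectionK.
Qed.

Lemma weyl_group_unit w : weyl_group A w -> w \in unitmx.
Proof. by case=> s _ <-; case: (mulmx1_unit (weyl_word_rev s)). Qed.

Lemma weyl_group_inv w : weyl_group A w -> weyl_group A (invmx w).
Proof.
move=> Ww; have Uw := weyl_group_unit Ww; case: Ww => s _ sw; exists (rev s) => //.
have := weyl_word_rev s; rewrite sw => /(congr1 (mulmx (invmx w))).
by rewrite mulmxA mulVmx // mul1mx mulmx1.
Qed.

Lemma simple_root_reflection i : simple_root A i *m simple_reflection A i = - simple_root A i.
Proof. by rewrite mulmx_reflection simple_rootE A2; apply/rowP => j; rewrite !mxE; ring. Qed.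

Lemma is_rootN b : is_root A b -> is_root A (- b).
Proof.
move=> [i [w Ww ->] ]; exists i, (simple_reflection A i *m w).
  exact: weyl_groupM (weyl_group_reflection _ _) Ww.
by rewrite mulmxA simple_root_reflection mulNmx.
Qed.

(** Both sides are the determinant of the bordered matrix [M], computed by eliminating its blocks in
    either order. *)
Lemma det_1Bmul (u : 'cV[int]_n) (v : 'rV[int]_n) :
  \det (1%:M - u *m v) = 1 - (v *m u) 0 0.
Proof.
pose M := block_mx 1%:M u v (1%:M : 'M_1).
have E1 : M = block_mx 1%:M 0 v 1%:M *m block_mx 1%:M u 0 (1%:M - v *m u).
  rewrite mulmx_block !(mulmx1, mul1mx, mul0mx, mulmx0, addr0).
  by rewrite addrCA subrr addr0.
have E2 : M = block_mx (1%:M - u *m v) u 0 1%:M *m block_mx 1%:M 0 v 1%:M.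
  by rewrite mulmx_block !(mulmx1, mul1mx, mul0mx, mulmx0, add0r) subrK.
have := congr1 determinant E2; rewrite E1 !det_mulmx !det_lblock !det_ublock.
by rewrite !det1 !(mul1r, mulr1) => <-; rewrite det_mx11 !mxE.
Qed.

Lemma det_simple_reflection i : \det (simple_reflection A i) = -1.
Proof.
rewrite /simple_reflection det_1Bmul -colE mxE simple_rootE A2; ring.
Qed.

End DiagTwo.

(** * Finiteness of the Weyl group *)

(** [d] gives the squared lengths of the simple roots up to a common factor, 1 for short and [m] for
    long ones; [th] and [et] are the highest root and the highest coroot in simple coordinates. *)
Record finite_type n (A : 'M[int]_n) (d : 'I_n -> int) (m : int)
    (th et : 'rV[int]_n) : Prop := FiniteType {
  ft_diag : forall i, A i i = 2;
  ft_off : forall i j, i != j -> A i j <= 0;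
  ft_m : 0 < m;
  ft_len : forall i, d i = 1 \/ d i = m;
  ft_sym : forall i j, d i * A i j = d j * A j i;
  ft_high : is_highest_root A th;
  ft_cohigh : is_highest_root A^T et
}.

(** In the dual system long and short are exchanged: the new symmetrizer is [m / d i]. *)
Lemma finite_type_tr n (A : 'M[int]_n) d m th et : finite_type A d m th et ->
  finite_type A^T (fun i => if d i == 1 then m else 1) m et th.
Proof.
case=> A2 Aoff m0 dm Asym hth het; split => //.
- by move=> i; rewrite mxE.
- by move=> i j ij; rewrite mxE Aoff // eq_sym.
- by move=> i; case: ifP => _; [right | left].
- move=> i j; rewrite !mxE; have := Asym i j.
  case: eqP => [->|i1]; case: eqP => [->|j1].
  + by rewrite !mul1r => ->.
  + by case: (dm j) => [/j1 //|->]; rewrite !mul1r => ->.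
  + by case: (dm i) => [/i1 //|->]; rewrite !mul1r => ->.
  + case: (dm i) => [/i1 //|->]; case: (dm j) => [/j1 //|->].
    by move/(mulfI (lt0r_neq0 m0)) ->.
- by rewrite trmxK.
Qed.

Section Dot.
Variable n : nat.
Definition dot (x y : 'rV[int]_n) : int := \sum_j x 0 j * y 0 j.

Lemma dot_ge0 x : 0 <= dot x x.
Proof. by apply: sumr_ge0 => j _; rewrite -expr2 sqr_ge0. Qed.

Lemma dot_gt0 x : x != 0 -> 0 < dot x x.
Proof.
move=> x0; rewrite lt_neqAle dot_ge0 andbT eq_sym; apply: contra x0.
rewrite psumr_eq0 => [/allP h|j _]; last by rewrite -expr2 sqr_ge0.
apply/eqP/rowP => j; rewrite mxE; apply/eqP.
by have := h j (mem_index_enum _); rewrite mulf_eq0 orbb.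
Qed.

(** Off-diagonal terms come in equal pairs, so only the diagonal matters for parity. *)
Lemma sum_symmetric_even (S : 'I_n -> 'I_n -> int) :
  (forall i j, S i j = S j i) -> (forall i, exists e, S i i = 2 * e) ->
  exists e, \sum_i \sum_j S i j = 2 * e.
Proof.
move=> Ssym /boolp.choice [f Sf].
exists (\sum_i f i + \sum_(i < n) \sum_(j < n | (j < i)%N) S i j).
have -> : \sum_i \sum_j S i j = \sum_(i < n) (2 * f i +
    (\sum_(j < n | (j < i)%N) S i j + \sum_(j < n | (i < j)%N) S i j)).
  apply: eq_bigr => i _; rewrite (bigD1 i) //= Sf; congr (_ + _).
  rewrite (bigID (fun j : 'I_n => (j < i)%N)) /=; congr (_ + _).
    by apply: eq_bigl => j; rewrite -val_eqE /=; lia.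
  by apply: eq_bigl => j; rewrite -val_eqE /=; lia.
rewrite big_split /= -mulr_sumr big_split /=.
rewrite [X in _ + (_ + X)](_ : _ = \sum_(i < n) \sum_(j < n | (j < i)%N) S i j); first ring.
rewrite (exchange_big_dep xpredT) //=; apply: eq_bigr => i _.
by apply: eq_bigr => j _.
Qed.

End Dot.

Section Finite.
Variables (n : nat) (A : 'M[int]_n) (th : 'rV[int]_n).
Hypothesis hth : is_highest_root A th.
Hypothesis A2 : forall i, A i i = 2.

(* If [A z = 0] then [th + z] and [th - z] represent the same root as [th]. *)
Lemma root_lattice_inj : injective (root_lattice A).
Proof.
have z0 z : root_lattice A z = 0 -> z = 0.
  move=> Az; case: hth => rth thmax.
  have le z' : root_lattice A z' = 0 -> forall i, z' 0 i <= 0.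
    move=> Az' i; have := thmax (th + z'); rewrite root_latticeD Az' addr0.
    by move=> /(_ rth i); rewrite mxE gerDl.
  apply/rowP => i; rewrite mxE; apply/eqP; rewrite eq_le le //=.
  by rewrite -oppr_le0; have := le (- z); rewrite root_latticeN Az oppr0 => /(_ erefl i); rewrite mxE.
by move=> x y exy; apply/eqP; rewrite -subr_eq0; apply/eqP/z0; rewrite root_latticeB exy subrr.
Qed.

Lemma root_bound c : is_root A (root_lattice A c) ->
  forall i, - th 0 i <= c 0 i <= th 0 i.
Proof.
move=> rc i; have [_ thmax] := hth; rewrite thmax // andbT.
have := thmax (- c); rewrite root_latticeN => /(_ (is_rootN A2 rc) i).
by rewrite mxE lerNl.
Qed.

Lemma highest_ge1 i : 1 <= th 0 i.
Proof.
have := root_bound (c := delta_mx 0 i); rewrite root_lattice_delta.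
by move=> /(_ (is_root_simple A i) i) /andP[_]; rewrite mxE !eqxx.
Qed.

Lemma det_cartan_neq0 : \det A^T != 0.
Proof.
apply/negP => /det0P [v v0 vA]; move: v0; rewrite (@root_lattice_inj v 0) ?eqxx //.
by rewrite root_lattice0.
Qed.

Lemma mul_cartan_inj (w1 w2 : 'M[int]_n) : A^T *m w1 = A^T *m w2 -> w1 = w2.
Proof.
move=> /(congr1 (mulmx (\adj A^T))); rewrite !mulmxA mul_adj_mx !mul_scalar_mx.
exact/scalemx_inj/det_cartan_neq0.
Qed.

(** [w] is determined by the matrix [C] with [A^T *m w = C *m A^T]. Its rows are the root
    coordinates of the images of the simple roots, which [root_bound] confines to a box. *)
Lemma weyl_finite : finite_set (weyl_group A).
Proof.
(* [K] bounds every coordinate of [th]; shifted by [K], the entries of [C] lie between 0 and 2K and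
   fit in an ordinal type. *)
pose K := (\sum_i `|th 0%R i|)%N.
have thK i : th 0 i <= K%:Z.
  have := highest_ge1 i; rewrite /K (bigD1 i) //=; lia.
pose g (M : 'M['I_(K + K)%N.+1]_n) : 'M[int]_n :=
  xget 0 [set w | A^T *m w = map_mx (fun o : 'I__ => (o : nat)%:Z - K%:Z) M *m A^T].
apply: (@sub_finite_set _ _ (g @` [set: 'M['I_(K + K)%N.+1]_n])); last first.
  by apply: finite_image; exact: finite_finset.
move=> w Ww; have [s _ sw] := Ww.
pose C := (weyl_word A^T (rev s))^T.
have CE : A^T *m w = C *m A^T by rewrite -sw weyl_word_tr.
exists (map_mx (fun z : int => inord (absz (z + K%:Z))) C) => //.
rewrite /g -map_mx_comp (_ : map_mx _ _ = C); last first.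
  apply/matrixP => i j; rewrite mxE /=.
  have := @root_bound (row i C).
  have -> : root_lattice A (row i C) = simple_root A i *m w.
    by rewrite /root_lattice -row_mul -CE row_mul -root_lattice_delta /root_lattice -rowE.
  move=> /(_ (is_rootM (is_root_simple A i) Ww) j); rewrite mxE => /andP[l u].
  have kj := thK j; rewrite inordK; first by lia.
  by lia.
apply: mul_cartan_inj; rewrite CE.
exact: (@xgetPex _ 0 [set w | A^T *m w = C *m A^T]) (ex_intro _ w CE).
Qed.

Definition weyl_seq : seq 'M[int]_n := finmap.enum_fset (fset_set (weyl_group A)).

Lemma mem_weyl_seq w : w \in weyl_seq <-> weyl_group A w.
Proof.
rewrite /weyl_seq; split.
  by move=> h; have := in_fset_set weyl_finite w; rewrite h => /esym h'; rewrite -in_setE h'.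
by move=> Ww; rewrite (in_fset_set weyl_finite) in_setE.
Qed.

Lemma uniq_weyl_seq : uniq weyl_seq.
Proof. exact: finmap.fset_uniq. Qed.

Lemma perm_weyl_mull v : weyl_group A v -> perm_eq [seq v *m w | w <- weyl_seq] weyl_seq.
Proof.
move=> Wv; have Uv := weyl_group_unit A2 Wv; apply: uniq_perm.
- rewrite map_inj_uniq ?uniq_weyl_seq // => w1 w2 /(congr1 (mulmx (invmx v))).
  by rewrite !mulmxA mulVmx // !mul1mx.
- exact: uniq_weyl_seq.
move=> w; apply/mapP/idP => [ [u /mem_weyl_seq Wu ->]|/mem_weyl_seq Ww].
  exact/mem_weyl_seq/weyl_groupM.
exists (invmx v *m w); last by rewrite mulmxA mulmxV // mul1mx.
exact/mem_weyl_seq/weyl_groupM/Ww/weyl_group_inv.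
Qed.

Lemma perm_weyl_mulr v : weyl_group A v -> perm_eq [seq w *m v | w <- weyl_seq] weyl_seq.
Proof.
move=> Wv; have Uv := weyl_group_unit A2 Wv; apply: uniq_perm.
- rewrite map_inj_uniq ?uniq_weyl_seq // => w1 w2 /(congr1 (mulmx^~ (invmx v))) /=.
  by rewrite -!mulmxA mulmxV // !mulmx1.
- exact: uniq_weyl_seq.
move=> w; apply/mapP/idP => [ [u /mem_weyl_seq Wu ->]|/mem_weyl_seq Ww].
  exact/mem_weyl_seq/weyl_groupM.
exists (w *m invmx v); last by rewrite -mulmxA mulVmx // mulmx1.
exact/mem_weyl_seq/weyl_groupM/weyl_group_inv.
Qed.

(** The dot product of coordinates, summed over the finite group to make it invariant; it stays
    integral and positive definite. *)
Definition gf (x y : 'rV[int]_n) : int := \sum_(w <- weyl_seq) dot (x *m w) (y *m w).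

Lemma gfC x y : gf x y = gf y x.
Proof. by apply: eq_bigr => w _; apply: eq_bigr => j _; rewrite mulrC. Qed.

Lemma gfDl x1 x2 y : gf (x1 + x2) y = gf x1 y + gf x2 y.
Proof.
rewrite /gf -big_split; apply: eq_bigr => w _; rewrite mulmxDl /dot -big_split.
by apply: eq_bigr => j _; rewrite mxE mulrDl.
Qed.

Lemma gfZl k x y : gf (k *: x) y = k * gf x y.
Proof.
rewrite /gf mulr_sumr; apply: eq_bigr => w _; rewrite -scalemxAl /dot mulr_sumr.
by apply: eq_bigr => j _; rewrite mxE mulrA.
Qed.

Lemma gfNl x y : gf (- x) y = - gf x y.
Proof. by rewrite -scaleN1r gfZl mulN1r. Qed.

Lemma gfBl x1 x2 y : gf (x1 - x2) y = gf x1 y - gf x2 y.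
Proof. by rewrite gfDl gfNl. Qed.

Lemma gfDr x y1 y2 : gf x (y1 + y2) = gf x y1 + gf x y2.
Proof. by rewrite gfC gfDl !(gfC _ x). Qed.

Lemma gfZr k x y : gf x (k *: y) = k * gf x y.
Proof. by rewrite gfC gfZl gfC. Qed.

Lemma gfNr x y : gf x (- y) = - gf x y.
Proof. by rewrite gfC gfNl gfC. Qed.

Lemma gfBr x y1 y2 : gf x (y1 - y2) = gf x y1 - gf x y2.
Proof. by rewrite gfDr gfNr. Qed.

Lemma gf0l x : gf 0 x = 0.
Proof. by rewrite -(scale0r 0) gfZl mul0r. Qed.

Lemma gf_sumr I (r : seq I) (P : pred I) (F : I -> 'rV[int]_n) x :
  gf x (\sum_(i <- r | P i) F i) = \sum_(i <- r | P i) gf x (F i).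
Proof.
apply: (big_morph (gf x)) => [y z|]; first exact: gfDr.
by rewrite gfC gf0l.
Qed.

Lemma gf_weyl v x y : weyl_group A v -> gf (x *m v) (y *m v) = gf x y.
Proof.
move=> Wv; rewrite /gf -[in RHS](perm_big _ (perm_weyl_mull Wv)) big_map.
by apply: eq_bigr => w _; rewrite !mulmxA.
Qed.

Lemma gf_ge0 x : 0 <= gf x x.
Proof. by apply: sumr_ge0 => w _; exact: dot_ge0. Qed.

Lemma gf_gt0 x : x != 0 -> 0 < gf x x.
Proof.
move=> x0; have W1 : 1%:M \in weyl_seq by apply/mem_weyl_seq/weyl_group1.
rewrite /gf (big_rem _ W1) /= mulmx1 ltr_wpDr ?dot_gt0 //.
by apply: sumr_ge0 => w _; exact: dot_ge0.
Qed.

Lemma gf_eq0 x : gf x x = 0 -> x = 0.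
Proof. by move=> h; apply/eqP; apply: contraT => /gf_gt0; rewrite h ltxx. Qed.

Definition g i := gf (simple_root A i) (simple_root A i).

Lemma simple_root_neq0 i : simple_root A i != 0.
Proof. by apply/eqP => /rowP/(_ i); rewrite simple_rootE A2 mxE. Qed.

Lemma g_gt0 i : 0 < g i.
Proof. exact/gf_gt0/simple_root_neq0. Qed.

Lemma gf_simple x i : 2 * gf x (simple_root A i) = x 0 i * g i.
Proof.
have := gf_weyl x (simple_root A i) (weyl_group_reflection A i).
rewrite simple_root_reflection // mulmx_reflection gfNr gfBl gfZl -/(g i); lia.
Qed.

Lemma gf_root x c : 2 * gf x (root_lattice A c) = \sum_j c 0 j * x 0 j * g j.
Proof.
rewrite root_latticeE gf_sumr mulr_sumr; apply: eq_bigr => j _.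
by rewrite gfZr mulrCA gf_simple mulrA.
Qed.

(** Connectedness of the Dynkin diagram as an induction principle. Reflections spread the support of
    a root only to neighbouring vertices, yet they lead from [simple_root A i0] to [th], whose
    support is everything. *)
Lemma highest_connected : exists i0, exists2 w0, weyl_group A w0 &
  root_lattice A th = simple_root A i0 *m w0 /\
  forall P : 'I_n -> Prop, P i0 -> (forall i j, P i -> A j i != 0 -> P j) -> forall j, P j.
Proof.
have [ [i0 [w0 Ww0 thE] ] _] := hth; exists i0, w0 => //; split => // P Pi0 Pstep j.
have [s _ sw0] := Ww0.
have [c thc Pc] : exists2 c, simple_root A i0 *m weyl_word A s = root_lattice A c &
    forall l, c 0 l != 0 -> P l.
  elim/last_ind: s {w0 Ww0 thE sw0} => [|s i [c sc Pc] ].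
    exists (delta_mx 0 i0); first by rewrite weyl_word_nil mulmx1 root_lattice_delta.
    by move=> l; rewrite mxE eqxx /=; case: (l =P i0) => [-> //|_]; rewrite eqxx.
  exists (c - root_lattice A c 0 i *: delta_mx 0 i).
    by rewrite weyl_word_rcons mulmxA sc root_lattice_reflection.
  move=> l; rewrite !mxE eqxx /=; case: (l =P i) => [->|_]; last first.
    by rewrite mulr0 subr0; exact: Pc.
  rewrite mulr1 => h; have [/Pc //|/negbNE/eqP ci] := boolP (c 0 i != 0).
  move: h; rewrite ci add0r oppr_eq0 => h.
  have [q] : exists q, c 0 q * A i q != 0.
    apply/existsP; apply: contraNT h; rewrite negb_exists => /forallP h.
    by rewrite big1 // => q _; rewrite mxE; apply/eqP/negbNE/h.
  by rewrite mulf_eq0 negb_or => /andP[/Pc Pq Aiq]; exact: Pstep Pq Aiq.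
apply: Pc; suff -> : c = th by rewrite gt_eqF // (lt_le_trans _ (highest_ge1 j)).
by apply: root_lattice_inj; rewrite -thc sw0 thE.
Qed.

End Finite.

Lemma seq_max (T : eqType) (s : seq T) (f : T -> int) x0 : x0 \in s ->
  exists2 x, x \in s & forall y, y \in s -> f y <= f x.
Proof.
elim: s x0 => // a [|b s] IH x0 _.
  by exists a; rewrite ?mem_head // => y; rewrite inE => /eqP ->.
have [x xs xmax] := IH b (mem_head _ _).
have [le|lt] := lerP (f a) (f x).
  by exists x; [rewrite inE xs orbT|move=> y; rewrite inE => /predU1P[-> //|/xmax] ].
exists a; first exact: mem_head.
by move=> y; rewrite inE => /predU1P[-> //|/xmax/le_trans]; apply; exact: ltW.
Qed.

(** * Signs of roots, dominance and levels *)

Section Short.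
Variables (n : nat) (A : 'M[int]_n) (d : 'I_n -> int) (m : int) (th et : 'rV[int]_n).
Hypothesis H : finite_type A d m th et.
Implicit Types (x y c : 'rV[int]_n) (w : 'M[int]_n) (i j l : 'I_n).
Let hth := ft_high H.
Let A2 := ft_diag H.
Let gfS := gf_simple hth A2.
Let gfR := gf_root hth A2.
Let gfW := gf_weyl hth A2.

Lemma d_gt0 i : 0 < d i.
Proof. by case: (ft_len H i) => ->; [|exact: ft_m H]. Qed.

Lemma cartan_neq0 i j : A i j != 0 -> A j i != 0.
Proof.
move=> Aij; have /eqP := ft_sym H i j; apply: contraL => /eqP ->.
by rewrite mulr0 mulf_eq0 negb_or Aij gt_eqF // d_gt0.
Qed.

Lemma g_sym i j : A i j * g A i = A j i * g A j.
Proof.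
have := gfS (simple_root A i) j; rewrite simple_rootE => <-.
by rewrite gfC gfS simple_rootE.
Qed.

(** The symmetrizer of a connected Cartan matrix is unique up to a factor; cross multiplication
    keeps the statement inside the integers. *)
Lemma proportional (q : 'I_n -> int) :
  (forall i j, A i j * q i = A j i * q j) -> forall i j, q i * d j = q j * d i.
Proof.
move=> q_sym.
have [i0 [_ _ [_ conn] ] ] := highest_connected hth A2.
have Q : forall j, q i0 * d j = q j * d i0.
  apply: conn => // i j qi Aji.
  have Aij := cartan_neq0 Aji; apply: (mulIf Aji).
  have -> : q i0 * d j * A j i = q i0 * (d j * A j i) by ring.
  rewrite -(ft_sym H).
  have -> : q i0 * (d i * A i j) = (q i0 * d i) * A i j by ring.
  rewrite qi.
  have -> : q i * d i0 * A i j = d i0 * (A i j * q i) by ring.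
  by rewrite q_sym; ring.
move=> i j; apply: (mulIf (lt0r_neq0 (d_gt0 i0))).
have -> : q i * d j * d i0 = (q i * d i0) * d j by ring.
have -> : q j * d i * d i0 = (q j * d i0) * d i by ring.
by rewrite -!Q; ring.
Qed.

Lemma g_proportional i j : g A i * d j = g A j * d i.
Proof. by apply: proportional => // a b; exact: g_sym. Qed.

(** Twice the norm is [g A i] times the sum of [c 0 j * c 0 k * (d j * A j k)], a symmetric sum with
    even diagonal. Hence short roots are shortest nonzero vectors of the root lattice. *)
Lemma gf_short i c : d i = 1 ->
  exists e, gf A (root_lattice A c) (root_lattice A c) = g A i * e.
Proof.
move=> di1; pose S j k := c 0 j * c 0 k * (d j * A j k).
have [|j|e Se] := @sum_symmetric_even n S.
- by move=> j k; rewrite /S (ft_sym H) [c 0 j * _]mulrC.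
- by exists (c 0 j * c 0 j * d j); rewrite /S A2; ring.
exists e; have := gf_root hth A2 (root_lattice A c) c.
rewrite (_ : \sum_j _ = g A i * \sum_j \sum_k S j k).
  by rewrite Se; lia.
rewrite mulr_sumr; apply: eq_bigr => j _.
have -> : g A j = g A i * d j by rewrite g_proportional di1 mulr1.
rewrite root_lattice_coord !mulr_sumr mulr_suml; apply: eq_bigr => k _.
by rewrite /S; ring.
Qed.

Lemma gf_short_ge i (c : 'rV[int]_n) : d i = 1 -> c != 0 ->
  g A i <= gf A (root_lattice A c) (root_lattice A c).
Proof.
move=> di1 c0; have := @gf_gt0 _ _ _ hth A2 (root_lattice A c).
have -> : root_lattice A c != 0.
  apply: contra c0 => /eqP cE; apply/eqP/(root_lattice_inj hth).
  by rewrite cE root_lattice0.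
move=> /(_ isT); have [e ->] := gf_short c di1; have := g_gt0 hth A2 i => gi.
rewrite pmulr_rgt0 // => e0; rewrite ler_peMr ?(ltW gi) //.
Qed.

Definition pos_part (c : 'rV[int]_n) : 'rV[int]_n := \row_l Num.max (c 0 l) 0.

Lemma pos_part_ge0 c l : 0 <= pos_part c 0 l.
Proof. by rewrite mxE le_max lexx orbT. Qed.

Lemma pos_partB c : c = pos_part c - pos_part (- c).
Proof.
apply/rowP => l; rewrite !mxE.
by case: (lerP (c 0 l) 0) => h; case: (lerP (- c 0 l) 0) => h'; lia.
Qed.

Lemma pos_part_eq0 c : pos_part c = 0 -> forall l, c 0 l <= 0.
Proof.
move=> h l; have : c 0 l <= pos_part c 0 l by rewrite mxE le_max lexx.
by rewrite h mxE.
Qed.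

(** The two parts have disjoint supports, so only off-diagonal Cartan entries, which are
    nonpositive, contribute. *)
Lemma gf_pos_neg c :
  gf A (root_lattice A (pos_part c)) (root_lattice A (pos_part (- c))) <= 0.
Proof.
suff : 2 * gf A (root_lattice A (pos_part c)) (root_lattice A (pos_part (- c))) <= 0.
  by lia.
rewrite gfR; apply: sumr_le0 => j _.
rewrite mulr_le0_ge0 ?(ltW (g_gt0 hth A2 j)) // root_lattice_coord mulr_sumr.
apply: sumr_le0 => k _; have [->|jk] := eqVneq j k.
  rewrite !mxE mulrCA (_ : Num.max (- c 0 k) 0 * Num.max (c 0 k) 0 = 0) ?mulr0 //.
  by case: (lerP (c 0 k) 0) => h; rewrite ?mulr0 // max_r ?mul0r // oppr_le0 ltW.
rewrite mulr_ge0_le0 ?pos_part_ge0 //.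
by rewrite mulr_le0_ge0 ?(ft_off H) // pos_part_ge0.
Qed.

(* A mixed-sign root of minimal length would be the difference of two nonzero
   lattice vectors making an obtuse angle. *)
Lemma coherent_short i w c : d i = 1 -> weyl_group A w ->
  root_lattice A c = simple_root A i *m w ->
  (forall l, 0 <= c 0 l) \/ (forall l, c 0 l <= 0).
Proof.
move=> di1 Ww rc.
have [cp0|cp0] := eqVneq (pos_part c) 0; first by right; exact: pos_part_eq0.
have [cm0|cm0] := eqVneq (pos_part (- c)) 0.
  by left=> l; have := pos_part_eq0 cm0 l; rewrite mxE oppr_le0.
have := gfW (simple_root A i) (simple_root A i) Ww.
rewrite -rc {1 2}(pos_partB c) root_latticeB !gfBl !gfBr -/(g A i).
have := gf_short_ge di1 cp0; have := gf_short_ge di1 cm0.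
rewrite (gfC A (root_lattice A (pos_part (- c)))).
by have := gf_pos_neg c; have := g_gt0 hth A2 i; lia.
Qed.

(** Pair with the negative part: dominance makes the result nonnegative, while by [gf_pos_neg] it is
    at most minus the norm of the negative part, which therefore vanishes. *)
Lemma root_lattice_ge0 c : dominant (root_lattice A c) -> forall l, 0 <= c 0 l.
Proof.
move=> dom l; rewrite -oppr_le0.
suff /pos_part_eq0/(_ l) : pos_part (- c) = 0 by rewrite mxE.
apply: (root_lattice_inj hth); rewrite root_lattice0; apply: (gf_eq0 hth A2).
apply/eqP; rewrite eq_le gf_ge0 andbT.
have : 0 <= 2 * gf A (root_lattice A c) (root_lattice A (pos_part (- c))).
  rewrite gfR; apply: sumr_ge0 => j _.
  by rewrite !mulr_ge0 ?pos_part_ge0 ?(ltW (g_gt0 hth A2 j)) // dom.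
rewrite [in X in 0 <= X -> _](pos_partB c) root_latticeB gfBl.
by have := gf_pos_neg c; rewrite -pos_partB; lia.
Qed.

Lemma gf_dominant x c : dominant x -> (forall l, 0 <= c 0 l) ->
  0 <= gf A x (root_lattice A c).
Proof.
move=> xd c0; suff : 0 <= 2 * gf A x (root_lattice A c) by lia.
rewrite gfR; apply: sumr_ge0 => j _.
by rewrite !mulr_ge0 ?(ltW (g_gt0 hth A2 j)) // xd.
Qed.

(** The vector [x - y] pairs nonnegatively with both [x] and [y], and the two pairings add up to the
    difference of the norms; both are then 0, and so is the norm of [x - y]. This separates Casimir
    eigenvalues later. *)
Lemma dominant_norm_eq x y c : dominant x -> dominant y ->
  (forall l, 0 <= c 0 l) -> x - y = root_lattice A c ->
  gf A x x <= gf A y y -> x = y.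
Proof.
move=> xd yd c0 xyE le_xy.
have := gf_dominant xd c0; have := gf_dominant yd c0; rewrite -xyE => y0 x0.
apply/eqP; rewrite -subr_eq0; apply/eqP/(gf_eq0 hth A2).
move: x0 y0 (gf_ge0 A (x - y)); rewrite !(gfBl, gfBr) (gfC A y x); lia.
Qed.

(** Take the orbit point of largest pairing with rho: a negative coordinate [i] would let s_i
    increase that pairing. *)
Lemma dominant_conj x : exists2 w, weyl_group A w & dominant (x *m w).
Proof.
have W1 : 1%:M \in weyl_seq A by apply/(mem_weyl_seq hth A2)/weyl_group1.
have [w /(mem_weyl_seq hth A2) Ww wmax] := seq_max (fun w => gf A (x *m w) (rho n)) W1.
exists w => // i; rewrite leNgt; apply/negP => xwi.
have /wmax : w *m simple_reflection A i \in weyl_seq A.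
  exact/(mem_weyl_seq hth A2)/weyl_groupM/weyl_group_reflection.
rewrite mulmxA mulmx_reflection gfBl gfZl (gfC A (simple_root A i)).
have := gfS (rho n) i; rewrite mxE mul1r.
by have := g_gt0 hth A2 i; nia.
Qed.

(** Scaling coordinates by [d] takes a root to a multiple of its coroot, so [diag_mx d] conjugates
    the action on root coordinates into the action on coroot coordinates. *)
Lemma reflection_diag i :
  (simple_reflection A^T i)^T *m diag_mx (\row_j d j) =
  diag_mx (\row_j d j) *m (simple_reflection A i)^T.
Proof.
apply/matrixP => a b; rewrite mul_mx_diag mul_diag_mx !mxE !big_ord1 !mxE !eqxx !andbT.
rewrite mulrBl mulrBr; congr (_ - _).
  by case: eqVneq => [->|_]; rewrite ?mulr1 ?mul1r ?mulr0 ?mul0r.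
case: eqVneq => [->|_]; rewrite ?mul0r ?mulr0 // !mul1r.
by rewrite mulrC (ft_sym H).
Qed.

Lemma weyl_word_diag s :
  (weyl_word A^T s)^T *m diag_mx (\row_j d j) =
  diag_mx (\row_j d j) *m (weyl_word A s)^T.
Proof.
elim: s => [|i s IH]; first by rewrite !weyl_word_nil !trmx1 mulmx1 mul1mx.
by rewrite !weyl_word_cons !trmx_mul -mulmxA reflection_diag !mulmxA IH.
Qed.

End Short.

Section Coherent.
Variables (n : nat) (A : 'M[int]_n) (d : 'I_n -> int) (m : int) (th et : 'rV[int]_n).
Hypothesis H : finite_type A d m th et.
Implicit Types (x y c : 'rV[int]_n) (w : 'M[int]_n) (i j l : 'I_n).
Let hth := ft_high H.
Let A2 := ft_diag H.

(* A long root is treated through its coroot, which is short in the dual root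
   system and has coordinates of the same signs. *)
Lemma root_coherent c : is_root A (root_lattice A c) ->
  (forall l, 0 <= c 0 l) \/ (forall l, c 0 l <= 0).
Proof.
move=> [i [w Ww rc] ].
have [di1|dim] := ft_len H i; first exact: (coherent_short H di1 Ww rc).
have [s _ sw] := Ww; pose c' : 'rV[int]_n := delta_mx 0 i *m (weyl_word A (rev s))^T.
have cE : c = delta_mx 0 i *m (weyl_word A^T (rev s))^T.
  by apply: (root_lattice_inj hth); rewrite rc -sw -root_lattice_delta root_lattice_word.
have cc' l : c 0 l * d l = m * c' 0 l.
  have := congr1 (mulmx (delta_mx (0 : 'I_1) i)) (weyl_word_diag H (rev s)).
  rewrite !mulmxA -cE => /rowP/(_ l).
  rewrite mul_mx_diag !mxE => ->; rewrite mulr_sumr; apply: eq_bigr => k _.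
  rewrite mul_mx_diag !mxE; case: (k =P i) => [->|_]; rewrite ?eqxx /= ?mul0r ?mulr0 //.
  by rewrite !mul1r dim.
have sgn l : ((0 <= c' 0 l) = (0 <= c 0 l)) * ((c' 0 l <= 0) = (c 0 l <= 0)).
  have m0 := ft_m H; have dl := d_gt0 H l.
  split; first by rewrite -(pmulr_rge0 _ m0) -cc' pmulr_lge0.
  by rewrite -(pmulr_rle0 _ m0) -cc' pmulr_lle0.
have [|||h|h] := @coherent_short _ _ _ _ _ _ (finite_type_tr H) i (weyl_word A^T s) c'.
- by rewrite dim; case: eqP => [->|].
- exact: weyl_group_word.
- by rewrite -root_lattice_delta root_lattice_word trmxK.
- by left=> l; rewrite -sgn.
- by right=> l; rewrite -sgn.
Qed.

Let gfS := gf_simple hth A2.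
Let gfR := gf_root hth A2.
Let gfW := gf_weyl hth A2.

(* If [s_j] changes the sign of a positive root then that root is [alpha_j]. *)
Lemma root_sign_change j c : is_root A (root_lattice A c) ->
  (forall l, 0 <= c 0 l) ->
  (forall l, (c - root_lattice A c 0 j *: delta_mx 0 j) 0 l <= 0) ->
  c = delta_mx 0 j.
Proof.
move=> rc c0 c1.
have cj l : l != j -> c 0 l = 0.
  move=> lj; apply/eqP; rewrite eq_le c0 andbT; have := c1 l.
  by rewrite !mxE (negPf lj) andbF mulr0 subr0.
have cE : c = c 0 j *: delta_mx 0 j.
  apply/rowP => l; rewrite !mxE eqxx /=; have [->|lj] := eqVneq l j; first by rewrite mulr1.
  by rewrite mulr0 cj.
(* Moved back by the inverse of [w], the root is a simple root, whose coordinate 1 becomes [c 0 j]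
   times an integer; so [c 0 j] is a positive unit. *)
have [i [w Ww rcE] ] := rc.
have [c' c'E] := root_lattice_weyl (delta_mx 0 j) (weyl_group_inv A2 Ww).
have : delta_mx 0 i = c 0 j *: c'.
  apply: (root_lattice_inj hth); rewrite root_latticeZ -c'E scalemxAl -root_latticeZ -cE.
  by rewrite rcE mulmxK ?root_lattice_delta // (weyl_group_unit A2).
move=> /rowP/(_ i); rewrite !mxE !eqxx /= => h.
have c1j : c 0 j = 1.
  have : c 0 j * c' 0 i = 1 by rewrite -h.
  move: (c 0 j) (c' 0 i) (c0 j) => a b a0 ab.
  have b1 : 1 <= b by nia.
  have a1 : 1 <= a by nia.
  by nia.
by rewrite cE c1j scale1r.
Qed.

(** The coefficient in a reflection is 2(x|alpha)/(alpha|alpha), which an isometry transports along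
    with the root. *)
Lemma reflection_conj i j w : weyl_group A w ->
  simple_root A i *m w = simple_root A j ->
  simple_reflection A i *m w = w *m simple_reflection A j.
Proof.
move=> Ww ij; apply/row_matrixP => k; rewrite !rowE !mulmxA !mulmx_reflection.
rewrite mulmxBl -scalemxAl ij; congr (_ - _ *: _).
set x : 'rV[int]_n := delta_mx 0 k; have gij : g A i = g A j by rewrite /g -ij gfW.
apply: (mulIf (lt0r_neq0 (g_gt0 hth A2 i))).
by rewrite -gfS gij -gfS -ij gfW.
Qed.

(** The exchange condition. At some letter [j] of [u] the image of alpha_i turns negative; just
    before, it equals alpha_j, so s_i passes through the prefix as s_j and cancels that letter. *)
Lemma exchange u i c : root_lattice A c = simple_root A i *m weyl_word A u ->
  (forall l, c 0 l <= 0) ->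
  exists2 u', (size u').+1 = size u & weyl_word A (i :: u) = weyl_word A u'.
Proof.
elim/last_ind: u c => [|u j IH] c.
  rewrite weyl_word_nil mulmx1 -root_lattice_delta => /(root_lattice_inj hth) ->.
  by move=> /(_ i); rewrite mxE !eqxx.
rewrite weyl_word_rcons mulmxA => cE cneg.
have [c' c'E] : exists c', root_lattice A c' = simple_root A i *m weyl_word A u.
  have [c' c'E] := root_lattice_weyl (delta_mx 0 i) (weyl_group_word A u).
  by exists c'; rewrite -c'E root_lattice_delta.
have rc' : is_root A (root_lattice A c').
  by rewrite c'E; apply: is_rootM (is_root_simple _ _) (weyl_group_word _ _).
have [c'pos|c'neg] := root_coherent rc'.
  have c'j : c' = delta_mx 0 j.
    apply: root_sign_change => // l; suff <- : c = c' - root_lattice A c' 0 j *: delta_mx 0 j by [].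
    by apply: (root_lattice_inj hth); rewrite cE -c'E root_lattice_reflection.
  exists u; first by rewrite size_rcons.
  rewrite weyl_word_cons weyl_word_rcons mulmxA.
  rewrite (@reflection_conj i j _ (weyl_group_word A u)) -?c'E ?c'j ?root_lattice_delta //.
  by rewrite -mulmxA simple_reflectionK ?mulmx1.
have [u' su' u'E] := IH _ c'E c'neg; exists (rcons u' j).
  by rewrite !size_rcons su'.
by rewrite -rcons_cons !weyl_word_rcons u'E.
Qed.

(** Induction on words: passing from [u] to [i :: u] adds [x 0 i] times the image of alpha_i under
    [u]. If that image is negative, [exchange] gives a shorter word instead. *)
Lemma dominant_ge x w : dominant x -> weyl_group A w ->
  exists2 c : 'rV[int]_n, (forall l, 0 <= c 0 l) & x - x *m w = root_lattice A c.
Proof.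
move=> xdom [s _ <-]; have [k sk] := ubnP (size s).
elim: k s sk => // k IH [_|i u]; first by exists 0 => [l|]; rewrite ?mxE // weyl_word_nil mulmx1 subrr root_lattice0.
rewrite ltnS /= => uk.
have [c cE] := root_lattice_weyl (delta_mx 0 i) (weyl_group_word A u).
rewrite root_lattice_delta in cE.
have rc : is_root A (root_lattice A c).
  by rewrite -cE; apply: is_rootM (is_root_simple _ _) (weyl_group_word _ _).
have [cpos|cneg] := root_coherent rc; last first.
  by have [u' su' ->] := exchange (esym cE) cneg; apply: IH; rewrite -ltnS su' ltnS ltnW // .
have [c' c'0 c'E] := IH u uk.
exists (c' + x 0 i *: c); first by move=> l; rewrite !mxE addr_ge0 ?mulr_ge0.
rewrite weyl_word_cons mulmxA mulmx_reflection mulmxBl -scalemxAl cE.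
by rewrite root_latticeD root_latticeZ -c'E opprB addrA addrAC.
Qed.

Lemma dominant_unique x w : dominant x -> weyl_group A w -> dominant (x *m w) ->
  x *m w = x.
Proof.
move=> xd Ww xwd; have [c c0 cE] := dominant_ge xd Ww.
have [c' c'0] := dominant_ge xwd (weyl_group_inv A2 Ww).
rewrite mulmxK ?(weyl_group_unit A2) // => c'E.
have /(root_lattice_inj hth) cc' : root_lattice A (c + c') = root_lattice A 0.
  by rewrite root_latticeD -cE -c'E addrA subrK subrr root_lattice0.
apply/esym/eqP; rewrite -subr_eq0 cE (_ : c = 0) ?root_lattice0 //.
apply/rowP => l; have /rowP/(_ l) := cc'; have := c0 l; have := c'0 l.
by rewrite !rowE_; lia.
Qed.

(** As in [dominant_ge], except that the added term is now a strictly positive multiple of a nonzero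
    positive root, so [x] cannot return to itself. *)
Lemma stabilizer_trivial x w : (forall i, 0 < x 0 i) -> weyl_group A w ->
  x *m w = x -> w = 1%:M.
Proof.
move=> x0 [s _ <-]; have [k sk] := ubnP (size s).
elim: k s sk => // k IH [_|i u]; first by rewrite weyl_word_nil.
rewrite ltnS /= => uk.
have [c cE] := root_lattice_weyl (delta_mx 0 i) (weyl_group_word A u).
rewrite root_lattice_delta in cE.
have rc : is_root A (root_lattice A c).
  by rewrite -cE; apply: is_rootM (is_root_simple _ _) (weyl_group_word _ _).
have [cpos|cneg] := root_coherent rc; last first.
  by have [u' su' ->] := exchange (esym cE) cneg; apply: IH; rewrite -ltnS su' ltnS ltnW.
have [|c' c'0 c'E] := @dominant_ge x _ _ (weyl_group_word A u).
  by move=> j; exact: ltW.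
rewrite weyl_word_cons mulmxA mulmx_reflection mulmxBl -scalemxAl cE => xE.
have /(root_lattice_inj hth) cc' : root_lattice A (c' + x 0 i *: c) = root_lattice A 0.
  move/eqP: xE; rewrite subr_eq => /eqP xE.
  by rewrite root_latticeD root_latticeZ -c'E xE opprD addrA subrr add0r addNr root_lattice0.
have c00 : c = 0.
  apply/rowP => l; have /rowP/(_ l) := cc'; have := c'0 l; have := cpos l; have := x0 i.
  by rewrite !rowE_; nia.
have Uu := weyl_group_unit A2 (weyl_group_word A u).
have /eqP := simple_root_neq0 A2 i.
by rewrite -(mulmxK Uu (simple_root A i)) cE c00 root_lattice0 mul0mx.
Qed.

Lemma coroot_act (e : 'rV[int]_n) w : is_root A^T (root_lattice A^T e) -> weyl_group A w ->
  is_root A^T (root_lattice A^T (e *m w^T)).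
Proof.
move=> re [s _ <-]; rewrite -[s]revK -[in X in weyl_word X _](trmxK A) -root_lattice_word.
exact/is_rootM/weyl_group_word.
Qed.

(** Pairing [x *m w] with the highest coroot is pairing [x] with another coroot, whose coordinates
    are bounded by those of [et] in absolute value. *)
Lemma cohighest_bound x w : dominant x -> weyl_group A w ->
  `|\sum_j et 0 j * (x *m w) 0 j| <= \sum_j et 0 j * x 0 j.
Proof.
move=> xd Ww; have /= b := root_bound (ft_cohigh H) (ft_diag (finite_type_tr H))
  (coroot_act (proj1 (ft_cohigh H)) Ww).
have -> : \sum_j et 0 j * (x *m w) 0 j = \sum_j (et *m w^T) 0 j * x 0 j.
  under eq_bigr do rewrite mxE mulr_sumr; rewrite exchange_big; apply: eq_bigr => j _ /=.
  by rewrite mxE mulr_suml; apply: eq_bigr => k _; rewrite mxE mulrCA mulrC.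
rewrite (le_trans (ler_norm_sum _ _ _)) //; apply: ler_sum => j _.
have /andP[b1 b2] := b j; have xj := xd j.
by rewrite ler_norml -mulNr !ler_wpM2r.
Qed.

(* If the level were at most 1, all pairings of the orbit of [beta] with the
   simple coroots would be at most 1, so one could subtract simple roots from
   [beta] within its orbit forever, staying in the positive cone. *)
Lemma cohighest_level_ge2 c : dominant (root_lattice A c) -> c != 0 ->
  2 <= \sum_j et 0 j * root_lattice A c 0 j.
Proof.
move=> dom c0; rewrite leNgt; apply/negP => lev.
have small w j : weyl_group A w -> (root_lattice A c *m w) 0 j <= 1.
  move=> Ww; have := coroot_act (e := delta_mx 0 j) _ Ww.
  rewrite root_lattice_delta => /(_ (is_root_simple _ _)).
  move=> /(root_bound (ft_cohigh H) (ft_diag (finite_type_tr H))) b.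
  have -> : (root_lattice A c *m w) 0 j =
      \sum_l (delta_mx 0 j *m w^T : 'rV_n) 0 l * root_lattice A c 0 l.
    rewrite -rowE [LHS]mxE; apply: eq_bigr => l _.
    by rewrite [row _ _ _ _]mxE [_^T _ _]mxE mulrC.
  suff : \sum_l (delta_mx 0 j *m w^T : 'rV_n) 0 l * root_lattice A c 0 l
     <= \sum_j et 0 j * root_lattice A c 0 j by lia.
  apply: ler_sum => l _; have /andP[_] := b l; have := dom l.
  by move=> h1 h2; rewrite ler_wpM2r.
suff : forall k (c' : 'rV[int]_n), (forall l, 0 <= c' 0 l) -> \sum_l c' 0 l <= k%:Z ->
    (exists2 w, weyl_group A w & root_lattice A c' = root_lattice A c *m w) -> False.
  move=> /(_ (absz (\sum_l c 0 l)) c (root_lattice_ge0 H dom)); apply; first by lia.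
  by exists 1%:M; rewrite ?mulmx1 //; exact: weyl_group1.
elim=> [|k IH] c' c'0 c'k [w Ww wE].
  have c'00 : c' = 0.
    apply/rowP => l; rewrite mxE; apply/eqP; rewrite eq_le c'0 andbT.
    by apply: le_trans c'k; rewrite (bigD1 l) //= lerDl sumr_ge0.
  move/eqP: c0; apply; apply: (root_lattice_inj hth); rewrite root_lattice0.
  by rewrite -(mulmxK (weyl_group_unit A2 Ww) (root_lattice A c)) -wE c'00 root_lattice0 mul0mx.
have : 0 < gf A (root_lattice A c') (root_lattice A c').
  apply: (gf_gt0 hth A2); rewrite wE; apply: contra c0 => /eqP c'E.
  apply/eqP/(root_lattice_inj hth); rewrite root_lattice0.
  by rewrite -(mulmxK (weyl_group_unit A2 Ww) (root_lattice A c)) c'E mul0mx.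
rewrite -(pmulr_rgt0 _ (ltr0Sn int 1)) gfR => sum0.
have [j] : exists j, 0 < c' 0 j * root_lattice A c' 0 j * g A j.
  apply/existsP; apply: contraLR sum0; rewrite negb_exists -leNgt => /forallP h.
  by apply: sumr_le0 => j _; rewrite leNgt h.
rewrite pmulr_lgt0 ?(g_gt0 hth A2) // => h.
have cj : 0 < c' 0 j by rewrite lt_neqAle c'0 andbT eq_sym; apply: contraTneq h => ->; rewrite mul0r ltxx.
move: h; rewrite pmulr_rgt0 // => rj.
have rj1 : root_lattice A c' 0 j = 1.
  by apply/eqP; rewrite eq_le -gtz0_ge1 rj andbT wE small.
apply: (IH (c' - delta_mx 0 j)).
- move=> l; rewrite !rowE_; have := c'0 l.
  by case: (l =P j) => [->|_]; [lia|rewrite subr0].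
- have -> : \sum_l (c' - delta_mx 0 j) 0 l = \sum_l c' 0 l - 1; last by lia.
  under eq_bigr do rewrite rowBE rowdE.
  rewrite sumrB; congr (_ - _); rewrite (bigD1 j) //= eqxx big1 ?addr0 //.
  by move=> l /negPf ->.
exists (w *m simple_reflection A j).
  exact/weyl_groupM/weyl_group_reflection.
by rewrite mulmxA -wE root_lattice_reflection rj1 scale1r.
Qed.

End Coherent.

Lemma cone_addr_eq0 n (c c' : 'rV[int]_n) : (forall i, 0 <= c 0 i) ->
  (forall i, 0 <= c' 0 i) -> c + c' = 0 -> c = 0.
Proof.
move=> c0 c'0 cc'; apply/rowP => i; rewrite row0E.
have := congr1 (fun v : 'rV[int]_n => v 0 i) cc'; rewrite /= rowDE row0E.
by have := c0 i; have := c'0 i; lia.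
Qed.

(** * The Weyl denominator identity *)

Section AlternatingSum.
Variables (F : numFieldType) (n : nat).
Implicit Types (l : seq 'rV[int]_n) (phi psi : 'rV[int]_n -> F) (x a c : 'rV[int]_n).

(* Applying [prod_(a <- l) (1 - e^(-a))] to [phi], evaluated at [x]. *)
Fixpoint alt_sum l phi x : F :=
  if l is a :: l' then alt_sum l' phi x - alt_sum l' phi (x - a) else phi x.

Lemma eq_alt_sum l phi psi x : phi =1 psi -> alt_sum l phi x = alt_sum l psi x.
Proof. by move=> e; elim: l x => [|a l IH] x /=; rewrite ?e // !IH. Qed.

Lemma alt_sumD l phi psi x :
  alt_sum l (fun y => phi y + psi y) x = alt_sum l phi x + alt_sum l psi x.
Proof. by elim: l x => [|a l IH] x //=; rewrite !IH; ring. Qed.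

Lemma alt_sumZ l (k : F) phi x :
  alt_sum l (fun y => k * phi y) x = k * alt_sum l phi x.
Proof. by elim: l x => [|a l IH] x //=; rewrite !IH; ring. Qed.

Lemma alt_sum0 l x : alt_sum l (fun=> 0) x = 0.
Proof. by elim: l x => [|a l IH] x //=; rewrite !IH subrr. Qed.

Lemma alt_sum_sum I (r : seq I) (phi : I -> 'rV[int]_n -> F) l x :
  alt_sum l (fun y => \sum_(i <- r) phi i y) x = \sum_(i <- r) alt_sum l (phi i) x.
Proof.
elim: r => [|i r IH].
  by rewrite big_nil -[RHS](alt_sum0 l x); apply: eq_alt_sum => y; rewrite big_nil.
rewrite big_cons -IH -alt_sumD; apply: eq_alt_sum => y; by rewrite big_cons.
Qed.

Lemma alt_sum_shift l phi x a :
  alt_sum l (fun y => phi (y - a)) x = alt_sum l phi (x - a).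
Proof. by elim: l x => [|b l IH] x //=; rewrite !IH addrAC. Qed.

Lemma alt_sum_cat l1 l2 phi x :
  alt_sum (l1 ++ l2) phi x = alt_sum l1 (alt_sum l2 phi) x.
Proof. by elim: l1 x => [|a l1 IH] x //=; rewrite !IH. Qed.

Lemma alt_sumC l1 l2 phi x :
  alt_sum l1 (alt_sum l2 phi) x = alt_sum l2 (alt_sum l1 phi) x.
Proof.
elim: l1 x => [|a l1 IH] x //=; rewrite !IH.
rewrite -alt_sum_shift -[- _]mulN1r -alt_sumZ -alt_sumD.
by apply: eq_alt_sum => y; rewrite mulN1r.
Qed.

Lemma perm_alt_sum l1 l2 phi x : perm_eq l1 l2 -> alt_sum l1 phi x = alt_sum l2 phi x.
Proof.
move=> p; pose P l := alt_sum l1 phi x = alt_sum l phi x.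
apply: (catCA_perm_ind (P := P)) p _ => // s1 s2 s3; rewrite /P => ->.
by rewrite !catA !(alt_sum_cat (_ ++ _)) !(alt_sum_cat _ _ (alt_sum s3 phi)) alt_sumC.
Qed.

Lemma alt_sum_map l phi x (w : 'M[int]_n) :
  alt_sum [seq a *m w | a <- l] phi (x *m w) = alt_sum l (fun y => phi (y *m w)) x.
Proof. by elim: l x => [|a l IH] x //=; rewrite -!IH mulmxBl. Qed.

(* [f a] solves the difference equation [(1 - e^(-a)) f = g a], and the sum is
   the Leibniz rule for the derivative of [prod_(a <- l) (1 - e^(-a))]. *)
Lemma alt_sum_leibniz (I : Type) (r : seq I) (al : I -> 'rV[int]_n)
    (fa : I -> 'rV[int]_n -> F) (D : 'rV[int]_n -> 'rV[int]_n -> F) x :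
  (forall p y, fa p y - fa p (y - al p) = D (al p) (y - al p)) ->
  (forall v w y, D (v + w) y = D v y + D w y) ->
  \sum_(p <- r) alt_sum [seq al p | p <- r] (fa p) x =
  alt_sum [seq al p | p <- r] (fun y => D (y - x) y) x.
Proof.
move=> fE DD; elim: r x => [|p r IH] x /=.
  by rewrite big_nil subrr; have /eqP := DD 0 0 x; rewrite addr0 -subr_eq0 opprD addrA subrr sub0r oppr_eq0 => /eqP.
rewrite big_cons sumrB !IH; set l := [seq al q | q <- r].
have -> : alt_sum l (fun y => D (y - x) y) (x - al p) =
    alt_sum l (fun y => D (y - (x - al p)) y) (x - al p) - alt_sum l (D (al p)) (x - al p).
  rewrite -mulN1r -alt_sumZ -alt_sumD; apply: eq_alt_sum => y.
  have -> : y - (x - al p) = y - x + al p by rewrite opprB addrCA addrC.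
  by rewrite (DD (y - x)) mulN1r addrK.
have <- : alt_sum l (fa p) x - alt_sum l (fa p) (x - al p) = alt_sum l (D (al p)) (x - al p).
  rewrite -(alt_sum_shift _ (fa p)) -(alt_sum_shift _ (D (al p))) -mulN1r -alt_sumZ -alt_sumD.
  by apply: eq_alt_sum => y; rewrite mulN1r fE.
by ring.
Qed.

Fixpoint alt_supp l x : seq 'rV[int]_n :=
  if l is a :: l' then alt_supp l' x ++ alt_supp l' (x - a) else [:: x].

Definition indic (s y : 'rV[int]_n) : F := (y == s)%:R.

Lemma alt_sum_expand l phi x (S : seq 'rV[int]_n) :
  uniq S -> {subset alt_supp l x <= S} ->
  alt_sum l phi x = \sum_(s <- S) phi s * alt_sum l (indic s) x.
Proof.
move=> uS; elim: l x => [|a l IH] x /= lS.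
  have xS : x \in S by apply: lS; rewrite inE.
  rewrite (bigD1_seq x) //= /indic eqxx mulr1 big1 ?addr0 // => s.
  by rewrite eq_sym => /negPf ->; rewrite mulr0.
rewrite !IH; first by rewrite -sumrB; apply: eq_bigr => s _; rewrite mulrBr.
- by move=> y ys; apply: lS; rewrite mem_cat ys orbT.
- by move=> y ys; apply: lS; rewrite mem_cat ys.
Qed.

Variable A : 'M[int]_n.

Definition positive (a : 'rV[int]_n) : Prop :=
  exists c, [/\ forall i, 0 <= c 0 i, c != 0 & a = root_lattice A c].

Lemma alt_sum_eq0 l phi x : (forall a, a \in l -> positive a) ->
  (forall c, (forall i, 0 <= c 0 i) -> phi (x - root_lattice A c) = 0) ->
  alt_sum l phi x = 0.
Proof.
elim: l x => [|a l IH] x lpos phi0 /=.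
  by rewrite -[x]subr0 -(root_lattice0 A) phi0 // => i; rewrite row0E.
rewrite !IH ?subrr // => [b bl|c c0|b bl]; try by apply: lpos; rewrite inE bl orbT.
have [|c' [c'0 _ ->] ] := lpos a; first exact: mem_head.
rewrite -addrA -opprD -root_latticeD phi0 // => i.
by rewrite rowDE addr_ge0.
Qed.

(** All terms but the leading one are evaluated at [x] minus a nonempty sum of positive vectors. *)
Lemma alt_sum_head l phi x : (forall a, a \in l -> positive a) ->
  (forall c, (forall i, 0 <= c 0 i) -> c != 0 -> phi (x - root_lattice A c) = 0) ->
  alt_sum l phi x = phi x.
Proof.
elim: l => [|a l IH] lpos phi0 //=.
rewrite IH // => [|b bl]; last by apply: lpos; rewrite inE bl orbT.
rewrite alt_sum_eq0 ?subr0 // => [b bl|c c0]; first by apply: lpos; rewrite inE bl orbT.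
have [|c' [c'0 c'n0 ->] ] := lpos a; first exact: mem_head.
rewrite -addrA -opprD -root_latticeD phi0 // => [i|].
  by rewrite rowDE addr_ge0.
by apply: contra c'n0 => /eqP /(cone_addr_eq0 c'0 c0) ->.
Qed.

End AlternatingSum.

Section Denominator.
Variables (F : numFieldType) (n : nat) (A : 'M[int]_n) (d : 'I_n -> int) (m : int).
Variables (th et : 'rV[int]_n).
Hypothesis H : finite_type A d m th et.
Variable L : seq 'rV[int]_n.
Hypothesis L_pos : forall a, a \in L -> positive A a.
Hypothesis L_perm : forall i, exists2 L', perm_eq L (simple_root A i :: L') &
  perm_eq [seq a *m simple_reflection A i | a <- L'] L'.
Let hth := ft_high H.
Let A2 := ft_diag H.
Implicit Types (phi : 'rV[int]_n -> F) (w : 'M[int]_n) (s c : 'rV[int]_n).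

(** Weyl's denominator e^rho times the product of the 1 - e^(-a), as a functional. [L] stands for
    the positive roots of the Lie algebra with multiplicity. *)
Definition weyl_den phi : F := alt_sum L phi (rho n).

(** s_i permutes the factors other than that of alpha_i, and it swaps rho with rho - alpha_i, the
    two points of the remaining factor, which carry opposite signs. *)
Lemma weyl_den_reflection i phi :
  weyl_den (fun y => phi (y *m simple_reflection A i)) = - weyl_den phi.
Proof.
have [L' pL pL'] := L_perm i; rewrite /weyl_den !(perm_alt_sum _ _ pL) /= opprB.
have rs : rho n *m simple_reflection A i = rho n - simple_root A i.
  by rewrite mulmx_reflection mxE scale1r.
rewrite -!alt_sum_map !(perm_alt_sum _ _ pL') mulmxBl rs simple_root_reflection //.
by rewrite opprK subrK.
Qed.

(** The coefficient of e^s in the expanded denominator. *)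
Definition den_coef s : F := weyl_den (indic F s).

Lemma den_coef_reflection i s : den_coef (s *m simple_reflection A i) = - den_coef s.
Proof.
rewrite -[LHS]opprK -(weyl_den_reflection i); congr (- _); apply: eq_alt_sum => y.
rewrite /indic; congr (_%:R); congr nat_of_bool.
by rewrite (can_eq (mulmxK (weyl_group_unit A2 (weyl_group_reflection A i)))).
Qed.

Lemma den_coef_weyl w s : weyl_group A w -> den_coef (s *m w) = (\det w)%:~R * den_coef s.
Proof.
move=> [u _ <-]; elim/last_ind: u => [|u i IH].
  by rewrite weyl_word_nil mulmx1 det1 mul1r.
rewrite weyl_word_rcons mulmxA den_coef_reflection IH det_mulmx det_simple_reflection //.
by rewrite rmorphM rmorphN1 mulrN1 mulNr.
Qed.

Lemma den_coef_rho : den_coef (rho n) = 1.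
Proof.
rewrite /den_coef /weyl_den (alt_sum_head (A := A)) ?/indic ?eqxx // => c c0 cn0.
rewrite [_ == _](_ : _ = false) // -subr_eq0 addrC addKr oppr_eq0.
apply: contraNF cn0 => /eqP h; apply/eqP/(root_lattice_inj hth).
by rewrite h root_lattice0.
Qed.

(** Conjugate a point of the support to a dominant one. Antisymmetry keeps it off the walls, so it
    is rho plus a dominant vector; it is also rho minus an element of the positive cone, and only
    rho itself is both. *)
Lemma den_coef_eq0 s : ~ (exists2 w, weyl_group A w & s = rho n *m w) -> den_coef s = 0.
Proof.
move=> sN; apply/eqP; apply: contraT => sn0; case: sN.
have [w Ww dom] := dominant_conj H s.
have swn0 : den_coef (s *m w) != 0.
  rewrite den_coef_weyl // mulf_neq0 // intr_eq0.
  by have := weyl_group_unit A2 Ww; rewrite unitmxE; apply: contraL => /eqP ->; rewrite unitr0.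
have dom1 : dominant (s *m w - rho n).
  move=> i; rewrite rowBE [rho n _ _]mxE subr_ge0 -gtz0_ge1 lt_neqAle dom andbT.
  apply: contra swn0 => /eqP si; have := den_coef_reflection i (s *m w).
  rewrite mulmx_reflection -si scale0r subr0 => /eqP.
  by rewrite -addr_eq0 -mulr2n mulrn_eq0.
exists (invmx w); first exact: weyl_group_inv.
have [c c0 sE] : exists2 c : 'rV[int]_n, (forall i, 0 <= c 0 i) & s *m w = rho n - root_lattice A c.
  apply: contrapT => nex; move/eqP: swn0; apply.
  rewrite /den_coef /weyl_den (alt_sum_eq0 (A := A)) // => c c0.
  by rewrite /indic; case: eqP => // cE; case: nex; exists c; rewrite ?cE.
suff c00 : c = 0 by rewrite -[s](mulmxK (weyl_group_unit A2 Ww)) sE c00 root_lattice0 subr0.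
have := @root_lattice_ge0 _ _ _ _ _ _ H (- c).
rewrite root_latticeN; move: dom1; rewrite sE addrAC subrr sub0r => dom1 /(_ dom1) cN.
by apply/rowP => i; have := c0 i; have := cN i; rewrite rowNE row0E; lia.
Qed.

(** The denominator is antisymmetric and supported on the orbit of rho, with coefficient 1 at rho;
    the orbit points are distinct because the stabilizer of rho is trivial. *)
Lemma weyl_denominator phi :
  weyl_den phi = \sum_(w <- weyl_seq A) (\det w)%:~R * phi (rho n *m w).
Proof.
pose O := [seq rho n *m w | w <- weyl_seq A].
have injO : {in weyl_seq A &, injective (fun w => rho n *m w)}.
  move=> w w' /(mem_weyl_seq hth A2) Ww /(mem_weyl_seq hth A2) Ww' /(congr1 (mulmx^~ (invmx w'))).
  rewrite /= mulmxK ?(weyl_group_unit A2) // -mulmxA => /(stabilizer_trivial H) h.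
  rewrite -[w](mulmxKV (weyl_group_unit A2 Ww')) h ?mul1mx //.
    by move=> i; rewrite mxE.
  exact/weyl_groupM/weyl_group_inv.
have uO : uniq O by rewrite map_inj_in_uniq // (uniq_weyl_seq A).
rewrite /weyl_den (@alt_sum_expand _ _ _ _ _ (undup (alt_supp L (rho n) ++ O))) ?undup_uniq //; last first.
  by move=> y; rewrite mem_undup mem_cat => ->.
rewrite (bigID (mem O)) /= [X in _ + X]big1 ?addr0 => [|s sO].
  rewrite -big_filter (perm_big O) /=; last first.
    apply: uniq_perm => //; first by rewrite filter_uniq // undup_uniq.
    by move=> y; rewrite mem_filter mem_undup mem_cat; case: (y \in O); rewrite ?orbT.
  rewrite big_map big_seq [RHS]big_seq; apply: eq_bigr => w /(mem_weyl_seq hth A2) Ww.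
  by rewrite -[alt_sum _ _ _]/(den_coef _) den_coef_weyl // den_coef_rho mulr1 mulrC.
rewrite -[alt_sum _ _ _]/(den_coef s) den_coef_eq0 ?mulr0 // => -[w Ww sE].
by move/negP: sO; apply; apply/mapP; exists w => //; apply/(mem_weyl_seq hth A2).
Qed.

End Denominator.

(** * Uniqueness of the invariant form up to a factor *)

Section InvariantForm.
Variables (F : numFieldType) (n : nat) (A : 'M[int]_n) (d : 'I_n -> int) (m : int).
Variables (th et : 'rV[int]_n).
Hypothesis H : finite_type A d m th et.
Let hth := ft_high H.
Let A2 := ft_diag H.
Implicit Types (x y c : 'rV[int]_n).

Lemma proportional_field (q : 'I_n -> F) :
  (forall i j, (A i j)%:~R * q i = (A j i)%:~R * q j) ->
  exists tau, forall i, q i = tau * (g A i)%:~R.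
Proof.
move=> q_sym; have [i0 [_ _ [_ conn] ] ] := highest_connected hth A2.
have gn0 i : (g A i)%:~R != 0 :> F by rewrite intr_eq0 gt_eqF // (g_gt0 hth A2).
exists (q i0 / (g A i0)%:~R).
apply: conn => [|i j qi Aji]; first by rewrite divfK.
have AjiF : (A j i)%:~R != 0 :> F by rewrite intr_eq0.
apply: (mulfI AjiF); rewrite -q_sym qi mulrCA [RHS]mulrCA; congr (_ * _).
by rewrite -!rmorphM /= (g_sym H).
Qed.

Definition bil (B : 'M[F]_n) x y : F := (map_mx intr x *m B *m (map_mx intr y)^T) 0 0.

Variable B : 'M[F]_n.

Lemma bilDl x1 x2 y : bil B (x1 + x2) y = bil B x1 y + bil B x2 y.
Proof. by rewrite /bil map_mxD !mulmxDl mxE. Qed.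

Lemma bilDr x y1 y2 : bil B x (y1 + y2) = bil B x y1 + bil B x y2.
Proof. by rewrite /bil map_mxD linearD mulmxDr mxE. Qed.

Lemma bilZr (k : int) x y : bil B x (k *: y) = k%:~R * bil B x y.
Proof.
rewrite /bil (_ : map_mx intr (k *: y) = k%:~R *: (map_mx intr y : 'rV[F]_n)).
  by rewrite linearZ -scalemxAr mxE.
by apply/rowP => j; rewrite !mxE rmorphM.
Qed.

Lemma bilNr x y : bil B x (- y) = - bil B x y.
Proof. by rewrite -scaleN1r bilZr rmorphN1 mulN1r. Qed.

Hypothesis Bsym : B^T = B.

Lemma bilC x y : bil B x y = bil B y x.
Proof.
rewrite /bil (_ : map_mx intr y *m B *m (map_mx intr x)^T =
   (map_mx intr x *m B *m (map_mx intr y)^T)^T :> 'M[F]_1); first by rewrite [RHS]mxE.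
by rewrite !trmx_mul trmxK Bsym mulmxA.
Qed.

Lemma bilNl x y : bil B (- x) y = - bil B x y.
Proof. by rewrite bilC bilNr bilC. Qed.

Lemma bilZl (k : int) x y : bil B (k *: x) y = k%:~R * bil B x y.
Proof. by rewrite bilC bilZr bilC. Qed.

Hypothesis Bweyl : forall i,
  map_mx intr (simple_reflection A i) *m B *m (map_mx intr (simple_reflection A i))^T = B.

Lemma bil_reflection i x y :
  bil B (x *m simple_reflection A i) (y *m simple_reflection A i) = bil B x y.
Proof. by rewrite /bil !map_mxM trmx_mul -{2}(Bweyl i) !mulmxA. Qed.

Lemma bil_simple x i : 2 * bil B x (simple_root A i) =
  (x 0 i)%:~R * bil B (simple_root A i) (simple_root A i).
Proof.
have := bil_reflection i x (simple_root A i).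
rewrite simple_root_reflection // mulmx_reflection bilNr bilDl bilNl bilZl => E.
by rewrite mulr_natl mulr2n -{1}E; ring.
Qed.

Hypothesis Bunit : B \in unitmx.

(** Invariance expresses both forms through the norms of simple roots, and these are proportional
    along the connected diagram. The positivity of [gf] thus becomes available for the Killing
    form. *)
Lemma bil_gf : exists2 tau : F, tau != 0 & forall x y, bil B x y = tau * (gf A x y)%:~R.
Proof.
pose q i := bil B (simple_root A i) (simple_root A i).
have two0 : 2 != 0 :> F by rewrite pnatr_eq0.
have [|tau qE] := @proportional_field q.
  move=> i j; rewrite /q -!simple_rootE -!bil_simple; congr (_ * _); exact: bilC.
have tE0 x i : bil B x (simple_root A i) = tau * (gf A x (simple_root A i))%:~R.
  apply: (mulfI two0); rewrite bil_simple -/(q i) qE mulrCA [RHS]mulrCA -[2 in RHS]/(2%:~R).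
  by rewrite -!rmorphM /= (gf_simple hth A2).
have tE1 x c : bil B x (root_lattice A c) = tau * (gf A x (root_lattice A c))%:~R.
  rewrite root_latticeE gf_sumr rmorph_sum mulr_sumr.
  rewrite (big_morph (bil B x) (id1 := 0) (op1 := +%R)); first last.
  - by rewrite -(scale0r 0) bilZr mul0r.
  - by move=> y z; rewrite bilDr.
  by apply: eq_bigr => i _; rewrite bilZr tE0 gfZr rmorphM mulrCA.
have tE x y : bil B x y = tau * (gf A x y)%:~R.
  (* The multiple [\det A^T *: y] of any weight lies in the root lattice, where [tE1] applies. *)
  have D0 : (\det A^T)%:~R != 0 :> F by rewrite intr_eq0 (det_cartan_neq0 hth).
  apply: (mulfI D0); rewrite -bilZr mulrCA -rmorphM -gfZr.
  have -> : \det A^T *: y = root_lattice A (y *m \adj A^T).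
    by rewrite /root_lattice -mulmxA mul_adj_mx mul_mx_scalar.
  exact: tE1.
exists tau => //; apply/eqP => t0.
have [i0 _] := highest_connected hth A2.
have bE i j : bil B (delta_mx 0 i) (delta_mx 0 j) = B i j.
  by rewrite /bil !map_delta_mx trmx_delta -rowE -colE !mxE.
have B0 : B = 0 by apply/matrixP => i j; rewrite -bE tE t0 mul0r mxE.
have := mulmxV Bunit; rewrite {1}B0 mul0mx => /matrixP/(_ i0 i0)/eqP.
by rewrite !mxE eqxx eq_sym oner_eq0.
Qed.

End InvariantForm.

Local Notation "[[ x , y ]]" := (lie_bracket x y) (at level 0).

(** * Weight spaces and the Casimir trace *)

Section Representations.
Variables (F : fieldType) (g : lieAlgebra F) (dd : nat) (V : lie_rep g dd).

Lemma repD x y : V (x + y) = V x + V y.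
Proof. by have := rep_linear V 1 x y; rewrite !scale1r. Qed.

Lemma rep0 : V 0 = 0.
Proof. by have := repD 0 0; rewrite addr0 => /eqP; rewrite -subr_eq0 opprD addrA subrr sub0r oppr_eq0 => /eqP. Qed.

Lemma repZ a x : V (a *: x) = a *: V x.
Proof. by have := rep_linear V a x 0; rewrite !addr0 rep0 addr0. Qed.

Lemma repN x : V (- x) = - V x.
Proof. by rewrite -scaleN1r repZ scaleN1r. Qed.

Lemma rep_sum I (r : seq I) (P : pred I) (G : I -> g) :
  V (\sum_(i <- r | P i) G i) = \sum_(i <- r | P i) V (G i).
Proof. apply: (big_morph V); [exact: repD|exact: rep0]. Qed.

End Representations.

(** * Representations of sl2 *)

Section Sl2.
Variables (F : numFieldType) (dd : nat) (e f h : 'M[F]_dd).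
Hypothesis ef : e *m f - f *m e = h.
Hypothesis he : h *m e - e *m h = 2 *: e.
Hypothesis hf : h *m f - f *m h = - (2 *: f).
Implicit Types (v : 'cV[F]_dd) (k : nat).

Lemma sl2_e_weight v c : h *m v = c *: v -> h *m (e *m v) = (c + 2) *: (e *m v).
Proof.
move=> hv; rewrite mulmxA -[h *m e](subrK (e *m h)) he mulmxDl -mulmxA hv.
by rewrite -scalemxAl -scalemxAr -scalerDl addrC.
Qed.

Lemma sl2_f_weight v c : h *m v = c *: v -> h *m (f *m v) = (c - 2) *: (f *m v).
Proof.
move=> hv; rewrite mulmxA -[h *m f](subrK (f *m h)) hf mulmxDl -mulmxA hv.
by rewrite mulNmx -scalemxAl -scalemxAr addrC -scaleNr -scalerDl.
Qed.

Lemma sl2_f_weight_iter v c k : h *m v = c *: v ->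
  h *m iter k (mulmx f) v = (c - k%:R * 2) *: iter k (mulmx f) v.
Proof.
move=> hv; elim: k => [|k IH] /=; first by rewrite mul0r subr0.
by rewrite (sl2_f_weight IH); congr (_ *: _); rewrite -natr1; ring.
Qed.

Lemma sl2_ef v c k : h *m v = c *: v ->
  e *m iter k.+1 (mulmx f) v =
  iter k.+1 (mulmx f) (e *m v) + (k.+1%:R * (c - k%:R)) *: iter k (mulmx f) v.
Proof.
move=> hv; elim: k => [|k IH].
  by rewrite /= mulmxA -[e *m f](subrK (f *m e)) ef mulmxDl hv mulmxA addrC mul1r subr0.
rewrite iterS mulmxA -[e *m f](subrK (f *m e)) ef mulmxDl (sl2_f_weight_iter _ hv) -mulmxA IH.
rewrite mulmxDr -scalemxAr addrCA; congr (_ + _); rewrite -scalerDl; congr (_ *: _).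
by rewrite -!natr1; ring.
Qed.

Lemma sl2_singular v (c : int) k : (k%:Z <= c)%R -> h *m v = c%:~R *: v -> e *m v = 0 ->
  iter k (mulmx f) v = 0 -> v = 0.
Proof.
move=> kc hv ev; elim: k kc => [|k IH] kc //= fv; apply: IH; first by lia.
have := sl2_ef k hv; rewrite /= fv mulmx0 ev.
have -> : iter k (mulmx f) (0 : 'cV[F]_dd) = 0 by elim: (k) => //= q ->; rewrite mulmx0.
rewrite mulmx0 add0r => /esym/eqP; rewrite scaler_eq0 mulf_eq0 pnatr_eq0 /= => /orP[|/eqP //].
rewrite subr_eq0 -[k%:R]/(k%:Z%:~R) eqr_int => /eqP; lia.
Qed.

(** Induction on the nilpotency order of e on [v]: by [sl2_ef] the vector e v is killed by f^(k+1),
    and its weight [c + 2] still dominates [k + 1]; so e v = 0 and [sl2_singular] applies. *)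
Lemma sl2_injective p v (c : int) k : (k%:Z <= c)%R -> h *m v = c%:~R *: v ->
  iter p (mulmx e) v = 0 -> iter k (mulmx f) v = 0 -> v = 0.
Proof.
elim: p v c k => [|p IH] v c k kc hv //; rewrite iterSr => ev fv.
apply: (sl2_singular kc hv) (fv); apply: (IH _ (c + 2) k.+1) => //; first by lia.
  by rewrite (sl2_e_weight hv) rmorphD.
by have := sl2_ef k hv; rewrite iterS fv mulmx0 mulmx0 scaler0 addr0.
Qed.

(* Otherwise all [f^k v] would be nonzero. *)
Lemma sl2_singular_ge0 v (c : int) : h *m v = c%:~R *: v -> e *m v = 0 ->
  (exists p, forall v, iter p (mulmx f) v = 0) -> v != 0 -> 0 <= c.
Proof.
move=> hv ev [p fp] v0; rewrite leNgt; apply/negP => c0.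
suff : forall k, iter k (mulmx f) v != 0 by move=> /(_ p); rewrite fp eqxx.
elim=> [|k IH] //; apply: contra IH => /eqP fv; have := sl2_ef k hv.
rewrite fv mulmx0 ev (_ : iter k.+1 _ _ = 0); last by elim: (k.+1) => //= q ->; rewrite mulmx0.
rewrite add0r => /esym/eqP; rewrite scaler_eq0 mulf_eq0 pnatr_eq0 /= => /orP[|//].
rewrite subr_eq0 -[k%:R]/(k%:Z%:~R) eqr_int => /eqP; lia.
Qed.

End Sl2.

(** * Weight bases and weight multiplicities *)

Section WeightRep.
Variables (F : numFieldType) (n : nat) (A : 'M[int]_n) (d : 'I_n -> int) (m : int).
Variables (th et : 'rV[int]_n).
Hypothesis H : finite_type A d m th et.
Let hth := ft_high H.
Let A2 := ft_diag H.
Variables (g : lieAlgebra F) (e f : 'I_n -> g).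
Hypothesis chev : chevalley_generators A e f.
Let hc i := [[e i, f i]].

Definition diagonal_rep dd (V : lie_rep g dd) (wt : 'I_dd -> 'rV[int]_n) :=
  forall i, V [[e i, f i]] = diag_mx (\row_j (wt j 0 i)%:~R).

Definition has_weight (x : g) (b : 'rV[int]_n) :=
  forall i, [[ [[e i, f i]], x ]] = (b 0 i)%:~R *: x.

Lemma has_weight_e i : has_weight (e i) (simple_root A i).
Proof. by move=> j; rewrite simple_rootE (chev_he chev). Qed.

Lemma has_weight_f i : has_weight (f i) (- simple_root A i).
Proof. by move=> j; rewrite rowNE simple_rootE (chev_hf chev) rmorphN scaleNr. Qed.

Variables (dd : nat) (V : lie_rep g dd) (wt : 'I_dd -> 'rV[int]_n).
Hypothesis Vh : diagonal_rep V wt.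
Implicit Types (mu nu : 'rV[int]_n) (v : 'cV[F]_dd) (M N : 'M[F]_dd).

Definition weight_vec mu v := forall i, V [[e i, f i]] *m v = (mu 0 i)%:~R *: v.

Lemma weight_vecP mu v : weight_vec mu v <-> forall j, v j 0 != 0 -> wt j = mu.
Proof.
split=> [wv j vj|h i].
  apply/rowP => i; have /matrixP/(_ j 0) := wv i.
  rewrite Vh mul_diag_mx !mxE => /(mulIf vj) /eqP; rewrite eqr_int => /eqP; exact.
apply/matrixP => j k; rewrite ord1 Vh mul_diag_mx !mxE.
by have [->|/h ->//] := eqVneq (v j 0) 0; rewrite !mulr0.
Qed.

Lemma shift_entry x b : has_weight x b -> forall j k, V x j k != 0 -> wt j = wt k + b.
Proof.
move=> wx j k xjk; apply/rowP => i; have := rep_bracket V [[e i, f i]] x.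
rewrite wx repZ Vh mul_diag_mx mul_mx_diag => /matrixP/(_ j k); rewrite !mxE => /eqP.
rewrite [X in _ - X]mulrC -mulrBl => /eqP/(mulIf xjk)/eqP.
by rewrite -rmorphB eqr_int => /eqP ->; rewrite addrC subrK.
Qed.

Lemma weight_vec_act x b mu v : has_weight x b -> weight_vec mu v -> weight_vec (mu + b) (V x *m v).
Proof.
move=> wx wv i; have := rep_bracket V [[e i, f i]] x.
rewrite wx repZ => /eqP; rewrite eq_sym subr_eq => /eqP E.
rewrite mulmxA E mulmxDl -mulmxA wv -scalemxAl -scalemxAr -scalerDl rowDE.
by rewrite rmorphD addrC.
Qed.

Definition tr_weight mu M : F := \sum_(j | wt j == mu) M j j.

(** Cyclicity of the trace between two weight spaces: [M] maps weight [mu + a] into weight [mu], so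
    both sides sum the same products of entries. *)
Lemma tr_weight_shift M N mu a : (forall j k, M j k != 0 -> wt k = wt j + a) ->
  tr_weight mu (M *m N) = tr_weight (mu + a) (N *m M).
Proof.
move=> Ma; pose G j k := if (wt j == mu) && (wt k == mu + a) then M j k * N k j else 0.
transitivity (\sum_j \sum_k G j k).
  rewrite /tr_weight big_mkcond; apply: eq_bigr => j _; rewrite mxE /G.
  case: eqP => wj /=; last by rewrite big1.
  apply: eq_bigr => k _; case: eqP => // wk.
  have [->|/Ma kE] := eqVneq (M j k) 0; first by rewrite mul0r.
  by case: wk; rewrite kE wj.
rewrite exchange_big /tr_weight [RHS]big_mkcond; apply: eq_bigr => k _; rewrite mxE /G.
case: eqP => wk /=; last by rewrite big1 // => j _; rewrite andbF.
apply: eq_bigr => j _; rewrite andbT; case: eqP => wj; first by rewrite mulrC.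
have [->|/Ma kE] := eqVneq (M j k) 0; first by rewrite mulr0.
by case: wj; apply: (addIr a); rewrite -wk kE.
Qed.

Lemma tr_weightD mu M N : tr_weight mu (M + N) = tr_weight mu M + tr_weight mu N.
Proof. by rewrite /tr_weight -big_split; apply: eq_bigr => j _; rewrite mxE. Qed.

Lemma tr_weightZ mu a M : tr_weight mu (a *: M) = a * tr_weight mu M.
Proof. by rewrite /tr_weight mulr_sumr; apply: eq_bigr => j _; rewrite mxE. Qed.

Lemma tr_weight_sum mu I (r : seq I) (G : I -> 'M[F]_dd) :
  tr_weight mu (\sum_(i <- r) G i) = \sum_(i <- r) tr_weight mu (G i).
Proof.
apply: (big_morph (tr_weight mu)); first exact: tr_weightD.
by rewrite /tr_weight big1 // => j _; rewrite mxE.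
Qed.

(** Each application moves the [k]-th coordinate of the weight by [c], and two such coordinates
    differ by at most 2K; hence 2K + 1 steps give 0. *)
Lemma nilpotent_shift (X : 'M[F]_dd) (k : 'I_n) (c : int) : c != 0 ->
  (forall i j, X i j != 0 -> wt i 0 k = wt j 0 k + c) ->
  exists p, forall v, iter p (mulmx X) v = 0.
Proof.
move=> c0 Xc; pose K := (\sum_j `|wt j 0%R k|)%N.
have wtK j : (`|wt j 0%R k| <= K)%N by rewrite /K (bigD1 j) //= leq_addr.
have step p v i : iter p (mulmx X) v i 0 != 0 ->
    exists j, wt i 0 k = wt j 0 k + p%:Z * c.
  elim: p i => [|p IHp] i /=; first by exists i; rewrite mul0r addr0.
  rewrite mxE => s0; have [l] : exists l, X i l * iter p (mulmx X) v l 0 != 0.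
    apply/existsP; apply: contraR s0 => /existsPn s0.
    by rewrite big1 // => l _; apply/eqP/negbNE/s0.
  rewrite mulf_eq0 negb_or => /andP[/Xc ->]; case/IHp => j ->; exists j; lia.
exists (K + K).+1 => v; apply/matrixP => i z; rewrite ord1 [RHS]mxE.
apply/eqP; apply: contraT => s0; have [j] := step _ _ _ s0; have := wtK i; have := wtK j.
move: (wt i 0 k) (wt j 0 k) => a b; nia.
Qed.

Lemma chev_sl2 i : let E := V (e i) in let G := V (f i) in let h := V [[e i, f i]] in
  [/\ E *m G - G *m E = h, h *m E - E *m h = 2 *: E & h *m G - G *m h = - (2 *: G)].
Proof.
rewrite /= -!rep_bracket; split=> //.
  by rewrite (chev_he chev) repZ A2.
by rewrite (chev_hf chev) repN repZ A2.
Qed.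

Lemma nilpotent_e i : exists p, forall v, iter p (mulmx (V (e i))) v = 0.
Proof.
apply: (@nilpotent_shift _ i 2) => // j k /(shift_entry (has_weight_e i)) ->.
by rewrite rowDE simple_rootE A2.
Qed.

Lemma nilpotent_f i : exists p, forall v, iter p (mulmx (V (f i))) v = 0.
Proof.
apply: (@nilpotent_shift _ i (- 2)) => // j k /(shift_entry (has_weight_f i)) ->.
by rewrite rowDE rowNE simple_rootE A2.
Qed.

Definition singular mu v := forall i, V (e i) *m v = 0 /\ V [[e i, f i]] *m v = (mu 0 i)%:~R *: v.

Lemma singular_dominant mu v : singular mu v -> v != 0 -> dominant mu.
Proof.
move=> sv v0 i; have [Ev hv] := sv i; have [E1 E2 E3] := chev_sl2 i.
exact: (sl2_singular_ge0 E1 E3 hv Ev (nilpotent_f i) v0).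
Qed.

Definition mult mu : nat := #|[set j | wt j == mu]%SET|.

Lemma mult_tr mu : (mult mu)%:R = tr_weight mu 1%:M.
Proof.
rewrite /mult /tr_weight -sum1dep_card natr_sum; apply: eq_bigr => j _.
by rewrite [RHS]mxE eqxx.
Qed.

Lemma mult_le mu nu M : (forall v, weight_vec mu v -> weight_vec nu (M *m v)) ->
  (forall v, weight_vec mu v -> M *m v = 0 -> v = 0) -> (mult mu <= mult nu)%N.
Proof.
move=> Mw Minj; pose J := [set j | wt j == mu]%SET; pose K := [set j | wt j == nu]%SET.
pose ext (v : 'cV[F]_#|J|) : 'cV[F]_dd := \col_j \sum_a v a 0 * (enum_val a == j)%:R.
have ext_val (v : 'cV[F]_#|J|) a : ext v (enum_val a) 0 = v a 0.
  rewrite mxE (bigD1 a) //= eqxx mulr1 big1 ?addr0 // => b.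
  by rewrite (inj_eq enum_val_inj) => /negPf ->; rewrite mulr0.
have extJ (v : 'cV[F]_#|J|) j : j \notin J -> ext v j 0 = 0.
  move=> jJ; rewrite mxE big1 // => a _; case: eqP => [aj|]; last by rewrite mulr0.
  by move: jJ; rewrite -aj enum_valP.
have extw (v : 'cV[F]_#|J|) : weight_vec mu (ext v).
  apply/weight_vecP => j; apply: contraNeq => jm; apply/eqP/extJ.
  by rewrite inE.
pose N : 'M[F]_(#|K|, #|J|) := \matrix_(b, a) M (enum_val b) (enum_val a).
have NE (v : 'cV[F]_#|J|) b : (N *m v) b 0 = (M *m ext v) (enum_val b) 0.
  rewrite !mxE [RHS](bigID (mem J)) /= [X in _ = _ + X]big1 ?addr0; last first.
    by move=> j jJ; rewrite extJ ?mulr0.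
  by rewrite [RHS]big_enum_val; apply: eq_bigr => a _; rewrite ext_val mxE.
have Ninj (v : 'cV_#|J|) : N *m v = 0 -> v = 0.
  move=> Nv; have Mv : M *m ext v = 0.
    apply/matrixP => j z; rewrite ord1 [RHS]mxE; apply/eqP; apply: contraT => Mj.
    have := iffLR (weight_vecP _ _) (Mw _ (extw v)) j Mj => /eqP jn.
    have jK : j \in K by rewrite inE.
    by move: Mj; rewrite -(enum_rankK_in jK jK) -NE Nv mxE eqxx.
  have e0 := Minj _ (extw v) Mv; apply/matrixP => a z.
  by rewrite ord1 -ext_val e0 !mxE.
rewrite /mult -/J -/K.
have : row_free N^T.
  rewrite -kermx_eq0; apply/rowV0P => u /sub_kermxP uN; apply: trmx_inj.
  by rewrite trmx0; apply: Ninj; rewrite -[N]trmxK -trmx_mul uN trmx0.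
by rewrite /row_free => /eqP <-; exact: rank_leq_col.
Qed.

Lemma weight_vec_iter x b k mu v : has_weight x b -> weight_vec mu v ->
  weight_vec (mu + k%:Z *: b) (iter k (mulmx (V x)) v).
Proof.
move=> wx wv; elim: k => [|k IH]; first by rewrite scale0r addr0.
have -> : mu + k.+1%:Z *: b = (mu + k%:Z *: b) + b.
  by apply/rowP => i; rewrite !rowE_; lia.
exact: weight_vec_act.
Qed.

Lemma iter_mulmx k (X : 'M[F]_dd) v : iter k (mulmx X) v = iter k (mulmx X) 1%:M *m v.
Proof. by elim: k => [|k IH] /=; rewrite ?mul1mx // IH mulmxA. Qed.

(** If [mu 0 i] is nonnegative, that power of f_i injects the weight space of [mu] into that of its
    reflection; otherwise a power of e_i does. As s_i is an involution, one inequality is enough. *)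
Lemma mult_reflection i mu : mult (mu *m simple_reflection A i) = mult mu.
Proof.
suff le mu' : (mult mu' <= mult (mu' *m simple_reflection A i))%N.
  apply/eqP; rewrite eqn_leq le andbT.
  by have := le (mu *m simple_reflection A i); rewrite -mulmxA simple_reflectionK // mulmx1.
rewrite mulmx_reflection; have [E1 E2 E3] := chev_sl2 i.
have [mui|mui] := lerP 0 (mu' 0 i).
  apply: (@mult_le _ _ (iter (absz (mu' 0 i)) (mulmx (V (f i))) 1%:M)) => v wv; rewrite -iter_mulmx.
    have := weight_vec_iter (absz (mu' 0 i)) (has_weight_f i) wv.
    by rewrite gez0_abs // scalerN.
  have [p ep] := nilpotent_e i; apply: (sl2_injective E1 E2 E3 _ (wv i) (ep v)).
  by rewrite gez0_abs.
apply: (@mult_le _ _ (iter (absz (mu' 0 i)) (mulmx (V (e i))) 1%:M)) => v wv; rewrite -iter_mulmx.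
  have := weight_vec_iter (absz (mu' 0 i)) (has_weight_e i) wv.
  by rewrite ltz0_abs // scaleNr.
have [p fp] := nilpotent_f i.
(* The same fact for the sl2-triple with e and f exchanged and h negated. *)
apply: (@sl2_injective _ _ (V (f i)) (V (e i)) (- V [[e i, f i]]) _ _ _ p v (- mu' 0 i)) => //.
- by rewrite -E1 opprB.
- by rewrite mulNmx mulmxN opprK addrC -opprB E3 opprK.
- by rewrite mulNmx mulmxN opprK addrC -opprB E2.
- by rewrite ltz0_abs.
- by rewrite mulNmx wv rmorphN scaleNr.
Qed.

Lemma mult_weyl w mu : weyl_group A w -> mult (mu *m w) = mult mu.
Proof.
case=> s _ <-; elim/last_ind: s => [|s i IH]; first by rewrite weyl_word_nil mulmx1.
by rewrite weyl_word_rcons mulmxA mult_reflection.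
Qed.

End WeightRep.

Section CasimirDatum.
Variables (F : numFieldType) (n : nat) (A : 'M[int]_n) (g : lieAlgebra F) (e f : 'I_n -> g).

Definition casimir (B : 'M[F]_n) r (ep fp : 'I_r -> g) dd (V : lie_rep g dd) : 'M[F]_dd :=
  \sum_i \sum_j B i j *: (V [[e i, f i]] *m V [[e j, f j]]) +
  \sum_p (V (ep p) *m V (fp p) + V (fp p) *m V (ep p)).

(** What the trace computations need from the Killing form: dual root vectors [cz_e p] and [cz_f p]
    of opposite weights, the positive roots being indexed with multiplicity, and the form [cz_B]
    induced on weights. [cz_perm] supplies the hypothesis of the denominator identity. *)
Record casimir_datum := CasimirDatum {
  cz_r : nat;
  cz_e : 'I_cz_r -> g;
  cz_f : 'I_cz_r -> g;
  cz_al : 'I_cz_r -> 'rV[int]_n;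
  cz_B : 'M[F]_n;
  cz_he : forall p, has_weight e f (cz_e p) (cz_al p);
  cz_hf : forall p, has_weight e f (cz_f p) (- cz_al p);
  cz_ef : forall p, [[cz_e p, cz_f p]] =
    \sum_i ((map_mx intr (cz_al p) : 'rV[F]_n) *m cz_B) 0 i *: [[e i, f i]];
  cz_pos : forall p, positive A (cz_al p);
  cz_kill : forall dd (V : lie_rep g dd) (v : 'cV_dd),
    (forall i, V (e i) *m v = 0) -> forall p, V (cz_e p) *m v = 0;
  cz_sym : cz_B^T = cz_B;
  cz_weyl : forall i, map_mx intr (simple_reflection A i) *m cz_B *m
    (map_mx intr (simple_reflection A i))^T = cz_B;
  cz_unit : cz_B \in unitmx;
  cz_perm : forall i, exists2 L',
    perm_eq [seq cz_al p | p <- index_enum 'I_cz_r] (simple_root A i :: L') &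
    perm_eq [seq a *m simple_reflection A i | a <- L'] L';
  cz_comm : forall dd (V : lie_rep g dd) x,
    V x *m casimir cz_B cz_e cz_f V = casimir cz_B cz_e cz_f V *m V x
}.

End CasimirDatum.

(** * Freudenthal's identity *)

Section Freudenthal.
Variables (F : numFieldType) (n : nat) (A : 'M[int]_n) (d : 'I_n -> int) (m : int).
Variables (th et : 'rV[int]_n).
Hypothesis H : finite_type A d m th et.
Let hth := ft_high H.
Let A2 := ft_diag H.
Variables (g : lieAlgebra F) (e f : 'I_n -> g).
Hypothesis chev : chevalley_generators A e f.
Variable cd : casimir_datum A e f.
Let B := cz_B cd.
Let ep := cz_e (c := cd).
Let fp := cz_f (c := cd).
Let al := cz_al (c := cd).
Let L := [seq al p | p <- index_enum 'I_(cz_r cd)].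

(** In coordinate [i], alpha_i contributes 2; the other roots are permuted by s_i, so their sum is
    s_i-fixed and has coordinate 0. *)
Lemma cd_sum : \sum_p al p = 2 *: rho n.
Proof.
apply/rowP => i; rewrite rowZE mxE mulr1.
have [L' pL pL'] := cz_perm cd i.
have sumL M : perm_eq L M -> \sum_p al p = \sum_(a <- M) a.
  by move=> pM; rewrite -(perm_big _ pM) big_map.
rewrite (sumL _ pL) big_cons rowDE simple_rootE A2.
have /eqP : (\sum_(a <- L') a) *m simple_reflection A i = \sum_(a <- L') a.
  by rewrite mulmx_suml -[RHS](perm_big _ pL') big_map.
rewrite mulmx_reflection -subr_eq0 addrAC subrr sub0r oppr_eq0 => /eqP/rowP/(_ i).
rewrite rowZE simple_rootE A2 row0E => /eqP; rewrite mulf_eq0 orbF => /eqP ->.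
by rewrite addr0.
Qed.

Lemma cd_L_pos a : a \in L -> positive A a.
Proof. by case/mapP => p _ ->; exact: cz_pos. Qed.

Let bilE := bil_gf H (cz_sym cd) (cz_weyl cd) (cz_unit cd).

Variables (dd : nat) (V : lie_rep g dd) (wt : 'I_dd -> 'rV[int]_n).
Hypothesis Vh : diagonal_rep e f V wt.
Implicit Types (mu nu kap : 'rV[int]_n) (v : 'cV[F]_dd) (Z : 'M[F]_dd).

Definition Om := casimir e f B ep fp V.

Lemma cartan_diag (G : 'I_n -> 'I_dd -> F) (D : 'I_n -> 'M[F]_dd) :
  (forall i, D i = diag_mx (\row_j G i j)) ->
  \sum_i D i = diag_mx (\row_j \sum_i G i j).
Proof.
move=> DE; apply/matrixP => j k; rewrite summxE !mxE -sumrMnl.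
by apply: eq_bigr => i _; rewrite DE !mxE.
Qed.

Lemma rep_ef p : V [[ep p, fp p]] = diag_mx (\row_j bil B (al p) (wt j)).
Proof.
rewrite cz_ef rep_sum (@cartan_diag (fun i j =>
  ((map_mx intr (al p) : 'rV[F]_n) *m B) 0 i * (wt j 0 i)%:~R)).
  congr diag_mx; apply/rowP => j; rewrite mxE [RHS]mxE /bil [RHS]mxE.
  by apply: eq_bigr => i _; congr (_ * _); rewrite !mxE.
by move=> i; rewrite repZ Vh; apply/matrixP => j k; rewrite !mxE mulrnAr.
Qed.

Lemma rep_cartan : \sum_i \sum_j B i j *: (V [[e i, f i]] *m V [[e j, f j]]) =
  diag_mx (\row_k bil B (wt k) (wt k)).
Proof.
rewrite exchange_big (@cartan_diag (fun j k => \sum_i (wt k 0 i)%:~R * B i j * (wt k 0 j)%:~R)).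
  congr diag_mx; apply/rowP => k; rewrite mxE [RHS]mxE /bil [RHS]mxE.
  by apply: eq_bigr => j _; rewrite !mxE mulr_suml; apply: eq_bigr => i _; rewrite !mxE.
move=> j; rewrite (@cartan_diag (fun i k => (wt k 0 i)%:~R * B i j * (wt k 0 j)%:~R)) // => i.
rewrite !Vh mul_diag_mx; apply/matrixP => k l; rewrite !mxE.
by case: (k == l); rewrite ?mulr1n ?mulr0n ?mulr0 //; ring.
Qed.

Lemma tr_weight_diag (r : 'rV[int]_n -> F) mu Z :
  tr_weight wt mu (diag_mx (\row_j r (wt j)) *m Z) = r mu * tr_weight wt mu Z.
Proof.
rewrite /tr_weight mulr_sumr; apply: eq_bigr => j /eqP wj.
by rewrite mul_diag_mx !mxE wj.
Qed.

Section Commuting.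
Variable Z : 'M[F]_dd.
Hypothesis Zcomm : forall x, V x *m Z = Z *m V x.

Let mZ mu := tr_weight wt mu Z.
Let Fp p mu := tr_weight wt mu (V (fp p) *m (V (ep p) *m Z)).

(** Cyclicity turns the trace of f e Z at [mu] into that of e f Z at [mu + al p], where the
    commutator [e, f] acts by a scalar. This needs of [Z] only that it commutes with the action. *)
Lemma string_step p mu :
  Fp p mu = Fp p (mu + al p) + bil B (al p) (mu + al p) * mZ (mu + al p).
Proof.
rewrite {1}/Fp (@tr_weight_shift _ _ _ _ _ _ _ (al p)); last first.
  by move=> j k /(shift_entry Vh (@cz_hf _ _ _ _ _ _ cd p)) ->; rewrite subrK.
rewrite -mulmxA -Zcomm mulmxA -[V (ep p) *m V (fp p)](subrK (V (fp p) *m V (ep p))).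
rewrite -rep_bracket mulmxDl tr_weightD addrC -mulmxA; congr (_ + _).
by rewrite rep_ef tr_weight_diag.
Qed.

Lemma trace_casimir mu : tr_weight wt mu (Om *m Z) =
  (bil B mu mu + bil B (2 *: rho n) mu) * mZ mu + 2 * \sum_p Fp p mu.
Proof.
have OmE : Om = \sum_i \sum_j B i j *: (V [[e i, f i]] *m V [[e j, f j]]) +
   (\sum_p V [[ep p, fp p]] + 2 *: \sum_p V (fp p) *m V (ep p)).
  rewrite /Om /casimir; congr (_ + _); rewrite scaler_sumr -big_split.
  by apply: eq_bigr => p _; rewrite rep_bracket scaler_nat mulr2n /= addrA subrK.
rewrite OmE !mulmxDl !tr_weightD rep_cartan (tr_weight_diag (fun x => bil B x x)) mulrDl -addrA; congr (_ + _).
congr (_ + _).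
  rewrite mulmx_suml tr_weight_sum -cd_sum (big_morph (fun x => bil B x mu) (id1 := 0) (op1 := +%R)).
  - by rewrite mulr_suml; apply: eq_bigr => p _; rewrite rep_ef (tr_weight_diag (bil B (al p))).
  - by move=> x y; rewrite bilDl.
  - by rewrite -(scale0r 0) bilC ?cz_sym // bilZr mul0r.
rewrite -scalemxAl tr_weightZ mulmx_suml tr_weight_sum; congr (_ * _).
by apply: eq_bigr => p _; rewrite /Fp mulmxA.
Qed.

(** The Leibniz rule turns the sums over root strings into the term 2(y - rho|kap - y). Added to
    |kap - y|^2 + 2(rho|kap - y) it gives |kap|^2 - |y|^2, and |y|^2 is |rho|^2 on the orbit of rho,
    where the denominator is supported. *)
Lemma freudenthal kap :
  weyl_den L (fun y => tr_weight wt (kap - y) (Om *m Z)) =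
  (bil B kap kap - bil B (rho n) (rho n)) * weyl_den L (fun y => mZ (kap - y)).
Proof.
have leib := @alt_sum_leibniz F n _ (index_enum 'I_(cz_r cd)) al
  (fun p y => Fp p (kap - y)) (fun u y => bil B u (kap - y) * mZ (kap - y)) (rho n).
have Bs := cz_sym cd.
transitivity (weyl_den L (fun y => (bil B kap kap - bil B y y) * mZ (kap - y))).
  rewrite /weyl_den.
  transitivity (alt_sum L (fun y => (bil B (kap - y) (kap - y) + bil B (2 *: rho n) (kap - y)) *
     mZ (kap - y)) (rho n) + 2 * \sum_p alt_sum L (fun y => Fp p (kap - y)) (rho n)).
    rewrite -alt_sum_sum -alt_sumZ -alt_sumD; apply: eq_alt_sum => y.
    exact: trace_casimir.
  rewrite leib.
  - rewrite -alt_sumZ -alt_sumD; apply: eq_alt_sum => y.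
    rewrite !(bilDl, bilDr, bilNr, bilZl) // !bilNl // (bilC Bs y kap) (bilC Bs (rho n)) .
    ring.
  - move=> p y; rewrite string_step.
    have -> : kap - y + al p = kap - (y - al p) by rewrite opprB addrA addrAC.
    by rewrite addrAC subrr add0r.
  - by move=> v w y; rewrite bilDl mulrDl.
rewrite !(weyl_denominator H cd_L_pos (@cz_perm _ _ _ _ _ _ cd)) mulr_sumr.
rewrite big_seq [RHS]big_seq; apply: eq_bigr => w /(mem_weyl_seq hth A2) Ww.
have [tau _ bE] := bilE.
by rewrite [bil B (_ *m w) _]bE (gf_weyl hth A2) // -bE mulrCA.
Qed.

End Commuting.

End Freudenthal.

(** For the rank factorization of [M] into column and row bases, idempotence says that the product
    in the opposite order is the identity of size the rank. *)
Lemma trace_idempotent (F : fieldType) k (M : 'M[F]_k) : M *m M = M ->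
  \tr M = (\rank M)%:R /\
  forall (a : 'cV_(\rank M)), M *m (col_base M *m a) = col_base M *m a.
Proof.
move=> MM; have /row_fullP [X XC] := col_base_full M.
have /row_freeP [Y RY] := row_base_free M.
have RC : row_base M *m col_base M = 1%:M.
  have : col_base M *m (row_base M *m col_base M) *m row_base M = col_base M *m row_base M.
    by rewrite mulmxA mulmx_base -mulmxA mulmx_base MM.
  move: (col_base M) (row_base M) XC RY => C R' XC RY /(congr1 (fun N => X *m N *m Y)).
  by rewrite /= !mulmxA XC !mul1mx -!mulmxA RY !mulmx1.
split.
  transitivity (\tr (col_base M *m row_base M)); first by rewrite mulmx_base.
  by rewrite mxtrace_mulC RC mxtrace1.
move=> a; rewrite mulmxA; congr (_ *m a).
transitivity (col_base M *m row_base M *m col_base M); first by rewrite mulmx_base.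
by rewrite -mulmxA RC mulmx1.
Qed.

Lemma horner_mx_eigen (F : fieldType) k (M : 'M[F]_k.+1) (v : 'cV[F]_k.+1) c (p : {poly F}) :
  M *m v = c *: v -> horner_mx M p *m v = p.[c] *: v.
Proof.
move=> Mv; elim/poly_ind: p => [|p a IH]; first by rewrite rmorph0 mul0mx horner0 scale0r.
rewrite rmorphD rmorphM /= horner_mx_X horner_mx_C mulmxDl -mulmxE -mulmxA Mv.
by rewrite -scalemxAr IH mul_scalar_mx !hornerE scalerDl scalerA mulrC.
Qed.

Lemma eq_mulmx_cV (F : fieldType) k (M N : 'M[F]_k) :
  (forall v : 'cV_k, M *m v = N *m v) -> M = N.
Proof.
move=> h; apply/matrixP => i j.
by have /matrixP/(_ i 0) := h (delta_mx j 0); rewrite -!colE !mxE.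
Qed.

Section CasimirSingular.
Variables (F : numFieldType) (n : nat) (A : 'M[int]_n) (d : 'I_n -> int) (m : int).
Variables (th et : 'rV[int]_n).
Hypothesis H : finite_type A d m th et.
Variables (g : lieAlgebra F) (e f : 'I_n -> g).
Variable cd : casimir_datum A e f.
Variables (dd : nat) (V : lie_rep g dd).
Let B := cz_B cd.

Lemma Om_singular mu v : singular e f V mu v ->
  Om cd V *m v = (bil B (mu + rho n) (mu + rho n) - bil B (rho n) (rho n)) *: v.
Proof.
move=> sv; have hv i : V [[e i, f i]] *m v = (mu 0 i)%:~R *: v by case: (sv i).
have ev : forall i, V (e i) *m v = 0 by move=> i; case: (sv i).
have efv (p : 'I_(cz_r cd)) : V [[cz_e p, cz_f p]] *m v = bil B (cz_al p) mu *: v.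
  rewrite cz_ef rep_sum mulmx_suml /bil mxE scaler_suml; apply: eq_bigr => i _.
  by rewrite repZ -scalemxAl hv scalerA; congr (_ * _ *: _); rewrite !mxE.
have -> : bil B (mu + rho n) (mu + rho n) - bil B (rho n) (rho n) =
    bil B mu mu + bil B (2 *: rho n) mu.
  rewrite bilZl ?cz_sym // !(bilDl, bilDr) (bilC (cz_sym cd) mu (rho n)) -[2%:~R]/(2%:R); ring.
rewrite /Om /casimir mulmxDl scalerDl; congr (_ + _).
  rewrite /bil mxE scaler_suml exchange_big /= mulmx_suml; apply: eq_bigr => j _.
  rewrite mulmx_suml mxE mulr_suml scaler_suml; apply: eq_bigr => i _.
  rewrite -scalemxAl -mulmxA hv -scalemxAr hv !scalerA !mxE; congr (_ *: _); ring.
rewrite mulmx_suml -(cd_sum H cd) (big_morph (fun x => bil B x mu) (id1 := 0) (op1 := +%R)).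
- rewrite scaler_suml; apply: eq_bigr => p _; rewrite -efv rep_bracket.
  by rewrite !mulmxDl mulNmx -!mulmxA (cz_kill ev) mulmx0 addr0 subr0.
- by move=> x y; rewrite bilDl.
- by rewrite -(scale0r 0) bilC ?cz_sym // bilZr mul0r.
Qed.

End CasimirSingular.

(** * Counting singular vectors *)

Section SingularCount.
Variables (F : numFieldType) (n : nat) (A : 'M[int]_n) (d : 'I_n -> int) (m : int).
Variables (th et : 'rV[int]_n).
Hypothesis H : finite_type A d m th et.
Let hth := ft_high H.
Let A2 := ft_diag H.
Variables (g : lieAlgebra F) (e f : 'I_n -> g).
Hypothesis chev : chevalley_generators A e f.
Variable cd : casimir_datum A e f.
Variables (dd : nat) (V : lie_rep g dd.+1) (wt : 'I_dd.+1 -> 'rV[int]_n).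
Hypothesis Vh : diagonal_rep e f V wt.
Let B := cz_B cd.
Let bilE := bil_gf H (cz_sym cd) (cz_weyl cd) (cz_unit cd).
Variable nu : 'rV[int]_n.
Implicit Types (mu b : 'rV[int]_n) (v : 'cV[F]_dd.+1).
Hypothesis nu_dom : dominant nu.
Let Cas := Om cd V.
Let c := bil B (nu + rho n) (nu + rho n) - bil B (rho n) (rho n).

(** Bezout for the two factors of the characteristic polynomial. The exponent [k.+1], one above the
    multiplicity of [c], makes [1 - p1] divisible by ['X - c%:P] even if [c] is not an
    eigenvalue. *)
Lemma casimir_projector : exists p1 p2 : {poly F}, exists k,
  1 = p1 + p2 * ('X - c%:P) /\ horner_mx Cas (p1 * ('X - c%:P) ^+ k) = 0.
Proof.
have chi0 : char_poly Cas != 0 by rewrite monic_neq0 ?char_poly_monic.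
have [k [q q0 chiE] ] := multiplicity_XsubC (char_poly Cas) c.
rewrite chi0 /= in q0.
have /Bezout_eq1_coprimepP [uv uvE] : coprimep q (('X - c%:P) ^+ k.+1).
  by rewrite coprimep_expr // coprimep_XsubC.
exists (uv.1 * q), (uv.2 * ('X - c%:P) ^+ k), k; split; first by rewrite -uvE exprSr mulrA.
by rewrite -mulrA -chiE rmorphM /= Cayley_Hamilton mulr0.
Qed.

Lemma same_casimir mu b : dominant mu -> (forall i, 0 <= b 0 i) -> mu = nu + root_lattice A b ->
  bil B (mu + rho n) (mu + rho n) - bil B (rho n) (rho n) = c -> mu = nu.
Proof.
move=> mud b0 muE /addIr; have [tau tau0 bE] := bilE.
rewrite !bE => /(mulfI tau0)/eqP; rewrite eqr_int => /eqP gfE.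
apply: (addIr (rho n)); apply: (dominant_norm_eq H (c := b)) => //.
- by move=> i; rewrite rowDE addr_ge0 ?mud // mxE.
- by move=> i; rewrite rowDE addr_ge0 ?nu_dom // mxE.
- by rewrite muE opprD addrACA subrr addr0 addrAC subrr add0r.
- by rewrite gfE.
Qed.

Lemma Cas_comm x : V x *m Cas = Cas *m V x.
Proof. exact: cz_comm. Qed.

Lemma horner_comm p x : V x *m horner_mx Cas p = horner_mx Cas p *m V x.
Proof. by apply: comm_mx_horner; exact: Cas_comm. Qed.

Lemma gf_simple_rho_gt0 i : 0 < gf A (simple_root A i) (rho n).
Proof.
have := gf_simple hth A2 (rho n) i; rewrite mxE mul1r gfC.
by have := g_gt0 hth A2 i; lia.
Qed.

(** Descending induction on the height [ht], which is bounded on weights. Once the claim holds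
    higher up, [E *m v] is singular of weight [mu] above [nu]; it is an eigenvector for an
    eigenvalue other than [c], yet a power of [Cas - c] kills it. *)
Lemma kill_above p1 k : horner_mx Cas (p1 * ('X - c%:P) ^+ k) = 0 ->
  forall mu v b, (forall i, 0 <= b 0 i) -> b != 0 -> mu = nu + root_lattice A b ->
  weight_vec e f V mu v -> horner_mx Cas p1 *m v = 0.
Proof.
move=> p1k; set E := horner_mx Cas p1.
pose ht x := gf A x (rho n); pose K := (\sum_j absz (ht (wt j)))%N.
have htK j : ht (wt j) <= K%:Z by rewrite /K (bigD1 j) //=; lia.
suff : forall q mu v b, K%:Z - ht mu < q%:Z -> (forall i, 0 <= b 0 i) -> b != 0 ->
   mu = nu + root_lattice A b -> weight_vec e f V mu v -> E *m v = 0.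
  move=> h mu v b; apply: (h (absz (K%:Z - ht mu)).+1); lia.
elim=> [|q IH] mu v b htq b0 bn0 muE wv.
  suff -> : v = 0 by rewrite mulmx0.
  apply/matrixP => j z; rewrite ord1 mxE; apply/eqP; apply: contraT => vj.
  by have := htK j; rewrite (iffLR (weight_vecP Vh _ _) wv j vj); lia.
apply/eqP; apply: contraT => Ev0; set u := E *m v in Ev0.
have su : singular e f V mu u.
  move=> i; split; last by rewrite mulmxA horner_comm -mulmxA wv -scalemxAr.
  rewrite mulmxA horner_comm -mulmxA.
  apply: (IH (mu + simple_root A i) _ (b + delta_mx 0 i)).
  - by rewrite /ht gfDl; have := gf_simple_rho_gt0 i; rewrite /ht in htq; lia.
  - by move=> j; rewrite rowDE rowdE addr_ge0.
  - apply: contra bn0 => /eqP /(cone_addr_eq0 b0) -> // j; by rewrite rowdE.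
  - by rewrite muE root_latticeD root_lattice_delta addrA.
  - exact: (weight_vec_act (has_weight_e chev i) wv).
have := Om_singular H cd su; rewrite -/Cas -/B => Ou.
have := horner_mx_eigen (('X - c%:P) ^+ k) Ou.
have -> : horner_mx Cas (('X - c%:P) ^+ k) *m u = 0.
  by rewrite /u /E mulmxA mulmxE -rmorphM (mulrC _ p1) /= p1k mul0mx.
rewrite horner_exp !hornerE => /esym/eqP; rewrite scaler_eq0 (negPf Ev0) orbF.
rewrite expf_eq0 => /andP[_]; rewrite subr_eq0 => /eqP.
move/(same_casimir (singular_dominant H chev Vh su Ev0) b0 muE) => mnu.
move: bn0; rewrite (root_lattice_inj hth (x1 := b) (x2 := 0)) ?eqxx //.
by rewrite root_lattice0; apply: (addrI nu); rewrite addr0 -muE.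
Qed.

(** [E] fixes singular vectors of weight [nu], and by [kill_above] it sends that weight space into
    them. So [E] after the projection on the weight space is idempotent, with the singular vectors
    as image and the trace of [E] there as rank. *)
Theorem singular_count : exists r, exists C : 'M[F]_(dd.+1, r),
  [/\ forall a : 'cV_r, C *m a = 0 -> a = 0,
      forall v, singular e f V nu v <-> exists a, v = C *m a &
      r%:R = \sum_(w <- weyl_seq A) (\det w)%:~R * (mult wt (nu + rho n - rho n *m w))%:R :> F].
Proof.
have [p1 [p2 [k [p12 p1k] ] ] ] := casimir_projector.
pose E := horner_mx Cas p1; pose Z := horner_mx Cas p2.
have E1 : 1%:M = E + (Cas - c%:M) *m Z.
  have := congr1 (horner_mx Cas) p12; rewrite rmorph1 => E0; apply: (etrans E0).
  rewrite rmorphD rmorphM /= rmorphB /= horner_mx_X horner_mx_C; congr (_ + _).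
  rewrite -mulmxE mulmxBr mulmxBl mul_mx_scalar mul_scalar_mx; congr (_ - _).
  by apply/esym/comm_mx_horner.
pose P := diag_mx (\row_j (wt j == nu)%:R) : 'M[F]_dd.+1.
have Pw v : weight_vec e f V nu (P *m v).
  apply/(weight_vecP Vh) => j; rewrite mul_diag_mx !mxE.
  by case: (wt j =P nu) => //= _; rewrite mul0r eqxx.
have Pid v : weight_vec e f V nu v -> P *m v = v.
  move=> /(weight_vecP Vh) wv; apply/matrixP => j z; rewrite ord1 mul_diag_mx !mxE.
  have [->|/wv ->] := eqVneq (v j 0) 0; first by rewrite mulr0.
  by rewrite eqxx mul1r.
have sw v : singular e f V nu v -> weight_vec e f V nu v by move=> sv i; case: (sv i).
have Es v : singular e f V nu v -> E *m v = v.
  move=> sv; rewrite -[RHS]mul1mx E1 mulmxDl -[LHS]addr0; congr (_ + _).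
  have CZ : Cas *m Z = Z *m Cas by apply: comm_mx_horner.
  have -> : (Cas - c%:M) *m Z = Z *m (Cas - c%:M).
    by rewrite mulmxBl mulmxBr CZ mul_scalar_mx mul_mx_scalar.
  by rewrite -mulmxA mulmxBl (Om_singular H cd sv) mul_scalar_mx subrr mulmx0.
have kill := kill_above p1k.
have Esing v : weight_vec e f V nu v -> singular e f V nu (E *m v).
  move=> wv i; split; last by rewrite mulmxA horner_comm -mulmxA wv -scalemxAr.
  rewrite mulmxA horner_comm -mulmxA.
  apply: (kill (nu + simple_root A i) _ (delta_mx 0 i)).
  - by move=> j; rewrite rowdE.
  - by apply/eqP => /rowP/(_ i); rewrite rowdE eqxx row0E.
  - by rewrite root_lattice_delta.
  - exact: (weight_vec_act (has_weight_e chev i) wv).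
pose M := E *m P.
have MM : M *m M = M.
  apply: eq_mulmx_cV => v; rewrite /M -!mulmxA.
  by have sE := Esing _ (Pw v); rewrite (Pid _ (sw _ sE)) (Es _ sE).
have [trM idM] := trace_idempotent MM.
exists (\rank M), (col_base M); split.
- move=> a Ca; have /row_fullP [X XC] := col_base_full M.
  by rewrite -[a]mul1mx -XC -mulmxA Ca mulmx0.
- move=> v; split=> [sv|[a ->] ].
    exists (row_base M *m v); rewrite mulmxA mulmx_base /M -mulmxA.
    by rewrite (Pid _ (sw _ sv)) (Es _ sv).
  by rewrite -idM /M -mulmxA; apply/Esing/Pw.
rewrite -trM; transitivity (tr_weight wt nu E).
  rewrite /M /mxtrace /tr_weight [RHS]big_mkcond; apply: eq_bigr => j _.
  by rewrite mul_mx_diag !mxE; case: eqP; rewrite ?mulr1 ?mulr0.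
have Lpos := @cd_L_pos _ _ _ _ _ _ cd.
pose L := [seq cz_al p | p <- index_enum 'I_(cz_r cd)].
(* All other terms of the product are traces of [E] over weight spaces above [nu], hence 0. *)
transitivity (@weyl_den F n L (fun y => tr_weight wt (nu + rho n - y) E)).
  rewrite /weyl_den (alt_sum_head (A := A)) ?addrK // => b b0 bn0.
  have -> : nu + rho n - (rho n - root_lattice A b) = nu + root_lattice A b.
    by rewrite opprB addrA (addrAC nu) addrK.
  rewrite /tr_weight big1 // => j /eqP wj.
  have := kill _ (delta_mx j 0) b b0 bn0 (erefl _).
  rewrite -/E -colE => /(_ _)/matrixP/(_ j 0); rewrite !mxE; apply.
  apply/(weight_vecP Vh) => l; rewrite mxE andbT; case: (l =P j) => [-> //|_] /=.
  by rewrite eqxx.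
(* The difference [1 - E] is [(Cas - c) *m Z], and [freudenthal] at [nu + rho n] has exactly the
   factor [c]: the difference contributes 0. *)
transitivity (@weyl_den F n L (fun y => tr_weight wt (nu + rho n - y) 1%:M)).
  rewrite /weyl_den [RHS](@eq_alt_sum _ _ _ _ (fun y => tr_weight wt (nu + rho n - y) E +
    (tr_weight wt (nu + rho n - y) (Cas *m Z) +
     - c * tr_weight wt (nu + rho n - y) Z))); last first.
    move=> y; rewrite E1 tr_weightD mulmxBl mul_scalar_mx -scaleNr.
    by rewrite [tr_weight _ _ (_ + (- c) *: _)]tr_weightD tr_weightZ.
  rewrite !alt_sumD alt_sumZ.
  have := @freudenthal _ _ _ _ _ _ _ H _ _ _ cd _ _ _ Vh Z (fun x => horner_comm p2 x) (nu + rho n).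
  by rewrite /weyl_den -/B -/c => ->; rewrite mulNr subrr addr0.
rewrite (weyl_denominator H Lpos (@cz_perm _ _ _ _ _ _ cd)).
by apply: eq_bigr => w _; rewrite mult_tr.
Qed.

End SingularCount.

(** * The Killing form *)

Section MaximalFree.
Variables (F : fieldType) (vT : vectType F).

Lemma max_free (C : vT -> Prop) (s0 : seq vT) : free s0 ->
  exists s, [/\ free (s0 ++ s), forall x, x \in s -> C x & forall x, C x -> x \in <<s0 ++ s>>%VS].
Proof.
move=> f0; suff : forall k s, free (s0 ++ s) -> (forall x, x \in s -> C x) ->
    (\dim {:vT} - size (s0 ++ s) < k)%N ->
    exists s, [/\ free (s0 ++ s), forall x, x \in s -> C x & forall x, C x -> x \in <<s0 ++ s>>%VS].
  by move=> /(_ _ [::]); apply; rewrite ?cats0.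
elim=> // k IH s fs Cs sk.
have [ [x Cx xs]|nex] := pselect (exists2 x, C x & x \notin <<s0 ++ s>>%VS); last first.
  exists s; split=> // x Cx; apply: contrapT => /negP xs; apply: nex; by exists x.
have fx : free (s0 ++ rcons s x).
  by rewrite -rcons_cat (perm_free (permEl (perm_rcons _ _))) free_cons xs.
have size_le (t : seq vT) : free t -> (size t <= \dim {:vT})%N.
  by rewrite /free => /eqP <-; rewrite dimvS // subvf.
apply: (IH _ fx) => [y|]; first by rewrite mem_rcons inE => /predU1P[-> //|/Cs].
by have := size_le _ fx; move: sk; rewrite !size_cat size_rcons; lia.
Qed.

(** Makes subspaces out of sets given by a property, so that simplicity, irreducibility and
    generation can be applied to radicals, stabilizers and graphs. *)
Lemma prop_subspace (P : vT -> Prop) : P 0 -> (forall a x y, P x -> P y -> P (a *: x + y)) ->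
  exists U : {vspace vT}, forall x, x \in U <-> P x.
Proof.
move=> P0 Plin; have [s [_ sP Ps] ] := max_free P (nil_free vT).
exists <<s>>%VS => x; split; last exact: Ps.
move=> xs; rewrite (@coord_span _ _ _ (in_tuple s) _ xs); elim/big_ind: _ => // [y z Py Pz|i _].
  by rewrite -[y]scale1r; exact: Plin.
by rewrite -[_ *: _]addr0; apply: Plin => //; apply: sP; rewrite mem_nth.
Qed.

End MaximalFree.

Section LieBasics.
Variables (F : fieldType) (g : lieAlgebra F).
Implicit Types x y z : g.

Lemma lieDl x y z : [[x + y, z]] = [[x, z]] + [[y, z]].
Proof. by have := lie_bracket_linearl z 1 x y; rewrite /= !scale1r. Qed.
Lemma lieDr x y z : [[x, y + z]] = [[x, y]] + [[x, z]].
Proof. by have := lie_bracket_linearr x 1 y z; rewrite !scale1r. Qed.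
Lemma lie0l z : [[0, z]] = 0.
Proof. by apply: (addrI [[0, z]]); rewrite -lieDl !addr0. Qed.
Lemma lie0r z : [[z, 0]] = 0.
Proof. by apply: (addrI [[z, 0]]); rewrite -lieDr !addr0. Qed.
Lemma lieZl a x y : [[a *: x, y]] = a *: [[x, y]].
Proof. by have := lie_bracket_linearl y a x 0; rewrite /= !addr0 lie0l addr0. Qed.
Lemma lieZr a x y : [[x, a *: y]] = a *: [[x, y]].
Proof. by have := lie_bracket_linearr x a y 0; rewrite /= !addr0 lie0r addr0. Qed.
Lemma lieNl x y : [[- x, y]] = - [[x, y]].
Proof. by rewrite -scaleN1r lieZl scaleN1r. Qed.
Lemma lieNr x y : [[x, - y]] = - [[x, y]].
Proof. by rewrite -scaleN1r lieZr scaleN1r. Qed.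
Lemma lie_suml I (r : seq I) (G : I -> g) y :
  [[\sum_(i <- r) G i, y]] = \sum_(i <- r) [[G i, y]].
Proof. by apply: (big_morph (fun x => [[x, y]])); [move=> *; exact: lieDl|exact: lie0l]. Qed.
Lemma lie_sumr I (r : seq I) (G : I -> g) y :
  [[y, \sum_(i <- r) G i]] = \sum_(i <- r) [[y, G i]].
Proof. by apply: (big_morph (fun x => [[y, x]])); [move=> *; exact: lieDr|exact: lie0r]. Qed.

Lemma lieC x y : [[x, y]] = - [[y, x]].
Proof.
have := lie_bracketxx (x + y); rewrite lieDl !lieDr !lie_bracketxx add0r addr0 => /eqP.
by rewrite addr_eq0 => /eqP.
Qed.

Lemma jacobi x y z : [[x, [[y, z]] ]] = [[ [[x, y]], z]] + [[y, [[x, z]] ]].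
Proof.
have /eqP := lie_jacobi x y z; rewrite -addrA addr_eq0 => /eqP ->.
by rewrite opprD [ [[ [[x, y]], z]] ]lieC addrC [ [[z, x]] ]lieC lieNr opprK.
Qed.

End LieBasics.

(** * Iterated brackets and the triangular decomposition *)

Section Generated.
Variables (F : numFieldType) (n : nat) (A : 'M[int]_n) (g : lieAlgebra F).

(** Right-nested brackets of the generators [x] with their weights; they will span the nilpotent
    halves of the algebra. *)
Inductive gen_bracket (x : 'I_n -> g) (r : 'I_n -> 'rV[int]_n) : g -> 'rV[int]_n -> Prop :=
  | gen_one i : gen_bracket x r (x i) (r i)
  | gen_step i y b : gen_bracket x r y b -> gen_bracket x r [[x i, y]] (r i + b).

Variables (e f : 'I_n -> g).
Hypothesis chev : chevalley_generators A e f.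
Let al i := simple_root A i.

Lemma has_weight_bracket (u v : 'I_n -> g) a b z t :
  has_weight u v z a -> has_weight u v t b -> has_weight u v [[z, t]] (a + b).
Proof.
move=> za tb i; rewrite jacobi za tb lieZl lieZr -scalerDl rowDE rmorphD; by [].
Qed.

Lemma gen_weight_e y b : gen_bracket e al y b -> has_weight e f y b.
Proof.
elim=> [i|i z c _ IH]; first exact: has_weight_e.
apply: has_weight_bracket IH => //; exact: has_weight_e.
Qed.

Lemma gen_weight_f y b : gen_bracket f (fun i => - al i) y b -> has_weight e f y b.
Proof.
elim=> [i|i z c _ IH]; first exact: has_weight_f.
apply: has_weight_bracket IH => //; exact: has_weight_f.
Qed.

Lemma gen_positive y b : gen_bracket e al y b -> positive A b.
Proof.
elim=> [i|i z b' _ [c [c0 cn0 ->] ] ].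
  exists (delta_mx 0 i); rewrite root_lattice_delta; split=> // [j|]; first by rewrite rowdE.
  by apply/eqP => /rowP/(_ i); rewrite rowdE eqxx row0E.
exists (delta_mx 0 i + c); split=> [j||]; first by rewrite rowDE rowdE addr_ge0.
- apply/eqP => ic; have /eqP := cn0; apply; move: ic; rewrite addrC.
  by apply: cone_addr_eq0 => // j; rewrite rowdE.
- by rewrite root_latticeD root_lattice_delta.
Qed.

Lemma gen_negative y b : gen_bracket f (fun i => - al i) y b -> positive A (- b).
Proof.
elim=> [i|i z b' _ [c [c0 cn0 cE] ] ].
  exists (delta_mx 0 i); rewrite root_lattice_delta opprK; split=> // [j|]; first by rewrite rowdE.
  by apply/eqP => /rowP/(_ i); rewrite rowdE eqxx row0E.
exists (delta_mx 0 i + c); split=> [j||]; first by rewrite rowDE rowdE addr_ge0.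
- apply/eqP => ic; have /eqP := cn0; apply; move: ic; rewrite addrC.
  by apply: cone_addr_eq0 => // j; rewrite rowdE.
- by rewrite root_latticeD root_lattice_delta -cE opprD opprK.
Qed.

Lemma gen_kill dd (V : lie_rep g dd) (v : 'cV_dd) : (forall i, V (e i) *m v = 0) ->
  forall y b, gen_bracket e al y b -> V y *m v = 0.
Proof.
move=> ev y b; elim=> [i|i z c _ IH]; first exact: ev.
by rewrite rep_bracket mulmxBl -!mulmxA ev IH !mulmx0 subrr.
Qed.

End Generated.

Lemma chevalley_swap (F : numFieldType) n (A : 'M[int]_n) (g : lieAlgebra F) (e f : 'I_n -> g) :
  chevalley_generators A e f -> chevalley_generators A f e.
Proof.
case=> ef hh he hf gen; split.
- by move=> i j ij; rewrite lieC ef ?oppr0 // eq_sym.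
- by move=> i j; rewrite [ [[f i, e i]] ]lieC [ [[f j, e j]] ]lieC lieNl lieNr hh !oppr0.
- by move=> i j; rewrite [ [[f i, e i]] ]lieC lieNl hf opprK.
- by move=> i j; rewrite [ [[f i, e i]] ]lieC lieNl he.
- by move=> S SS Sg; apply: gen => // i; case: (Sg i).
Qed.

Section NonzeroGenerators.
Variables (F : numFieldType) (n : nat) (A : 'M[int]_n) (d : 'I_n -> int) (m : int).
Variables (th et : 'rV[int]_n).
Hypothesis H : finite_type A d m th et.
Let hth := ft_high H.
Let A2 := ft_diag H.
Variables (g : lieAlgebra F) (e f : 'I_n -> g).
Hypothesis chev : chevalley_generators A e f.
Hypothesis simple : simple_lie g.

(** If e_j = 0, then [h_j, e_i] = 0 kills the neighbouring e_i; along the connected diagram all e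
    vanish, then all f, and the algebra would be 0. *)
Lemma gen_neq0 i : e i != 0.
Proof.
have [i0 [_ _ [_ conn] ] ] := highest_connected hth A2.
have step i1 j : A j i1 != 0 -> e j = 0 -> e i1 = 0.
  move=> Aji ej0; have := chev_he chev j i1; rewrite ej0 !lie0l => /esym/eqP.
  by rewrite scaler_eq0 intr_eq0 (negPf Aji) => /eqP.
apply: (conn (fun i => is_true (e i != 0))); last first.
  by move=> i1 j ei Aji; apply: contra ei => /eqP ej; apply/eqP/(step _ j).
apply/eqP => e0; have e0' : forall j, e j = 0.
  apply: conn => // i1 j ei Aji; apply: (step _ i1) => //.
  exact: (cartan_neq0 H).
have f0 j : f j = 0.
  have := chev_hf chev j j; rewrite e0' !lie0l => /esym/eqP.
  by rewrite oppr_eq0 scaler_eq0 intr_eq0 A2 /= => /eqP.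
have [ [x [y xy] ] _] := simple.
have full0 : 0%VS = fullv :> {vspace g}.
  apply: (chev_gen chev) => [u v|j]; last by rewrite e0' f0 mem0v.
  by rewrite !memv0 => /eqP -> _; rewrite lie0l.
have : [[x, y]] \in (fullv : {vspace g}) by exact: memvf.
by rewrite -full0 memv0 (negPf xy).
Qed.

(** Bracketing the relation with each e_j, which is nonzero, shows that the invertible Cartan matrix
    annihilates the coefficients. *)
Lemma cartan_free (c : 'I_n -> F) : \sum_i c i *: [[e i, f i]] = 0 -> forall i, c i = 0.
Proof.
move=> c0; pose u := \row_i c i.
have uA : u *m map_mx intr A = 0.
  apply/rowP => j; rewrite !mxE; have := congr1 (fun x => [[x, e j]]) c0.
  rewrite /= lie_suml lie0l => cj.
  have : (\sum_i u 0 i * (A i j)%:~R) *: e j = 0.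
    rewrite -cj scaler_suml; apply: eq_bigr => i _.
    by rewrite lieZl (chev_he chev) scalerA mxE.
  move/eqP; rewrite scaler_eq0 (negPf (gen_neq0 j)) orbF => /eqP E; rewrite -[RHS]E.
  by apply: eq_bigr => i _; rewrite !mxE.
have u0 : u = 0.
  have dA : \det (map_mx intr A : 'M[F]_n) != 0.
    by rewrite det_map_mx intr_eq0 -det_tr (det_cartan_neq0 hth).
  apply/eqP; apply: contraT => un0; case/negP: dA; apply/det0P; by exists u.
by move=> i; have /rowP/(_ i) := u0; rewrite !mxE.
Qed.

End NonzeroGenerators.

Lemma gen_reweight (F : numFieldType) n (g : lieAlgebra F) (x : 'I_n -> g) r r' y b :
  gen_bracket x r y b -> exists b', gen_bracket x r' y b'.
Proof.
elim=> [i|i z c _ [b' IH] ]; first by exists (r' i); exact: gen_one.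
by exists (r' i + b'); exact: gen_step.
Qed.

Section Structure.
Variables (F : numFieldType) (n : nat) (A : 'M[int]_n) (g : lieAlgebra F).

(** [W] is quantified inside the induction because the hypothesis is used for another subspace, the
    preimage of [W] under the bracket with f_j. *)
Lemma ad_e_negative (e f : 'I_n -> g) (chev : chevalley_generators A e f) i y b :
  gen_bracket f (fun i => - simple_root A i) y b ->
  forall W : {vspace g}, (forall j, [[e j, f j]] \in W) ->
  (forall y b, gen_bracket f (fun i => - simple_root A i) y b -> y \in W) -> [[e i, y]] \in W.
Proof.
elim=> [j|j z c gz IH] W hW nW.
  by have [->//|ij] := eqVneq i j; rewrite (chev_ef chev) // mem0v.
rewrite jacobi memvD //.
  have [->|ij] := eqVneq i j; last by rewrite (chev_ef chev) // lie0l mem0v.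
  by rewrite (gen_weight_f chev gz) memvZ // (nW _ c).
have [|a x1 x2|W' W'P] := @prop_subspace F g (fun x => [[f j, x]] \in W).
- by rewrite lie0r mem0v.
- by move=> W1 W2; rewrite lieDr lieZr memvD // memvZ.
apply/W'P/IH => [l|y' b' gy']; apply/W'P; last first.
  by apply: (nW _ (- simple_root A j + b')); exact: gen_step.
rewrite lieC (chev_hf chev) opprK memvZ // (nW _ (- simple_root A j)) //; exact: gen_one.
Qed.

Variables (d : 'I_n -> int) (m : int) (th et : 'rV[int]_n).
Hypothesis H : finite_type A d m th et.
Variables (e f : 'I_n -> g).
Hypothesis chev : chevalley_generators A e f.
Hypothesis simple : simple_lie g.
Let al i := simple_root A i.
Let pos := gen_bracket e al.
Let neg := gen_bracket f (fun i => - al i).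

(** The span [U] is stable under brackets with all e_i and f_i. The elements preserving [U] form a
    subalgebra, hence everything; so [U] is itself a subalgebra containing the generators. *)
Lemma generated_full (s0 s : seq g) :
  (forall x, x \in s0 -> exists i, x = [[e i, f i]]) -> (forall i, [[e i, f i]] \in s0) ->
  (forall x, x \in s -> exists b, pos x b \/ neg x b) ->
  (forall x b, pos x b \/ neg x b -> x \in <<s0 ++ s>>%VS) -> <<s0 ++ s>>%VS = fullv.
Proof.
move=> s0P s0h sP sU; set U := <<_>>%VS.
have hU i : [[e i, f i]] \in U by apply: memv_span; rewrite mem_cat s0h.
have span_ind (P : g -> Prop) : P 0 -> (forall a x y, P x -> P y -> P (a *: x + y)) ->
    (forall i, P [[e i, f i]]) -> (forall x b, pos x b -> P x) -> (forall x b, neg x b -> P x) ->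
    forall u, u \in U -> P u.
  move=> P0 Pl Ph Pp Pn u uU; rewrite (@coord_span _ _ _ (in_tuple (s0 ++ s)) _ uU).
  elim/big_ind: _ => // [y z Py Pz|i _]; first by rewrite -[y]scale1r; exact: Pl.
  rewrite -[_ *: _]addr0; apply: Pl => //.
  have : (s0 ++ s)`_i \in s0 ++ s by rewrite mem_nth.
  rewrite mem_cat => /orP[/s0P [j ->]//|/sP [b [/Pp|/Pn] ] //].
have adU x : (forall i, [[x, [[e i, f i]] ]] \in U) -> (forall y b, pos y b -> [[x, y]] \in U) ->
    (forall y b, neg y b -> [[x, y]] \in U) -> forall u, u \in U -> [[x, u]] \in U.
  move=> xh xp xn; apply: span_ind => //; first by rewrite lie0r mem0v.
  by move=> a y z yU zU; rewrite lieDr lieZr memvD // memvZ.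
have eU i : forall u, u \in U -> [[e i, u]] \in U.
  apply: adU => [j|y b py|y b ny].
  - rewrite lieC (chev_he chev) -scaleNr memvZ // (sU _ (al i)) //; left; exact: gen_one.
  - apply: (sU _ (al i + b)); left; exact: gen_step.
  - apply: (ad_e_negative chev _ ny) => // y' b' ny'; apply: (sU _ b'); by right.
have fU i : forall u, u \in U -> [[f i, u]] \in U.
  apply: adU => [j|y b py|y b ny].
  - rewrite lieC (chev_hf chev) opprK memvZ // (sU _ (- al i)) //; right; exact: gen_one.
  - have [b' py'] := gen_reweight (fun i => - simple_root A i) py.
    apply: (ad_e_negative (chevalley_swap chev) _ py') => [j|z c /(gen_reweight al) [c' pz] ].
      by rewrite lieC memvN.
    by apply: (sU _ c'); left.
  - apply: (sU _ (- al i + b)); right; exact: gen_step.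
have [|a x1 x2 h1 h2 u uU|T TP] := @prop_subspace F g (fun x => forall u, u \in U -> [[x, u]] \in U).
- by move=> u _; rewrite lie0l mem0v.
- by rewrite lieDl lieZl memvD ?memvZ ?h1 ?h2.
have Tfull : T = fullv.
  apply: (chev_gen chev) => [x y /TP xT /TP yT|i].
    apply/TP => u uU; have -> : [[ [[x, y]], u]] = [[x, [[y, u]] ]] - [[y, [[x, u]] ]].
      by rewrite (jacobi x) addrK.
    by apply: memvB; [apply/xT/yT|apply/yT/xT].
  by split; apply/TP; [exact: eU|exact: fU].
apply: (chev_gen chev) => [x y xU yU|i].
  by have /TP : x \in T; [rewrite Tfull memvf|apply].
by split; [apply: (sU _ (al i)); left|apply: (sU _ (- al i)); right]; exact: gen_one.
Qed.

Lemma lie_basis : exists N (X : (n + N).-tuple g) (w : 'I_N -> 'rV[int]_n) (sg : 'I_N -> bool),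
  [/\ basis_of fullv X, forall i, tnth X (lshift N i) = [[e i, f i]] &
      forall q, if sg q then pos (tnth X (rshift n q)) (w q)
                else neg (tnth X (rshift n q)) (w q)].
Proof.
pose s0 := [tuple [[e i, f i]] | i < n].
have f0 : free s0.
  apply/freeP => k k0; apply: (cartan_free H chev simple).
  by rewrite -[RHS]k0; apply: eq_bigr => i _; rewrite -tnth_nth tnth_mktuple.
have [s [fs sC Cs] ] := max_free (fun x => exists b, pos x b \/ neg x b) f0.
have full : <<s0 ++ s>>%VS = fullv.
  apply: generated_full => //; last by move=> x b xb; apply: Cs; exists b.
    by move=> x /mapP[i _ ->]; exists i.
  by move=> i; apply/mapP; exists i; rewrite ?mem_enum.
pose X := [tuple of s0 ++ in_tuple s].
have XE q : tnth X (rshift n q) = s`_q.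
  rewrite (tnth_nth 0) /= nth_cat size_map size_enum_ord ltnNge leq_addr /=.
  by rewrite addKn.
have sgP (q : 'I_(size s)) : exists bw : bool * 'rV[int]_n,
    if bw.1 then pos s`_q bw.2 else neg s`_q bw.2.
  by have /sC [b [p|p] ] := mem_nth 0 (ltn_ord q); [exists (true, b)|exists (false, b)].
have [bw bwP] := boolp.choice sgP.
exists (size s), X, (fun q => (bw q).2), (fun q => (bw q).1); split.
- by apply/andP; split; [apply/eqP; exact: full|exact: fs].
- move=> i; rewrite (tnth_nth 0) /= nth_cat size_map size_enum_ord ltn_ord.
  by rewrite -(tnth_nth 0 s0 i) tnth_mktuple.
- by move=> q; rewrite XE; exact: bwP.
Qed.

End Structure.

(** * The Casimir element of the Killing form *)

Section Killing.
Variables (F : numFieldType) (n : nat) (A : 'M[int]_n) (g : lieAlgebra F).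
Variables (d : 'I_n -> int) (m : int) (th et : 'rV[int]_n).
Hypothesis H : finite_type A d m th et.
Let hth := ft_high H.
Let A2 := ft_diag H.
Variables (e f : 'I_n -> g).
Hypothesis chev : chevalley_generators A e f.
Hypothesis simple : simple_lie g.
Let al i := simple_root A i.
Let pos := gen_bracket e al.
Let neg := gen_bracket f (fun i => - al i).
Variables (N : nat) (X : (n + N).-tuple g) (w : 'I_N -> 'rV[int]_n) (sg : 'I_N -> bool).
Hypothesis hX : basis_of fullv X.
Hypothesis hXh : forall i, tnth X (lshift N i) = [[e i, f i]].
Hypothesis hXq : forall q, if sg q then pos (tnth X (rshift n q)) (w q)
                           else neg (tnth X (rshift n q)) (w q).
Implicit Types x y z : g.

Definition co y : 'cV[F]_(n + N) := \col_k coord X k y.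
Definition vecX (v : 'cV[F]_(n + N)) : g := \sum_k v k 0 *: tnth X k.

Lemma co_linear a x y : co (a *: x + y) = a *: co x + co y.
Proof. by apply/matrixP => k l; rewrite !mxE linearP. Qed.

Lemma coK y : vecX (co y) = y.
Proof.
rewrite [RHS](coord_basis hX (memvf y)); apply: eq_bigr => k _.
by rewrite mxE (tnth_nth 0).
Qed.

Lemma vecXK v : co (vecX v) = v.
Proof.
apply/matrixP => k l; rewrite ord1 mxE /vecX.
under eq_bigr do rewrite (tnth_nth 0).
by rewrite coord_sum_free // (basis_free hX).
Qed.

Lemma coord_X k l : coord X k (tnth X l) = (k == l)%:R.
Proof. by rewrite (tnth_nth 0) coord_free ?(basis_free hX) // eq_sym. Qed.

Definition adm x : 'M[F]_(n + N) := \matrix_(k, l) coord X k [[x, tnth X l]].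

Lemma adm_co x y : adm x *m co y = co [[x, y]].
Proof.
apply/matrixP => k l; rewrite -{2}(coK y) lie_sumr !mxE linear_sum.
by apply: eq_bigr => j _; rewrite !mxE lieZr linearZ /= mulrC.
Qed.

Lemma adm_linear : linear adm.
Proof. by move=> a x y; apply/matrixP => k l; rewrite !mxE lieDl lieZl linearP. Qed.

Lemma adm_bracket x y : adm [[x, y]] = adm x *m adm y - adm y *m adm x.
Proof.
apply: eq_mulmx_cV => v; rewrite -(vecXK v); set z := vecX v.
have coD a b : co (a + b) = co a + co b by rewrite -[a]scale1r co_linear !scale1r.
by rewrite mulmxBl -!mulmxA !adm_co (jacobi x) coD addrK.
Qed.

Definition adrep : lie_rep g (n + N) := LieRep adm_linear adm_bracket.

Definition wD (k : 'I_(n + N)) : 'rV[int]_n :=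
  match fintype.split k with inl _ => 0 | inr q => w q end.

Lemma wD_l i : wD (lshift N i) = 0.
Proof. by rewrite /wD (unsplitK (inl i)). Qed.

Lemma wD_r q : wD (rshift n q) = w q.
Proof. by rewrite /wD (unsplitK (inr q)). Qed.

Lemma X_weight k : has_weight e f (tnth X k) (wD k).
Proof.
case: (split_ordP k) => [i|q] ->.
  by move=> j; rewrite wD_l hXh (chev_hh chev) row0E scale0r.
rewrite wD_r; have := hXq q.
by case: (sg q); [exact: gen_weight_e|exact: gen_weight_f].
Qed.

Lemma adrep_diagonal : diagonal_rep e f adrep wD.
Proof.
move=> i; apply/matrixP => k l; rewrite !mxE X_weight linearZ /= coord_X.
by case: eqP => [->|]; rewrite ?mulr0 ?mulr1 ?mulr1n.
Qed.

Definition K x y : F := \tr (adm x *m adm y).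

Lemma K_sym x y : K x y = K y x.
Proof. exact: mxtrace_mulC. Qed.

Lemma K_linear_l a x y z : K (a *: x + y) z = a * K x z + K y z.
Proof. by rewrite /K adm_linear mulmxDl -scalemxAl mxtraceD mxtraceZ. Qed.

Lemma K0l z : K 0 z = 0.
Proof. by have := K_linear_l (-1) z z z; rewrite scaleN1r addNr mulN1r addNr. Qed.

Lemma KZl a x z : K (a *: x) z = a * K x z.
Proof. by have := K_linear_l a x 0 z; rewrite K0l !addr0. Qed.

Lemma K_suml I (r : seq I) (G : I -> g) z :
  K (\sum_(i <- r) G i) z = \sum_(i <- r) K (G i) z.
Proof.
apply: (big_morph (fun x => K x z)); last exact: K0l.
by move=> x y; have := K_linear_l 1 x y z; rewrite scale1r mul1r.
Qed.

Lemma K_inv x y z : K [[z, x]] y = - K x [[z, y]].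
Proof.
rewrite /K !adm_bracket; move: (adm x) (adm y) (adm z) => a b c.
have trB (M1 M2 : 'M[F]_(n + N)) : \tr (M1 - M2) = \tr M1 - \tr M2 by exact: raddfB.
rewrite mulmxBl mulmxBr !trB !mulmxA opprB; congr (_ - _).
by rewrite -(mulmxA c) mxtrace_mulC.
Qed.

Lemma K_weight x y a b : has_weight e f x a -> has_weight e f y b -> a + b != 0 -> K x y = 0.
Proof.
move=> xa yb; apply: contraNeq => Kxy; apply/eqP/rowP => i.
have := K_inv x y [[e i, f i]]; rewrite xa yb KZl (K_sym x (_ *: _)) KZl (K_sym y) => /eqP.
rewrite -subr_eq0 opprK -mulrDl mulf_eq0 (negPf Kxy) orbF -rmorphD intr_eq0 => /eqP.
by rewrite rowDE row0E.
Qed.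

Lemma K_h i j : K [[e i, f i]] [[e j, f j]] = (\sum_k wD k 0 i * wD k 0 j)%:~R.
Proof.
rewrite /K; have -> : adm [[e i, f i]] = diag_mx (\row_k (wD k 0 i)%:~R) := adrep_diagonal i.
have -> : adm [[e j, f j]] = diag_mx (\row_k (wD k 0 j)%:~R) := adrep_diagonal j.
rewrite rmorph_sum; apply: eq_bigr => k _.
by rewrite mul_diag_mx !mxE eqxx mulr1n rmorphM.
Qed.

Lemma coZ a x : co (a *: x) = a *: co x.
Proof. by apply/matrixP => k l; rewrite !mxE linearZ. Qed.

Lemma co_weight x b : has_weight e f x b -> forall k, co x k 0 != 0 -> wD k = b.
Proof.
move=> xb; apply/(weight_vecP adrep_diagonal) => i.
by rewrite -[adrep _]/(adm _) adm_co xb coZ.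
Qed.

Lemma wD_e i : exists2 k, wD k = al i & co (e i) k 0 != 0.
Proof.
have [k ek] : exists k, co (e i) k 0 != 0.
  apply/existsP; apply: contraT => /existsPn h; have := gen_neq0 H chev simple i.
  rewrite -(coK (e i)) /vecX big1 ?eqxx // => k _.
  by have /negbNE/eqP -> := h k; rewrite scale0r.
by exists k => //; apply: (co_weight (has_weight_e chev i)).
Qed.

(** The radical is an ideal. It is not everything, because K(h_i, h_i) is a sum of squares of
    integers, one of which comes from the weight alpha_i and is 4. *)
Lemma K_nondegenerate x : (forall y, K x y = 0) -> x = 0.
Proof.
move=> Kx; have [|a y z Ky Kz u|U UP] := @prop_subspace F g (fun x => forall y, K x y = 0).
- by move=> y; rewrite K0l.
- by rewrite K_linear_l Ky Kz mulr0 addr0.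
have idealU : lie_ideal U.
  by move=> y z /UP Kz; apply/UP => u; rewrite K_inv Kz oppr0.
have [_ /(_ U idealU) [U0|Ufull] ] := simple.
  by apply/eqP; rewrite -memv0 -U0; apply/UP.
have [i0 _] := highest_connected hth A2.
have /UP/(_ [[e i0, f i0]]) : [[e i0, f i0]] \in U by rewrite Ufull memvf.
rewrite K_h => /eqP; rewrite intr_eq0 psumr_eq0 => [/allP h|k _]; last by rewrite -expr2 sqr_ge0.
have [k wk _] := wD_e i0; have := h k (mem_index_enum _).
by rewrite /= wk simple_rootE A2.
Qed.

Definition Kh : 'M[F]_n := \matrix_(i, j) K [[e i, f i]] [[e j, f j]].
Definition Kr : 'M[F]_N := \matrix_(p, q) K (tnth X (rshift n p)) (tnth X (rshift n q)).
Definition Km : 'M[F]_(n + N) := \matrix_(k, l) K (tnth X k) (tnth X l).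

Lemma w_sign q : if sg q then positive A (w q) else positive A (- w q).
Proof.
have := hXq q; case: (sg q); first exact: gen_positive.
exact: gen_negative.
Qed.

Lemma positive_neq0 b : positive A b -> b != 0.
Proof.
case=> c [_ c0 ->]; apply: contra c0 => /eqP cE; apply/eqP/(root_lattice_inj hth).
by rewrite cE root_lattice0.
Qed.

Lemma w_neq0 q : w q != 0.
Proof.
by have := w_sign q; case: (sg q) => /positive_neq0 //; rewrite oppr_eq0.
Qed.

Lemma Km_block : Km = block_mx Kh 0 0 Kr.
Proof.
apply/matrixP => k l; case: (split_ordP k) => [i|p] ->; case: (split_ordP l) => [j|q] ->.
- by rewrite block_mxEul !mxE !hXh.
- rewrite block_mxEur !mxE; apply: K_weight (X_weight _) (X_weight _) _.
  by rewrite wD_l wD_r add0r w_neq0.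
- rewrite block_mxEdl !mxE; apply: K_weight (X_weight _) (X_weight _) _.
  by rewrite wD_l wD_r addr0 w_neq0.
- by rewrite block_mxEdr !mxE.
Qed.

Lemma Km_unit : Km \in unitmx.
Proof.
rewrite unitmxE unitfE; apply/negP => /det0P [u u0 uK].
case/negP: u0; rewrite -[u]trmxK trmx_eq0 -[u^T]vecXK (_ : vecX _ = 0).
  by rewrite -(scale0r 0) coZ scale0r.
apply: K_nondegenerate => y; rewrite -(coK y) K_sym /vecX K_suml big1 // => l _.
rewrite KZl K_sym K_suml (_ : \sum_i _ = (u *m Km) 0 l); first by rewrite uK [X in _ * X]mxE mulr0.
by rewrite [RHS]mxE; apply: eq_bigr => k _; rewrite KZl !mxE.
Qed.

Lemma Kh_unit : Kh \in unitmx.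
Proof. by have := Km_unit; rewrite Km_block block_diag_mx_unit => /andP[]. Qed.

Lemma Kr_unit : Kr \in unitmx.
Proof. by have := Km_unit; rewrite Km_block block_diag_mx_unit => /andP[]. Qed.

Lemma Km_inv : invmx Km = block_mx (invmx Kh) 0 0 (invmx Kr).
Proof. by rewrite Km_block invmx_block_diag // -Km_block Km_unit. Qed.

Lemma Kr_tr : Kr^T = Kr.
Proof. by apply/matrixP => p q; rewrite !mxE K_sym. Qed.

Lemma Kh_tr : Kh^T = Kh.
Proof. by apply/matrixP => p q; rewrite !mxE K_sym. Qed.

(** Invariance makes the diagonal matrix of weights anticommute with [Kr], hence also with its
    inverse. *)
Lemma invKr_weight p q : invmx Kr p q != 0 -> w q = - w p.
Proof.
move=> Rpq; apply/eqP; rewrite -addr_eq0; apply/eqP/rowP => i; rewrite rowDE row0E.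
pose W := diag_mx (\row_q (w q 0 i)%:~R) : 'M[F]_N.
have WK : W *m Kr = - (Kr *m W).
  apply/matrixP => a b; rewrite [RHS]mxE mul_diag_mx mul_mx_diag !mxE.
  have := K_inv (tnth X (rshift n a)) (tnth X (rshift n b)) [[e i, f i]].
  by rewrite !X_weight !wD_r KZl (K_sym (tnth X (rshift n a)) (_ *: _)) KZl (K_sym (tnth X (rshift n b))) => ->; rewrite mulrC.
have : invmx Kr *m (W *m Kr) *m invmx Kr = - (invmx Kr *m (Kr *m W) *m invmx Kr).
  by rewrite WK mulmxN mulNmx.
rewrite !mulmxA mulVmx ?Kr_unit // mul1mx -!mulmxA mulmxV ?Kr_unit // mulmx1.
move=> /matrixP/(_ p q); rewrite [X in _ = X]mxE mul_mx_diag mul_diag_mx !mxE mulrC => /eqP.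
by rewrite -subr_eq0 opprK -mulrDl mulf_eq0 (negPf Rpq) orbF -rmorphD intr_eq0 => /eqP.
Qed.

Section TotalCasimir.
Variables (dd : nat) (V : lie_rep g dd).

Definition quad_sum (M : 'M[F]_(n + N)) : 'M[F]_dd :=
  \sum_k \sum_l M k l *: (V (tnth X k) *m V (tnth X l)).

Lemma quad_sumD M1 M2 : quad_sum (M1 + M2) = quad_sum M1 + quad_sum M2.
Proof.
rewrite /quad_sum -big_split; apply: eq_bigr => k _ /=; rewrite -big_split.
by apply: eq_bigr => l _; rewrite mxE scalerDl.
Qed.

Lemma bracket_X x k : [[x, tnth X k]] = \sum_i adm x i k *: tnth X i.
Proof. by rewrite -{1}(coK [[x, tnth X k]]) /vecX; apply: eq_bigr => i _; rewrite !mxE. Qed.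

Lemma quad_sum_bracket x M : V x *m quad_sum M =
  quad_sum M *m V x + quad_sum (adm x *m M + M *m (adm x)^T).
Proof.
have VX k : V x *m V (tnth X k) = V (tnth X k) *m V x + \sum_i adm x i k *: V (tnth X i).
  rewrite -[LHS](subrK (V (tnth X k) *m V x)) -rep_bracket bracket_X rep_sum addrC.
  by congr (_ + _); apply: eq_bigr => i _; rewrite repZ.
have -> : quad_sum (adm x *m M + M *m (adm x)^T) =
   \sum_k \sum_l M k l *: ((\sum_i adm x i k *: V (tnth X i)) *m V (tnth X l) +
     V (tnth X k) *m (\sum_i adm x i l *: V (tnth X i))).
  rewrite quad_sumD; transitivity (\sum_k \sum_l M k l *: ((\sum_i adm x i k *: V (tnth X i)) *m V (tnth X l))
     + \sum_k \sum_l M k l *: (V (tnth X k) *m (\sum_i adm x i l *: V (tnth X i)))).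
    congr (_ + _); rewrite /quad_sum.
      transitivity (\sum_i \sum_l \sum_k (adm x i k * M k l) *: (V (tnth X i) *m V (tnth X l))).
        by apply: eq_bigr => i _; apply: eq_bigr => l _; rewrite mxE scaler_suml.
      rewrite exchange_big [RHS]exchange_big; apply: eq_bigr => l _ /=.
      rewrite exchange_big; apply: eq_bigr => k _ /=.
      rewrite mulmx_suml scaler_sumr; apply: eq_bigr => i _.
      by rewrite -scalemxAl scalerA mulrC.
    apply: eq_bigr => k _.
    transitivity (\sum_i \sum_l (M k l * adm x i l) *: (V (tnth X k) *m V (tnth X i))).
      by apply: eq_bigr => i _; rewrite mxE scaler_suml; apply: eq_bigr => l _; rewrite !mxE.
    rewrite exchange_big; apply: eq_bigr => l _ /=.
    rewrite mulmx_sumr scaler_sumr; apply: eq_bigr => i _.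
    by rewrite -scalemxAr scalerA.
  rewrite -big_split; apply: eq_bigr => k _ /=; rewrite -big_split.
  by apply: eq_bigr => l _; rewrite scalerDr.
rewrite mulmx_sumr mulmx_suml -big_split; apply: eq_bigr => k _ /=.
rewrite mulmx_sumr mulmx_suml -big_split; apply: eq_bigr => l _ /=.
rewrite -scalemxAr -scalemxAl -scalerDr; congr (_ *: _).
rewrite mulmxA VX mulmxDl -mulmxA VX mulmxDr mulmxA.
by rewrite -addrA [X in _ + X]addrC.
Qed.

Definition total_casimir : 'M[F]_dd := quad_sum (invmx Km).

(** Invariance of the Killing form reads [a^T *m Km = - (Km *m a)]; multiplied by the inverse of
    [Km] on both sides, it says that the derivation in [quad_sum_bracket] kills this inverse. *)
Lemma total_casimir_comm x : V x *m total_casimir = total_casimir *m V x.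
Proof.
rewrite quad_sum_bracket; set a := adm x.
have aK : a^T *m Km = - (Km *m a).
  apply/matrixP => k l; rewrite [RHS]mxE.
  transitivity (K [[x, tnth X k]] (tnth X l)).
    by rewrite bracket_X K_suml mxE; apply: eq_bigr => i _; rewrite KZl !mxE.
  rewrite K_inv; congr (- _); rewrite K_sym bracket_X K_suml mxE.
  by apply: eq_bigr => i _; rewrite KZl !mxE mulrC K_sym.
have -> : a *m invmx Km + invmx Km *m a^T = 0.
  have : invmx Km *m (a^T *m Km) *m invmx Km = - (invmx Km *m (Km *m a) *m invmx Km).
    by rewrite aK mulmxN mulNmx.
  rewrite !mulmxA mulVmx ?Km_unit // mul1mx -!mulmxA mulmxV ?Km_unit // mulmx1 => ->.
  by rewrite addrN.
rewrite /quad_sum [X in _ + X]big1 ?addr0 // => k _.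
by rewrite big1 // => l _; rewrite mxE scale0r.
Qed.

End TotalCasimir.

Definition fdual q : g := \sum_q' invmx Kr q q' *: tnth X (rshift n q').

Lemma fdual_weight q : has_weight e f (fdual q) (- w q).
Proof.
move=> i; rewrite /fdual lie_sumr scaler_sumr; apply: eq_bigr => q' _.
rewrite lieZr X_weight wD_r scalerA [RHS]scalerA mulrC.
by have [->|/invKr_weight ->//] := eqVneq (invmx Kr q q') 0; rewrite !mulr0.
Qed.

Lemma K_fdual q : K (fdual q) (tnth X (rshift n q)) = 1.
Proof.
have := mulVmx Kr_unit => /matrixP/(_ q q); rewrite [X in _ = X]mxE eqxx mulr1n => <-.
by rewrite /fdual K_suml mxE; apply: eq_bigr => q' _; rewrite KZl !mxE.
Qed.

Lemma weight0_cartan x : has_weight e f x 0 ->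
  x = \sum_i co x (lshift N i) 0 *: [[e i, f i]].
Proof.
move=> x0; rewrite -{1}(coK x) /vecX big_split_ord /= [X in _ + X]big1 ?addr0.
  by apply: eq_bigr => i _; rewrite hXh.
move=> q _; have [->|/(co_weight x0)] := eqVneq (co x (rshift n q) 0) 0; first by rewrite scale0r.
by rewrite wD_r => wq; have := w_neq0 q; rewrite wq eqxx.
Qed.

(** The bracket has weight 0, so it lies in the Cartan subalgebra, and there its Killing products
    with the h_j are the coordinates of the root. *)
Lemma bracket_fdual q : [[tnth X (rshift n q), fdual q]] =
  \sum_i ((map_mx intr (w q) : 'rV[F]_n) *m invmx Kh) 0 i *: [[e i, f i]].
Proof.
set x := [[_, _]].
have x0 : has_weight e f x 0.
  rewrite -(subrr (w q)); apply: has_weight_bracket; last exact: fdual_weight.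
  by rewrite -wD_r; exact: X_weight.
pose c := \row_i co x (lshift N i) 0.
have cK : c *m Kh = map_mx intr (w q).
  apply/rowP => j; rewrite !mxE.
  transitivity (K x [[e j, f j]]).
    by rewrite [in RHS](weight0_cartan x0) K_suml; apply: eq_bigr => i _; rewrite KZl !mxE.
  by rewrite K_inv lieC X_weight wD_r -scaleNr K_sym KZl K_sym K_fdual mulr1 opprK.
rewrite {1}(weight0_cartan x0); apply: eq_bigr => i _; rewrite -cK mulmxK ?Kh_unit //.
by rewrite [c 0 i]mxE.
Qed.

Lemma count_wD (a : 'rV[int]_n) : count_mem a [seq wD k | k <- index_enum 'I_(n + N)] = mult wD a.
Proof. by rewrite count_map /mult -sum1dep_card -sum1_count. Qed.

Lemma perm_wD i : perm_eq [seq wD k *m simple_reflection A i | k <- index_enum 'I_(n + N)]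
  [seq wD k | k <- index_enum 'I_(n + N)].
Proof.
apply/allP => a _ /=; rewrite count_wD -(mult_reflection H chev adrep_diagonal i) -count_wD !count_map.
apply/eqP/eq_count => k /=; rewrite -[in RHS](inj_eq (can_inj (mulmxK (weyl_group_unit A2 (weyl_group_reflection A i))))).
by rewrite -mulmxA simple_reflectionK // mulmx1.
Qed.

(** [Kh] sums the squares of the weights of the adjoint representation, which s_i permutes; the
    inverse matrix inherits the invariance. *)
Lemma invKh_weyl i : map_mx intr (simple_reflection A i) *m invmx Kh *m
    (map_mx intr (simple_reflection A i))^T = invmx Kh.
Proof.
pose s := simple_reflection A i; pose sF := map_mx intr s : 'M[F]_n.
have ss : sF *m sF = 1%:M by rewrite -map_mxM simple_reflectionK // map_mx1.
have sK : sF^T *m Kh *m sF = Kh.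
  pose Kz : 'M[int]_n := \matrix_(a, b) \sum_k wD k 0 a * wD k 0 b.
  have KhE : Kh = map_mx intr Kz by apply/matrixP => a b; rewrite !mxE K_h.
  rewrite KhE /sF map_trmx -!map_mxM; congr map_mx; apply/matrixP => a b.
  rewrite [RHS]mxE -[RHS](big_map wD xpredT (fun x : 'rV[int]_n => x 0 a * x 0 b)).
  rewrite -(perm_big _ (perm_wD i)) big_map.
  transitivity (\sum_k \sum_j \sum_l s j a * (wD k 0 j * wD k 0 l) * s l b).
    rewrite [LHS]mxE; transitivity (\sum_k \sum_l \sum_j s j a * (wD k 0 j * wD k 0 l) * s l b).
      rewrite [RHS]exchange_big /=; apply: eq_bigr => l _; rewrite mxE mulr_suml.
      rewrite [RHS]exchange_big /=; apply: eq_bigr => j _; rewrite !mxE mulr_sumr mulr_suml.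
      by apply: eq_bigr => k _.
    by apply: eq_bigr => k _; rewrite exchange_big.
  apply: eq_bigr => k _; rewrite !mxE mulr_suml; apply: eq_bigr => j _.
  by rewrite mulr_sumr; apply: eq_bigr => l _; rewrite /s; ring.
have : invmx Kh *m (sF^T *m Kh *m sF) *m (sF *m invmx Kh *m sF^T) = invmx Kh *m Kh *m (sF *m invmx Kh *m sF^T).
  by rewrite sK.
rewrite mulVmx ?Kh_unit // mul1mx => <-; rewrite -!mulmxA (mulmxA sF sF) ss mul1mx.
by rewrite (mulmxA Kh) mulmxV ?Kh_unit // mul1mx -trmx_mul ss trmx1 mulmx1.
Qed.

Lemma positive_asym b : positive A b -> positive A (- b) -> False.
Proof.
case=> c [c0 cn0 cE] [c' [c'0 _ c'E] ].
have : c + c' = 0.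
  by apply: (root_lattice_inj hth); rewrite root_latticeD -cE -c'E addrN root_lattice0.
by move/(cone_addr_eq0 c0 c'0) => c00; rewrite c00 eqxx in cn0.
Qed.

(** Such a bracket involves e_i alone, and [e_i, e_i] = 0. This gives simple roots multiplicity
    1. *)
Lemma gen_simple i y b : pos y b -> forall k : int, b = k *: al i -> y = 0 \/ y = e i /\ k = 1.
Proof.
have inj c c' : root_lattice A c = root_lattice A c' -> c = c' by exact: (root_lattice_inj hth).
elim=> [j k|j z c gz IH k].
  rewrite /al -!root_lattice_delta -root_latticeZ => /inj E; right.
  have := congr1 (fun v : 'rV[int]_n => v 0 j) E; rewrite /= rowZE !rowdE eqxx.
  by have [->|_] := eqVneq j i; [rewrite mulr1 => <-|rewrite mulr0 => /eqP; rewrite oner_eq0].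
have [c' [c'0 c'n0 cE] ] := gen_positive gz; left.
have E : delta_mx 0 j + c' = k *: delta_mx 0 i.
  by apply: inj; rewrite root_latticeD root_latticeZ !root_lattice_delta -cE.
have ji : j = i.
  apply/eqP; apply: contraT => ji.
  have := congr1 (fun v : 'rV[int]_n => v 0 j) E; rewrite /= !(rowDE, rowZE, rowdE) eqxx (negPf ji).
  by rewrite mulr0; have := c'0 j; lia.
have [|->|[-> _] ] := IH (k - 1).
- rewrite cE; have -> : c' = (k - 1) *: delta_mx 0 i.
    by rewrite scalerBl scale1r -E ji addrAC subrr add0r.
  by rewrite root_latticeZ root_lattice_delta.
- by rewrite lie0r.
- by rewrite ji lie_bracketxx.
Qed.

Lemma X_neq0 k : tnth X k != 0.
Proof.
apply/eqP => Xk; have := coord_X k k; rewrite Xk linear0 eqxx => /eqP.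
by rewrite eq_sym oner_eq0.
Qed.

Lemma simple_weight i q k : w q = k *: al i -> positive A (w q) ->
  tnth X (rshift n q) = e i /\ k = 1.
Proof.
move=> wq wpos; have := hXq q; have := w_sign q; case: (sg q) => [_ gX|wneg]; last first.
  by case: (positive_asym wpos wneg).
have [/eqP|//] := gen_simple gX wq.
by rewrite (negPf (X_neq0 _)).
Qed.

Lemma simple_positive i : positive A (al i).
Proof. exact: gen_positive (gen_one e al i). Qed.

Lemma mult_simple i : mult wD (al i) = 1%N.
Proof.
have [k0 wk0 _] := wD_e i.
have nz : al i != 0 by exact: simple_root_neq0.
rewrite /mult (_ : [set j | wD j == al i]%SET = [set k0]%SET) ?cards1 //.
apply/setP => k; rewrite !inE; apply/eqP/eqP => [|->//].
have Xe l : wD l = al i -> tnth X l = e i.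
  case: (split_ordP l) => [a|q] ->; first by rewrite wD_l => E; rewrite -E eqxx in nz.
  rewrite wD_r => wq; have [] // := @simple_weight i q 1.
    by rewrite scale1r.
  by rewrite wq; exact: simple_positive.
move=> /Xe Xk; have := coord_X k0 k; rewrite Xk -(Xe _ wk0) coord_X eqxx.
by have [->//|_] := eqVneq k0 k => /eqP; rewrite oner_eq0.
Qed.

Lemma weight_sign b : (0 < mult wD b)%N -> [\/ b = 0, positive A b | positive A (- b)].
Proof.
rewrite card_gt0 => /set0Pn [k]; rewrite inE => /eqP <-.
case: (split_ordP k) => [i|q] ->; first by rewrite wD_l; exact: Or31.
by rewrite wD_r; have := w_sign q; case: (sg q) => ?; [exact: Or32|exact: Or33].
Qed.

(** A positive root other than alpha_i has a positive coordinate at some other vertex; s_i leaves it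
    unchanged, so the image cannot be negative. *)
Lemma reflect_positive i b : positive A b -> b != al i -> (0 < mult wD b)%N ->
  positive A (b *m simple_reflection A i) /\ b *m simple_reflection A i != al i.
Proof.
move=> bpos bi bm; have sK := simple_reflectionK A2 i; split; last first.
  apply/eqP => E; apply: (positive_asym (simple_positive i)).
  by rewrite -simple_root_reflection // -/(al i) -E -mulmxA sK mulmx1.
have [c [c0 _ cE] ] := bpos.
have [j ji cj] : exists2 j, j != i & 0 < c 0 j.
  apply: contrapT => nj; have cE' : c = c 0 i *: delta_mx 0 i.
    apply/rowP => j; rewrite rowZE rowdE; have [->|ji] := eqVneq j i; first by rewrite mulr1.
    rewrite mulr0; apply/eqP; rewrite eq_le c0 andbT leNgt; apply/negP => cj.
    by apply: nj; exists j.
  have bE : b = c 0 i *: al i by rewrite cE {1}cE' root_latticeZ root_lattice_delta.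
  move: bm; rewrite card_gt0 => /set0Pn [k]; rewrite inE; case: (split_ordP k) => [a|q] ->.
    by rewrite wD_l => /eqP b0; have := positive_neq0 bpos; rewrite -b0 eqxx.
  rewrite wD_r => /eqP wq; have [] := @simple_weight i q (c 0 i); rewrite ?wq //.
  by move=> _ c1; move: bi; rewrite bE c1 scale1r eqxx.
have : (0 < mult wD (b *m simple_reflection A i))%N.
  by rewrite (mult_reflection H chev adrep_diagonal).
case/weight_sign => [E|//|[c' [c'0 _ c'E] ] ].
  have := positive_neq0 bpos; rewrite -[b]mulmx1 -sK mulmxA E mul0mx eqxx; by [].
move: c'E; rewrite cE root_lattice_reflection -root_latticeN => /(root_lattice_inj hth) E.
have := congr1 (fun v : 'rV[int]_n => v 0 j) E.
by rewrite /= rowNE rowBE rowZE rowdE (negPf ji) mulr0 subr0; have := c'0 j; lia.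
Qed.

Let r := #|[pred q | sg q]|.
Let idx (p : 'I_r) : 'I_N := enum_val p.
Let L := [seq w (idx p) | p <- index_enum 'I_r].

Lemma big_positive (R : Type) (x0 : R) (op : Monoid.com_law x0) (G : 'I_N -> R) :
  \big[op/x0]_(q | sg q) G q = \big[op/x0]_(p < r) G (idx p).
Proof. by rewrite -(big_enum_val G). Qed.

Lemma count_L b : count_mem b L = if `[< positive A b >] then mult wD b else 0%N.
Proof.
have -> : count_mem b L = (\sum_(q | sg q) (w q == b))%N.
  rewrite -sum1_count big_map big_mkcond /=.
  by rewrite big_positive; apply: eq_bigr => p _ /=; case: eqP.
have multE : mult wD b = (\sum_(i < n) (0%R == b) + \sum_q (w q == b))%N.
  rewrite /mult -sum1dep_card big_mkcond big_split_ord /=; congr (_ + _)%N; apply: eq_bigr => i _.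
    by rewrite wD_l; case: eqP.
  by rewrite wD_r; case: eqP.
case: asboolP => [bpos|bN].
  rewrite multE [X in (X + _)%N]big1 ?add0n => [|i _]; last first.
    by case: eqP => // b0; have := positive_neq0 bpos; rewrite -b0 eqxx.
  rewrite [RHS](bigID sg) /= [X in (_ + X)%N]big1 ?addn0 // => q qN.
  have := w_sign q; rewrite (negPf qN); case: eqP => // -> bneg.
  by case: (positive_asym bpos bneg).
rewrite big1 // => q sq; have := w_sign q; rewrite sq; case: eqP => // -> //.
Qed.

Lemma perm_L i : exists2 L', perm_eq L (al i :: L') &
  perm_eq [seq a *m simple_reflection A i | a <- L'] L'.
Proof.
exists [seq b <- L | b != al i].
  apply/allP => a _ /=; rewrite count_filter.
  have [<-|ai] := eqVneq (al i) a.
    rewrite count_L asboolT; last exact: simple_positive.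
    by rewrite -/(al i) mult_simple (eq_count (a2 := pred0)) ?count_pred0 // => x /=; case: eqP.
  rewrite add0n; apply/eqP/eq_count => x /=; case: eqP => // ->.
  by rewrite eq_sym ai.
have cL b : count_mem b [seq b <- L | b != al i] =
    if `[< positive A b >] && (b != al i) then mult wD b else 0%N.
  rewrite count_filter; have [->|bi] := eqVneq b (al i).
    by rewrite andbF (eq_count (a2 := pred0)) ?count_pred0 // => x /=; case: eqP.
  rewrite andbT -count_L; apply: eq_count => x /=; case: eqP => // ->; by rewrite bi.
have mr b : mult wD (b *m simple_reflection A i) = mult wD b.
  exact: (mult_reflection H chev adrep_diagonal).
have imp b : `[< positive A b >] && (b != al i) -> (0 < mult wD b)%N ->
    `[< positive A (b *m simple_reflection A i) >] && (b *m simple_reflection A i != al i).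
  by move=> /andP[/asboolP bp bi] bm; have [p1 ->] := reflect_positive bp bi bm; rewrite andbT; apply/asboolP.
apply/allP => a _ /=; rewrite cL count_map; set a' := a *m simple_reflection A i.
have a'K : a' *m simple_reflection A i = a by rewrite -mulmxA simple_reflectionK ?mulmx1.
rewrite (eq_count (a2 := pred1 a')) => [|x /=]; last first.
  by rewrite -[in LHS]a'K (inj_eq (can_inj (mulmxK (weyl_group_unit A2 (weyl_group_reflection A i))))).
rewrite cL mr; have [->|] := posnP (mult wD a); first by rewrite !if_same.
move=> am; have am' : (0 < mult wD a')%N by rewrite mr.
have := imp a; have := imp a'; rewrite a'K -/a' => h1 h2.
by case: ifP => c1; case: ifP => c2 //; [move: (h1 c1 am'); rewrite c2|move: (h2 c2 am); rewrite c1].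
Qed.

(** The inverse Gram matrix is symmetric and pairs positive with negative root vectors only; the
    negative half of the sum is thus the positive half with the factors in the other order. *)
Lemma total_casimirE dd (V : lie_rep g dd) : total_casimir V =
  casimir e f (invmx Kh) (fun p => tnth X (rshift n (idx p))) (fun p => fdual (idx p)) V.
Proof.
have fV q : V (fdual q) = \sum_q' invmx Kr q q' *: V (tnth X (rshift n q')).
  by rewrite rep_sum; apply: eq_bigr => q' _; rewrite repZ.
rewrite /total_casimir /quad_sum Km_inv big_split_ord /=; congr (_ + _).
  apply: eq_bigr => i _; rewrite big_split_ord /= [X in _ + X]big1 ?addr0 => [|q _].
    by apply: eq_bigr => j _; rewrite block_mxEul !hXh.
  by rewrite block_mxEur mxE scale0r.
have -> : \sum_q \sum_l block_mx (invmx Kh) 0 0 (invmx Kr) (rshift n q) l *: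
    (V (tnth X (rshift n q)) *m V (tnth X l)) =
    \sum_q V (tnth X (rshift n q)) *m V (fdual q).
  apply: eq_bigr => q _; rewrite big_split_ord /= [X in X + _]big1 ?add0r => [|i _].
    by rewrite fV mulmx_sumr; apply: eq_bigr => q' _; rewrite block_mxEdr scalemxAr.
  by rewrite block_mxEdl mxE scale0r.
rewrite (bigID sg) /= big_split /=; congr (_ + _).
  by rewrite big_positive.
rewrite -(big_positive _ (fun q => V (fdual q) *m V (tnth X (rshift n q)))) /=.
have invKr_tr p q : invmx Kr p q = invmx Kr q p.
  by rewrite -[in LHS]Kr_tr -trmx_inv mxE.
have opp q q' : invmx Kr q q' != 0 -> sg q' = ~~ sg q.
  move=> /invKr_weight wq; have := w_sign q; have := w_sign q'; rewrite wq opprK.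
  case: (sg q'); case: (sg q) => // h1 h2; by [case: (positive_asym h2 h1)|case: (positive_asym h1 h2)].
transitivity (\sum_(q | ~~ sg q) \sum_(q' | sg q') invmx Kr q q' *: (V (tnth X (rshift n q)) *m V (tnth X (rshift n q')))).
  apply: eq_bigr => q qN; rewrite fV mulmx_sumr (bigID sg) /= [X in _ + X]big1 ?addr0.
    by apply: eq_bigr => q' _; rewrite scalemxAr.
  move=> q' q'N; have [->|/opp] := eqVneq (invmx Kr q q') 0; first by rewrite scale0r mulmx0.
  by rewrite (negPf q'N) qN.
rewrite exchange_big /=; apply: eq_bigr => q' q'P.
rewrite fV mulmx_suml [RHS](bigID sg) /= [X in _ = X + _]big1 ?add0r.
  by apply: eq_bigr => q _; rewrite invKr_tr scalemxAl.
move=> q qP; have [->|/opp] := eqVneq (invmx Kr q' q) 0; first by rewrite scale0r mul0mx.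
by rewrite q'P qP.
Qed.

Definition killing_casimir_datum : casimir_datum A e f.
Proof.
apply: (@CasimirDatum _ _ A g e f r (fun p => tnth X (rshift n (idx p))) (fun p => fdual (idx p))
  (fun p => w (idx p)) (invmx Kh)).
- by move=> p; rewrite -wD_r; exact: X_weight.
- by move=> p; exact: fdual_weight.
- by move=> p; exact: bracket_fdual.
- by move=> p; have := w_sign (idx p); have : sg (idx p) := enum_valP p; move=> ->.
- move=> dd V v ev p; have := hXq (idx p); have -> : sg (idx p) := enum_valP p.
  exact: gen_kill.
- by rewrite trmx_inv Kh_tr.
- exact: invKh_weyl.
- by rewrite unitmx_inv Kh_unit.
- exact: perm_L.
- by move=> dd V x; rewrite -total_casimirE total_casimir_comm.
Defined.

End Killing.

(** * Highest weight modules and tensor products *)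

Section HighestWeight.
Variables (F : numFieldType) (n : nat) (A : 'M[int]_n) (g : lieAlgebra F).
Variables (d : 'I_n -> int) (m : int) (th et : 'rV[int]_n).
Hypothesis H : finite_type A d m th et.
Let hth := ft_high H.
Let A2 := ft_diag H.
Variables (e f : 'I_n -> g).
Hypothesis chev : chevalley_generators A e f.
Hypothesis simple : simple_lie g.

Lemma casimir_datum_exists : inhabited (casimir_datum A e f).
Proof.
have [N [X [w [sg [hX hXh hXq] ] ] ] ] := lie_basis H chev simple.
exact: (inhabits (killing_casimir_datum H chev simple hX hXh hXq)).
Qed.

Section Module.
Variables (dd : nat) (V : lie_rep g dd).
Implicit Types (u v : 'cV[F]_dd) (mu nu lam c : 'rV[int]_n) (U : {vspace 'cV[F]_dd}).

Definition rep_stable U := forall x u, u \in U -> V x *m u \in U.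

Lemma generators_stable U : (forall i u, u \in U -> V (e i) *m u \in U) ->
  (forall i u, u \in U -> V (f i) *m u \in U) -> rep_stable U.
Proof.
move=> eU fU.
have [|a x y Px Py u uU|T TP] := @prop_subspace F g (fun x => forall u, u \in U -> V x *m u \in U).
- by move=> u _; rewrite rep0 mul0mx mem0v.
- by rewrite repD repZ mulmxDl -scalemxAl memvD ?memvZ ?Px ?Py.
have Tfull : T = fullv.
  apply: (chev_gen chev) => [x y /TP xT /TP yT|i]; last by split; apply/TP; [exact: eU|exact: fU].
  apply/TP => u uU; rewrite rep_bracket mulmxBl -!mulmxA.
  by apply: memvB; [apply/xT/yT|apply/yT/xT].
by move=> x; apply/TP; rewrite Tfull memvf.
Qed.

Inductive lowered (v : 'cV[F]_dd) (lam : 'rV[int]_n) : 'cV[F]_dd -> 'rV[int]_n -> Prop :=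
  | lowered0 : lowered v lam v lam
  | loweredS i u mu : lowered v lam u mu -> lowered v lam (V (f i) *m u) (mu - simple_root A i).

Lemma f_weight i mu u : weight_vec e f V mu u -> weight_vec e f V (mu - simple_root A i) (V (f i) *m u).
Proof.
exact: weight_vec_act (has_weight_f chev i).
Qed.

Lemma lowered_weight v lam u mu : weight_vec e f V lam v -> lowered v lam u mu ->
  weight_vec e f V mu u.
Proof. by move=> wv; elim=> // i u' mu' _ IH; exact: f_weight. Qed.

Lemma lowered_le v lam u mu : lowered v lam u mu ->
  (u = v /\ mu = lam) \/ exists c, [/\ forall i, 0 <= c 0 i, c != 0 & mu = lam - root_lattice A c].
Proof.
elim=> [|i u' mu' _ IH]; first by left.
right; have [c [c0 ->] ] : exists c : 'rV[int]_n, (forall i, 0 <= c 0 i) /\ mu' = lam - root_lattice A c.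
  case: IH => [ [_ ->]|[c [c0 _ ->] ] ]; last by exists c.
  by exists 0; rewrite root_lattice0 subr0; split=> // j; rewrite row0E.
exists (c + delta_mx 0 i); split.
- by move=> j; rewrite rowDE rowdE addr_ge0.
- apply/eqP; rewrite addrC => /cone_addr_eq0 E.
  have /rowP/(_ i) : delta_mx 0 i = 0 :> 'rV[int]_n by apply: E => // j; rewrite rowdE.
  by rewrite rowdE eqxx row0E.
- by rewrite root_latticeD root_lattice_delta opprD addrA.
Qed.

(** Lowered vectors span a submodule, since e_i commutes past f_j up to a weight factor. The basis
    is chosen among them so that each member has a weight and [lowered_le] bounds it. *)
Lemma highest_weight_submodule lam v : singular e f V lam v -> v != 0 ->
  exists N (X : N.-tuple 'cV[F]_dd) (wt : 'I_N -> 'rV[int]_n),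
  [/\ free X, forall k, lowered v lam (tnth X k) (wt k), v \in <<X>>%VS & rep_stable <<X>>%VS].
Proof.
move=> sv v0; have [s [fs sC Cs] ] := max_free (fun u => exists mu, lowered v lam u mu) (nil_free _).
rewrite /= in fs Cs; have sP (k : 'I_(size s)) : exists mu, lowered v lam (tnth (in_tuple s) k) mu.
  by apply: sC; rewrite (tnth_nth 0) mem_nth.
have [wt wtP] := boolp.choice sP.
have vs : v \in <<s>>%VS by apply: Cs; exists lam; exact: lowered0.
exists (size s), (in_tuple s), wt; split=> //.
have span_ind (Q : 'cV[F]_dd -> Prop) : Q 0 -> (forall a x y, Q x -> Q y -> Q (a *: x + y)) ->
    (forall u mu, lowered v lam u mu -> Q u) -> forall u, u \in <<s>>%VS -> Q u.
  move=> Q0 Ql Qs u us; rewrite (@coord_span _ _ _ (in_tuple s) _ us).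
  elim/big_ind: _ => // [y z Qy Qz|i _]; first by rewrite -[y]scale1r; exact: Ql.
  by rewrite -[_ *: _]addr0; apply: Ql => //; rewrite -tnth_nth; apply: Qs (wtP i).
have fU i u : u \in <<s>>%VS -> V (f i) *m u \in <<s>>%VS.
  move: u; apply: span_ind => [|a x y xs ys|u mu lu]; first by rewrite mulmx0 mem0v.
    by rewrite mulmxDr -scalemxAr memvD ?memvZ.
  by apply: Cs; exists (mu - simple_root A i); exact: loweredS lu.
have wv : weight_vec e f V lam v by move=> i; case: (sv i).
apply: generators_stable => // i; apply: span_ind => [|a x y xs ys|u mu].
- by rewrite mulmx0 mem0v.
- by rewrite mulmxDr -scalemxAr memvD ?memvZ.
elim=> [|j u' mu' lu IH]; first by have [-> _] := sv i; rewrite mem0v.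
rewrite mulmxA -[V (e i) *m _](subrK (V (f j) *m V (e i))) -rep_bracket mulmxDl -mulmxA.
rewrite memvD ?fU //; have [<-|ij] := eqVneq i j; last by rewrite (chev_ef chev) // rep0 mul0mx mem0v.
by rewrite (lowered_weight wv lu) memvZ //; apply: Cs; exists mu'.
Qed.

Lemma weight_coord N (X : N.-tuple 'cV[F]_dd) (wt : 'I_N -> 'rV[int]_n) (a : 'I_N -> F) mu :
  free X -> (forall k, weight_vec e f V (wt k) (tnth X k)) ->
  weight_vec e f V mu (\sum_k a k *: tnth X k) -> forall k, a k != 0 -> wt k = mu.
Proof.
move=> fX wX wu k ak; apply/rowP => i; have := wu i.
rewrite mulmx_sumr scaler_sumr => /eqP; rewrite -subr_eq0 -sumrB => /eqP E.
have /freeP/(_ (fun k => a k * ((wt k 0 i)%:~R - (mu 0 i)%:~R))) := fX.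
move=> /(_ _ k)/eqP; rewrite mulf_eq0 (negPf ak) /= subr_eq0 eqr_int => h.
apply/eqP/h; rewrite -[RHS]E; apply: eq_bigr => l _; rewrite -tnth_nth.
by rewrite -scalemxAr wX !scalerA -scalerBl; congr (_ *: _); ring.
Qed.

End Module.
End HighestWeight.

Section DirectSum.
Variables (F : fieldType) (g : lieAlgebra F) (d1 d2 : nat) (V : lie_rep g d1) (W : lie_rep g d2).

Definition sum_fun (x : g) : 'M[F]_(d1 + d2) := block_mx (V x) 0 0 (W x).

Lemma sum_fun_linear : linear sum_fun.
Proof.
by move=> a x y; rewrite /sum_fun !rep_linear scale_block_mx add_block_mx !scaler0 !addr0.
Qed.

Lemma sum_fun_bracket x y : sum_fun [[x, y]] = sum_fun x *m sum_fun y - sum_fun y *m sum_fun x.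
Proof.
rewrite /sum_fun !mulmx_block !(mulmx0, mul0mx, addr0, add0r) opp_block_mx add_block_mx.
by rewrite !oppr0 !addr0 !rep_bracket.
Qed.

Definition sum_rep : lie_rep g (d1 + d2) := LieRep sum_fun_linear sum_fun_bracket.

Lemma sum_repE x u v : sum_rep x *m col_mx u v = col_mx (V x *m u) (W x *m v) :> 'cV_(d1 + d2).
Proof. by rewrite /= /sum_fun mul_block_col !mul0mx addr0 add0r. Qed.

End DirectSum.

Section Homs.
Variables (F : numFieldType) (n : nat) (A : 'M[int]_n) (g : lieAlgebra F).
Variables (d : 'I_n -> int) (m : int) (th et : 'rV[int]_n).
Hypothesis H : finite_type A d m th et.
Let hth := ft_high H.
Let A2 := ft_diag H.
Variables (e f : 'I_n -> g).
Hypothesis chev : chevalley_generators A e f.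
Hypothesis simple : simple_lie g.

Section SingularExists.
Variables (dT : nat) (T : lie_rep g dT) (wt : 'I_dT -> 'rV[int]_n).
Hypothesis Th : diagonal_rep e f T wt.
Implicit Types (u v : 'cV[F]_dT) (mu : 'rV[int]_n) (K : {vspace 'cV[F]_dT}).

(** Induction on the number of nonzero coordinates: if two of them have different weights,
    subtracting the eigenvalue of one from a suitable h_i kills that coordinate and keeps the
    other. *)
Lemma weight_vec_exists K : rep_stable T K -> K != 0%VS ->
  exists mu u, [/\ u \in K, u != 0 & weight_vec e f T mu u].
Proof.
move=> sK K0; pose S u := [set j | u j 0 != 0]%SET.
suff : forall k u, (#|S u| <= k)%N -> u \in K -> u != 0 ->
    exists mu u, [/\ u \in K, u != 0 & weight_vec e f T mu u].
  by move=> h; apply: (h _ (vpick K) (leqnn _)); rewrite ?memv_pick ?vpick0.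
elim=> [|k IH] u Sk uK u0.
  case/eqP: u0; apply/matrixP => j z; rewrite ord1 [RHS]mxE; apply/eqP; apply: contraT => uj.
  by move: Sk; rewrite leqn0 cards_eq0 => /eqP/setP/(_ j); rewrite !inE uj.
have [j1 uj1] : exists j1, u j1 0 != 0.
  apply/existsP; apply: contraR u0 => /existsPn h.
  by apply/eqP/matrixP => j z; rewrite ord1 [RHS]mxE; apply/eqP/negbNE/h.
have [same|] := pselect (forall j, u j 0 != 0 -> wt j = wt j1).
  by exists (wt j1), u; split=> //; apply/(weight_vecP Th).
move=> /existsNP [j2 /not_implyP [uj2 w12] ].
have [i wi] : exists i, wt j1 0 i != wt j2 0 i.
  apply: contrapT => nex; apply: w12; apply/rowP => i; apply/eqP.
  by rewrite eq_sym; apply: contraT => wi; case: nex; exists i.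
pose u' := T [[e i, f i]] *m u - (wt j1 0 i)%:~R *: u.
have u'E j : u' j 0 = ((wt j 0 i)%:~R - (wt j1 0 i)%:~R) * u j 0.
  by rewrite /u' Th [LHS]mxE mul_diag_mx !mxE mulrBl.
apply: (IH u').
- rewrite -ltnS (leq_trans _ Sk) // proper_card //; apply/properP; split.
    apply/fintype.subsetP => j; rewrite !inE u'E; apply: contraNneq => ->.
    by rewrite mulr0.
  by exists j1; rewrite !inE ?uj1 // u'E subrr mul0r eqxx.
- by rewrite memvB ?memvZ ?sK.
- apply/eqP => /matrixP/(_ j2 0)/eqP; rewrite u'E mxE mulf_eq0 (negPf uj2) orbF.
  by rewrite subr_eq0 eqr_int eq_sym (negPf wi).
Qed.

Lemma singular_exists K : rep_stable T K -> K != 0%VS ->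
  exists mu u, [/\ u \in K, u != 0 & singular e f T mu u].
Proof.
move=> sK /(weight_vec_exists sK) [mu0 [u0 [u0K u0n wu0] ] ].
pose ht x := gf A x (rho n); pose M := (\sum_j absz (ht (wt j)))%N.
have htM j : ht (wt j) <= M%:Z by rewrite /M (bigD1 j) //=; lia.
suff : forall k mu u, M%:Z - ht mu < k%:Z -> u \in K -> u != 0 -> weight_vec e f T mu u ->
    exists mu u, [/\ u \in K, u != 0 & singular e f T mu u].
  move=> h; apply: (h (absz (M%:Z - ht mu0)).+1 mu0 u0) => //; lia.
elim=> [|k IH] mu u htk uK un wu.
  case/eqP: un; apply/matrixP => j z; rewrite ord1 [RHS]mxE; apply/eqP; apply: contraT => uj.
  by have := htM j; rewrite (iffLR (weight_vecP Th _ _) wu j uj); lia.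
have [sing|] := pselect (forall i, T (e i) *m u = 0); first by exists mu, u; split.
move=> /existsNP [i /eqP ein0]; apply: (IH (mu + simple_root A i) (T (e i) *m u)).
- by rewrite /ht gfDl; have := gf_simple_rho_gt0 H i; rewrite /ht in htk; lia.
- exact: sK.
- exact: ein0.
- exact: weight_vec_act (has_weight_e chev i) wu.
Qed.

End SingularExists.

(** * Homomorphisms from an irreducible module *)

Section Extension.
Variables (cd : casimir_datum A e f).
Variables (dT : nat) (T : lie_rep g dT) (wt : 'I_dT -> 'rV[int]_n).
Hypothesis Th : diagonal_rep e f T wt.
Variables (dn : nat) (V : lie_rep g dn) (nu : 'rV[int]_n) (v : 'cV[F]_dn).
Hypothesis irrV : irreducible_rep V.
Hypothesis v0 : v != 0.
Hypothesis sv : singular e f V nu v.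
Hypothesis nu_dom : dominant nu.

Lemma irreducible_span (P : 'cV[F]_dn -> Prop) : (forall a x y, P x -> P y -> P (a *: x + y)) ->
  (forall x u, P u -> P (V x *m u)) -> P v -> forall u, P u.
Proof.
move=> Pl PV Pv; have P0 : P 0 by rewrite -[0](addNr v) -scaleN1r; exact: Pl.
have [U UP] := prop_subspace P0 Pl; have [_ irr] := irrV.
have [x u /UP Pu|U0|Ufull] := irr U; first by apply/UP/PV.
  by case/eqP: v0; apply/eqP; rewrite -memv0 -U0; apply/UP.
by move=> u; apply/UP; rewrite Ufull memvf.
Qed.

(* The homomorphism is read off the submodule of [V + T] generated by [(v, w)]:
   it is the graph of a map because its intersection with [T] contains no
   singular vector, by comparison of the Casimir eigenvalues. *)
Lemma hom_extension w : singular e f T nu w ->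
  exists2 phi : 'M[F]_(dT, dn), (forall x, T x *m phi = phi *m V x) & phi *m v = w.
Proof.
move=> sw; pose W := sum_rep V T; pose v' : 'cV[F]_(dn + dT) := col_mx v w.
have sv' : singular e f W nu v'.
  move=> i; have [ev hv] := sv i; have [ew hw] := sw i.
  by rewrite /W !sum_repE ev hv ew hw col_mx0 scale_col_mx.
have v'0 : v' != 0 by apply: contra v0 => /eqP; rewrite -col_mx0 => /eq_col_mx [-> _].
have [N [X [wX [fX Xlow v'X Xstab] ] ] ] := highest_weight_submodule chev sv' v'0.
set U := <<X>>%VS in v'X Xstab.
have wX_weight k : weight_vec e f W (wX k) (tnth X k).
  by apply: (lowered_weight chev _ (Xlow k)) => i; case: (sv' i).
pose c := bil (cz_B cd) (nu + rho n) (nu + rho n) - bil (cz_B cd) (rho n) (rho n).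
have OmX k : Om cd W *m tnth X k = c *: tnth X k.
  elim: (Xlow k) => [|i u mu _ IH]; first exact: (Om_singular H cd sv').
  by rewrite mulmxA /Om -(cz_comm cd) -mulmxA IH scalemxAr.
have XE u : u \in U -> u = \sum_k coord X k u *: tnth X k.
  by move=> uU; rewrite {1}(coord_span uU); apply: eq_bigr => k _; rewrite -tnth_nth.
have OmU u : u \in U -> Om cd W *m u = c *: u.
  move=> /XE ->; rewrite mulmx_sumr scaler_sumr; apply: eq_bigr => k _.
  by rewrite -scalemxAr OmX scalerA mulrC -scalerA.
have inj u : col_mx (0 : 'cV[F]_dn) u \in U -> u = 0.
  have [|a x y xU yU|K KP] := @prop_subspace F _ (fun u : 'cV[F]_dT => col_mx (0 : 'cV[F]_dn) u \in U).
  - by rewrite col_mx0 mem0v.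
  - have -> : col_mx (0 : 'cV[F]_dn) (a *: x + y) = a *: col_mx 0 x + col_mx 0 y.
      by rewrite scale_col_mx add_col_mx scaler0 addr0.
    by rewrite memvD ?memvZ.
  move=> /KP uK; apply/eqP; apply: contraT => u0.
  have stabK : rep_stable T K.
    by move=> x y /KP yU; apply/KP; have := Xstab x _ yU; rewrite sum_repE mulmx0.
  have Kn0 : K != 0%VS by apply: contra u0 => /eqP K0; rewrite -memv0 -K0.
  have [mu [y [/KP yU y0 sy] ] ] := singular_exists Th stabK Kn0.
  set y' : 'cV[F]_(dn + dT) := col_mx 0 y in yU.
  have sy' : singular e f W mu y'.
    by move=> i; have [ey hy] := sy i; rewrite /W !sum_repE !mulmx0 ey hy col_mx0 scale_col_mx scaler0.
  have y'0 : y' != 0 by apply: contra y0 => /eqP; rewrite -col_mx0 => /eq_col_mx [_ ->].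
  have /eqP := Om_singular H cd sy'; rewrite (OmU _ yU) -subr_eq0 -scalerBl scaler_eq0 (negPf y'0) orbF.
  rewrite subr_eq0 /c => /eqP/addIr cE.
  have wy : weight_vec e f W mu (\sum_k coord X k y' *: tnth X k).
    by rewrite -(XE _ yU) => i; case: (sy' i).
  have coordX k := weight_coord fX wX_weight wy (k := k).
  have mudom : dominant mu := singular_dominant H chev Th sy y0.
  have munu : mu = nu.
    have [k ck] : exists k, coord X k y' != 0.
      apply/existsP; apply: contraT => /existsPn h; case/eqP: y'0; rewrite (XE _ yU) big1 // => k _.
      by have /negbNE/eqP -> := h k; rewrite scale0r.
    have [c' [c'0 muE] ] : exists c' : 'rV[int]_n, (forall i, 0 <= c' 0 i) /\ mu = nu - root_lattice A c'.
      rewrite -(coordX k ck); case: (lowered_le (Xlow k)) => [ [_ ->]|[c' [c'0 _ ->] ] ]; last by exists c'.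
      by exists 0; rewrite root_lattice0 subr0; split=> // i; rewrite row0E.
    apply/esym; apply: (@same_casimir _ _ _ _ _ _ _ H _ _ _ cd mu mudom nu c' nu_dom c'0) => //.
      by rewrite muE subrK.
    by rewrite cE.
  (* A lowered vector other than [v'] has weight strictly below [nu]. So [y'] is a multiple of [v'],
     and its zero component in [V] makes it 0. *)
  have Xv' k : coord X k y' != 0 -> tnth X k = v'.
    move=> /coordX wk; case: (lowered_le (Xlow k)) => [ [] //|[c' [_ c'n0 E] ] ].
    move: E; rewrite wk munu => /eqP; rewrite -subr_eq0 opprB addrC subrK => /eqP E.
    by case/eqP: c'n0; apply: (root_lattice_inj hth); rewrite root_lattice0.
  have y'E : y' = (\sum_k coord X k y') *: v'.
    rewrite {1}(XE _ yU) scaler_suml; apply: eq_bigr => k _.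
    by have [->|/Xv' ->//] := eqVneq (coord X k y') 0; rewrite !scale0r.
  move: (y'E); rewrite {1}/y' /v' scale_col_mx => /eq_col_mx [/esym/eqP]; rewrite scaler_eq0 (negPf v0) orbF.
  by move=> /eqP s0; case/eqP: y'0; rewrite y'E s0 scale0r.
have ex : forall x : 'cV[F]_dn, exists u, col_mx x u \in U.
  apply: irreducible_span => [a x y [u xu] [u' yu']|x y [u yu]|]; last by exists w.
    exists (a *: u + u').
    have -> : col_mx (a *: x + y) (a *: u + u') = a *: col_mx x u + col_mx y u'.
      by rewrite scale_col_mx add_col_mx.
    by rewrite memvD ?memvZ.
  by exists (T x *m u); rewrite -sum_repE; exact: Xstab.
have [h hP] := boolp.choice ex.
pose phi : 'M[F]_(dT, dn) := \matrix_(i, j) h (delta_mx j 0) i 0.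
have phiP x : col_mx x (phi *m x) \in U.
  have -> : col_mx x (phi *m x) = \sum_j x j 0 *: col_mx (delta_mx j 0) (h (delta_mx j 0)).
    apply/matrixP => k z; rewrite ord1 summxE; case: (split_ordP k) => i ->.
      rewrite col_mxEu (bigD1 i) //= mxE col_mxEu mxE !eqxx mulr1 big1 ?addr0 // => j ji.
      by rewrite mxE col_mxEu mxE eq_sym (negPf ji) mulr0.
    by rewrite col_mxEd mxE; apply: eq_bigr => j _; rewrite [RHS]mxE col_mxEd [phi i j]mxE mulrC.
  by apply: memv_suml => j _; rewrite memvZ.
have graph x u : col_mx x u \in U -> u = phi *m x.
  move=> xu; apply/eqP; rewrite -subr_eq0; apply/eqP/inj.
  have -> : col_mx (0 : 'cV[F]_dn) (u - phi *m x) = col_mx x u - col_mx x (phi *m x).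
    by rewrite opp_col_mx add_col_mx subrr.
  exact: memvB.
exists phi; last by rewrite -(graph v w).
move=> x; apply/matrixP => i j.
have := graph (V x *m delta_mx j 0) (T x *m (phi *m delta_mx j 0)).
rewrite -sum_repE => /(_ (Xstab x _ (phiP _))).
by rewrite !mulmxA -!colE => /matrixP/(_ i 0); rewrite !mxE.
Qed.

End Extension.

(** Evaluation at the highest weight vector identifies homomorphisms with singular vectors of weight
    [nu]: injective because that vector generates, surjective by the extension hypothesis. *)
Lemma dim_rep_hom (cd : casimir_datum A e f) dT (T : lie_rep g dT) dn (V : lie_rep g dn)
    (nu : 'rV[int]_n) r (C : 'M[F]_(dT, r)) :
  is_irrep e f nu V -> (forall a : 'cV_r, C *m a = 0 -> a = 0) ->
  (forall w, singular e f T nu w <-> exists a, w = C *m a) ->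
  (forall v w, singular e f V nu v -> v != 0 -> singular e f T nu w ->
    exists2 phi : 'M[F]_(dT, dn), (forall x, T x *m phi = phi *m V x) & phi *m v = w) ->
  \dim (rep_hom V T) = r.
Proof.
move=> [irrV [v v0 sv] ] Cinj CP ext; pose ev := linfun (mulmxr v : 'M[F]_(dT, dn) -> 'cV[F]_dT).
have evE phi : ev phi = phi *m v by rewrite lfunE.
have cap0 : (rep_hom V T :&: lker ev)%VS = 0%VS.
  apply/eqP; rewrite -subv0; apply/subvP => phi; rewrite memv_cap memv_ker memv0 evE.
  move=> /andP[/mem_rep_hom hphi /eqP phiv].
  have k0 : forall u : 'cV[F]_dn, phi *m u = 0.
    apply: (irreducible_span irrV v0) => // [a x y x0 y0|x u u0].
      by rewrite mulmxDr -scalemxAr x0 y0 scaler0 addr0.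
    by rewrite mulmxA -hphi -mulmxA u0 mulmx0.
  apply/eqP/matrixP => i j; have /matrixP/(_ i 0) := k0 (delta_mx j 0).
  by rewrite -colE !mxE.
rewrite -(limg_dim_eq cap0); pose M := linfun (mulmx C : 'cV[F]_r -> 'cV[F]_dT).
have ME a : M a = C *m a by rewrite lfunE.
have -> : (ev @: rep_hom V T)%VS = (M @: fullv)%VS.
  apply/vspaceP => w; apply/memv_imgP/memv_imgP => [ [phi /mem_rep_hom hphi ->]|[a _ ->] ].
    have /CP [a wE] : singular e f T nu (ev phi).
      move=> i; have [ev0 hv] := sv i.
      by rewrite evE !mulmxA !hphi -!mulmxA ev0 hv mulmx0 -scalemxAr.
    by exists a; rewrite ?memvf // ME.
  have /(ext v _ sv v0) [phi hphi phiv] : singular e f T nu (M a) by apply/CP; exists a; rewrite ME.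
  by exists phi; rewrite ?evE //; apply/mem_rep_hom.
rewrite limg_dim_eq; first by rewrite dimvf dim_matrix; exact: muln1.
apply/eqP; rewrite -subv0; apply/subvP => a; rewrite memv_cap memv_ker memv0 ME.
by move=> /andP[_ /eqP /Cinj ->].
Qed.

End Homs.

Section Conjugate.
Variables (F : fieldType) (g : lieAlgebra F) (dd : nat) (V : lie_rep g dd) (P : 'M[F]_dd).
Hypothesis Pu : P \in unitmx.

Definition conj_fun (x : g) : 'M[F]_dd := invmx P *m V x *m P.

Lemma conj_fun_linear : linear conj_fun.
Proof.
by move=> a x y; rewrite /conj_fun repD repZ mulmxDr mulmxDl -scalemxAr -scalemxAl.
Qed.

Lemma conj_fun_bracket x y : conj_fun [[x, y]] = conj_fun x *m conj_fun y - conj_fun y *m conj_fun x.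
Proof. by rewrite /conj_fun rep_bracket mulmxBr mulmxBl !mulmxA !mulmxK. Qed.

Definition conj_rep : lie_rep g dd := LieRep conj_fun_linear conj_fun_bracket.

Lemma conj_repE x : V x *m P = P *m conj_rep x.
Proof. by rewrite /= /conj_fun !mulmxA mulmxV // mul1mx. Qed.

End Conjugate.

Lemma singular_transport (F : numFieldType) n (g : lieAlgebra F) (e f : 'I_n -> g) dd
    (V V' : lie_rep g dd) (P : 'M[F]_dd) nu v :
  P \in unitmx -> (forall x, V x *m P = P *m V' x) ->
  singular e f V nu (P *m v) <-> singular e f V' nu v.
Proof.
move=> Pu VP; have inj (a b : 'cV[F]_dd) : P *m a = P *m b -> a = b.
  by move=> h; rewrite -(mulKmx Pu a) h mulKmx.
split=> s i; have [s1 s2] := s i; split.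
- by apply: inj; rewrite mulmx0 mulmxA -VP -mulmxA.
- by apply: inj; rewrite mulmxA -VP -mulmxA s2 scalemxAr.
- by rewrite mulmxA VP -mulmxA s1 mulmx0.
- by rewrite mulmxA VP -mulmxA s2 scalemxAr.
Qed.

(** * Irreducible modules and tensor products *)

Section Irreducible.
Variables (F : numFieldType) (n : nat) (A : 'M[int]_n) (g : lieAlgebra F).
Variables (d : 'I_n -> int) (m : int) (th et : 'rV[int]_n).
Hypothesis H : finite_type A d m th et.
Let hth := ft_high H.
Let A2 := ft_diag H.
Variables (e f : 'I_n -> g).
Hypothesis chev : chevalley_generators A e f.
Hypothesis simple : simple_lie g.

Section OneRep.
Variables (dd : nat) (V : lie_rep g dd) (lam : 'rV[int]_n).
Hypothesis irrV : is_irrep e f lam V.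

Lemma irrep_span v nu : singular e f V nu v -> v != 0 ->
  exists (X : dd.-tuple 'cV[F]_dd) (wt : 'I_dd -> 'rV[int]_n),
  basis_of fullv X /\ forall k, lowered A f V v nu (tnth X k) (wt k).
Proof.
move=> sv v0; have [N [X [wt [fX Xlow vX Xstab] ] ] ] := highest_weight_submodule chev sv v0.
have full : <<X>>%VS = fullv.
  have [ [_ /(_ _ Xstab) [X0|//] ] _] := irrV.
  by case/eqP: v0; apply/eqP; rewrite -memv0 -X0.
have bX : basis_of fullv X by apply/andP; split; [apply/eqP|].
have Nd : N = dd.
  have := size_basis bX; rewrite dimvf => E0; have : (dd * 1)%N = N := E0; lia.
by subst N; exists X, wt.
Qed.

Lemma irrep_diagonal : exists (P : 'M[F]_dd) (Pu : P \in unitmx) (wt : 'I_dd -> 'rV[int]_n),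
  diagonal_rep e f (conj_rep V Pu) wt /\
  forall j, exists2 c : 'rV[int]_n, (forall i, 0 <= c 0 i) & wt j = lam - root_lattice A c.
Proof.
have [_ [v v0 sv] ] := irrV; have [X [wt [bX Xlow] ] ] := irrep_span sv v0.
pose P : 'M[F]_dd := \matrix_(i, k) tnth X k i 0.
have PE k : P *m delta_mx k 0 = tnth X k.
  by rewrite -colE; apply/matrixP => i z; rewrite ord1 !mxE.
have Pu : P \in unitmx.
  rewrite -unitmx_tr unitmxE unitfE; apply/negP => /det0P [u /negP u0 uP]; apply: u0.
  apply/eqP/rowP => k; rewrite [RHS]mxE.
  have /freeP/(_ (fun k => u 0 k)) := basis_free bX; apply.
  have : P *m u^T = 0 by rewrite -[P]trmxK -trmx_mul uP trmx0.
  move=> E; rewrite -[RHS]E; apply/matrixP => i z; rewrite ord1 summxE [RHS]mxE.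
  by apply: eq_bigr => l _; rewrite !mxE -tnth_nth mulrC.
exists P, Pu, wt; split=> [i|j]; last first.
  case: (lowered_le (Xlow j)) => [ [_ ->]|[c [c0 _ ->] ] ]; last by exists c.
  by exists 0; rewrite ?root_lattice0 ?subr0 // => i; rewrite row0E.
have wv : weight_vec e f V lam v by move=> j; case: (sv j).
rewrite /= /conj_fun -mulmxA -[RHS](mulKmx Pu); congr (_ *m _).
apply/matrixP => a k.
have /matrixP/(_ a 0) := lowered_weight chev wv (Xlow k) i.
rewrite -PE mulmxA -!colE mul_mx_diag !mxE => ->.
by rewrite mulrC.
Qed.

(** Each of the two vectors generates the module, so each weight lies below the other; and only the
    generator itself attains the top weight. *)
Lemma irrep_singular v nu w : singular e f V lam v -> v != 0 -> singular e f V nu w -> w != 0 ->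
  nu = lam /\ exists k, w = k *: v.
Proof.
move=> sv v0 sw w0.
have [X [wt [bX Xlow] ] ] := irrep_span sv v0; have [Y [wtY [bY Ylow] ] ] := irrep_span sw w0.
have wv mu u : singular e f V mu u -> weight_vec e f V mu u by move=> s i; case: (s i).
have expand (Z : dd.-tuple 'cV[F]_dd) u : basis_of fullv Z -> u = \sum_k coord Z k u *: tnth Z k.
  move=> bZ; rewrite {1}(coord_basis bZ (memvf u)); apply: eq_bigr => k _.
  by rewrite -tnth_nth.
have coordZ (Z : dd.-tuple 'cV[F]_dd) wZ z mz u mu : basis_of fullv Z -> singular e f V mz z ->
    (forall k, lowered A f V z mz (tnth Z k) (wZ k)) -> singular e f V mu u ->
    forall k, coord Z k u != 0 -> wZ k = mu.
  move=> bZ sz Zlow su; apply: (weight_coord (basis_free bZ)); last by rewrite -expand //; exact: wv.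
  by move=> k; exact: (lowered_weight chev (wv _ _ sz) (Zlow k)).
have coord_nz (Z : dd.-tuple 'cV[F]_dd) u : basis_of fullv Z -> u != 0 -> exists k, coord Z k u != 0.
  move=> bZ un; apply/existsP; apply: contraT => /existsPn h; case/eqP: un.
  by rewrite (expand Z u bZ) big1 // => k _; have /negbNE/eqP -> := h k; rewrite scale0r.
have nulam : nu = lam.
  have [k ck] := coord_nz _ _ bX w0; have [l cl] := coord_nz _ _ bY v0.
  have := coordZ _ _ _ _ _ _ bX sv Xlow sw _ ck; have := coordZ _ _ _ _ _ _ bY sw Ylow sv _ cl.
  case: (lowered_le (Xlow k)) => [ [_ ->] _ ->//|[c [c0 cn0 ->] ] ].
  case: (lowered_le (Ylow l)) => [ [_ ->] ->//|[c' [c'0 _ ->] ] E1 E2].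
  case/eqP: cn0; apply: (cone_addr_eq0 c0 c'0); apply: (root_lattice_inj hth).
  move: E1; rewrite -E2 => /eqP; rewrite -subr_eq0 addrAC -addrA addrAC addrA subrr sub0r -opprD oppr_eq0 => /eqP E.
  by rewrite root_latticeD root_lattice0 -E addrC.
split=> //; exists (\sum_k coord X k w); rewrite {1}(expand X w bX) scaler_suml; apply: eq_bigr => k _.
have [->|ck] := eqVneq (coord X k w) 0; first by rewrite !scale0r.
have wk := coordZ _ _ _ _ _ _ bX sv Xlow sw _ ck.
case: (lowered_le (Xlow k)) => [ [-> _]//|[c [_ cn0 cE] ] ].
case/eqP: cn0; apply: (root_lattice_inj hth); rewrite root_lattice0.
by move: cE; rewrite wk nulam => /eqP; rewrite -subr_eq0 opprB addrC subrK => /eqP.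
Qed.

End OneRep.

(** Weyl's character formula, coefficient by coefficient: the sum counts singular vectors of weight
    [nu], and those of the module form one line, of weight [lam]. *)
Lemma irrep_count dd (V : lie_rep g dd) lam P (Pu : P \in unitmx) (wt : 'I_dd -> 'rV[int]_n) nu :
  is_irrep e f lam V -> diagonal_rep e f (conj_rep V Pu) wt -> dominant nu ->
  \sum_(w <- weyl_seq A) (\det w)%:~R * (mult wt (nu + rho n - rho n *m w))%:R = (nu == lam)%:R :> F.
Proof.
have [cd] := casimir_datum_exists H chev simple.
case: dd V P Pu wt => [|dd] V P Pu wt irrV Vh nud; first by have [ [] ] := irrV.
have [r [C [Cinj CP <-] ] ] := singular_count H chev cd Vh nud.
have [_ [v v0 sv] ] := irrV; have tr := singular_transport e f _ _ Pu (conj_repE V Pu).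
have Pinj (a : 'cV[F]_dd.+1) : P *m a = 0 -> a = 0 by move=> h; rewrite -(mulKmx Pu a) h mulmx0.
have sing (a : 'cV[F]_r) : C *m a != 0 -> nu = lam /\ exists k, P *m (C *m a) = k *: v.
  move=> Ca; have /CP/tr sC : exists b, C *m a = C *m b by exists a.
  by apply: (irrep_singular irrV sv v0 sC); apply: contra Ca => /eqP/Pinj ->.
have [nulam|nul] := eqVneq nu lam; last first.
  case: r C Cinj {CP} sing => // r C Cinj sing; exfalso.
  have /eqP : (delta_mx 0 0 : 'cV[F]_r.+1) = 0.
    by apply: Cinj; apply/eqP; apply: contraT => /sing [E _]; rewrite E eqxx in nul.
  by move/eqP/matrixP/(_ 0 0)/eqP; rewrite !mxE oner_eq0.
have /CP [a aE] : singular e f (conj_rep V Pu) nu (invmx P *m v).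
  by apply/tr; rewrite mulKVmx // nulam.
have rk : \rank C = r.
  rewrite -mxrank_tr; apply/eqP; rewrite -/(row_free C^T) -kermx_eq0; apply/rowV0P => u /sub_kermxP uC.
  by apply: trmx_inj; rewrite trmx0; apply: Cinj; rewrite -[C]trmxK -trmx_mul uC trmx0.
have [k kE] : exists k : 'rV[F]_r, C = invmx P *m v *m k.
  have ck (j : 'I_r) : exists k, C *m delta_mx j 0 = k *: (invmx P *m v).
    have [->|/sing [_ [k kE] ] ] := eqVneq (C *m delta_mx j 0 : 'cV[F]_dd.+1) 0; first by exists 0; rewrite scale0r.
    by exists k; rewrite -[LHS](mulKmx Pu) kE scalemxAr.
  have [h hP] := boolp.choice ck; exists (\row_j h j).
  apply/matrixP => i j; have /matrixP/(_ i 0) := hP j.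
  rewrite -colE [X in X = _ -> _]mxE => ->; rewrite [LHS]mxE [RHS]mxE big_ord1.
  by rewrite [X in _ = _ * X]mxE mulrC.
have r1 : (r <= 1)%N by rewrite -rk kE (leq_trans (mulmx_max_rank _ _)).
case: r {Cinj CP sing rk k kE} C a aE r1 => [|[|//] ] C a aE _ //.
case/eqP: v0; rewrite -(mulKVmx Pu v) aE (_ : a = 0) ?mulmx0 //.
by apply/matrixP => -[].
Qed.

Definition tensor_weight dl dm (wl : 'I_dl -> 'rV[int]_n) (wm : 'I_dm -> 'rV[int]_n)
    (k : 'I_(dl * dm)) : 'rV[int]_n := wl (mxtens_unindex k).1 + wm (mxtens_unindex k).2.

Lemma tensor_diagonal dl dm (Vl : lie_rep g dl) (Vm : lie_rep g dm) wl wm :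
  diagonal_rep e f Vl wl -> diagonal_rep e f Vm wm ->
  diagonal_rep e f (tensor_rep Vl Vm) (tensor_weight wl wm).
Proof.
move=> hl hm i; rewrite /= /tensor_fun hl hm; apply/matrixP => a b.
rewrite -(mxtens_unindexK a) -(mxtens_unindexK b).
move: (mxtens_unindex a) (mxtens_unindex b) => [a1 a2] [b1 b2].
rewrite [LHS]mxE !tensmxE !mxE (can_eq (@mxtens_indexK _ _)) /tensor_weight !mxtens_indexK.
rewrite xpair_eqE /= rmorphD /=.
by case: eqP => _; case: eqP => _; rewrite ?mulr1n ?mulr0n ?mulr0 ?mul0r ?mulr1 ?mul1r ?addr0.
Qed.

(** The one number [r] links characters to homomorphisms. The middle clause will bound levels: a
    nonzero singular vector forces [nu] to be a weight of the tensor product. *)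
Lemma tensor_count dl dm (Vl : lie_rep g dl) (Vm : lie_rep g dm) lam mu Pl Pm
    (Plu : Pl \in unitmx) (Pmu : Pm \in unitmx) wl wm nu :
  is_irrep e f lam Vl -> is_irrep e f mu Vm ->
  diagonal_rep e f (conj_rep Vl Plu) wl -> diagonal_rep e f (conj_rep Vm Pmu) wm -> dominant nu ->
  exists r : nat, [/\ r%:R = \sum_(w <- weyl_seq A) (\det w)%:~R *
      (mult (tensor_weight wl wm) (nu + rho n - rho n *m w))%:R :> F,
    (0 < r)%N -> exists i j, nu = wl i + wm j &
    forall dn (Vn : lie_rep g dn), is_irrep e f nu Vn ->
      \dim (rep_hom Vn (tensor_rep Vl Vm)) = r].
Proof.
move=> irrl irrm hl hm nud; have [cd] := casimir_datum_exists H chev simple.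
pose T := tensor_rep Vl Vm; pose T0 := tensor_rep (conj_rep Vl Plu) (conj_rep Vm Pmu).
have Th : diagonal_rep e f T0 (tensor_weight wl wm) by exact: tensor_diagonal.
pose P := Pl *t Pm.
have [ [dl0 _] _] := irrl; have [ [dm0 _] _] := irrm.
have Pu : P \in unitmx by apply: tensmx_unit; rewrite -?lt0n.
have TP x : T x *m P = P *m T0 x.
  by rewrite /= /tensor_fun mulmxDl mulmxDr !tensmx_mul !conj_repE !mul1mx !mulmx1.
have tr := singular_transport e f _ _ Pu TP.
have [r [C [Cinj CP rE] ] ] : exists r, exists C : 'M[F]_(dl * dm, r),
  [/\ forall a : 'cV_r, C *m a = 0 -> a = 0,
      forall v, singular e f T0 nu v <-> exists a, v = C *m a &
      r%:R = \sum_(w <- weyl_seq A) (\det w)%:~R *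
        (mult (tensor_weight wl wm) (nu + rho n - rho n *m w))%:R :> F].
  have dpos : (0 < dl * dm)%N.
    by rewrite muln_gt0 dl0.
  move: (tensor_weight wl wm) T0 Th {T P Pu TP tr}.
  move: (dl * dm)%N dpos => [//|dd] _ wt T0 Th.
  apply (singular_count H chev cd Th nud).
exists r; split=> //.
  case: r C Cinj CP {rE} => // r C Cinj CP _.
  have sC : singular e f T0 nu (C *m delta_mx 0 0) by apply/CP; exists (delta_mx 0 0).
  have [k ck] : exists k, (C *m delta_mx 0 0 : 'cV_(dl * dm)) k 0 != 0.
    apply/existsP; apply: contraT => /existsPn h.
    have /Cinj /matrixP/(_ 0 0)/eqP : C *m (delta_mx 0 0 : 'cV[F]_r.+1) = 0.
      by apply/matrixP => i z; rewrite ord1 [RHS]mxE; apply/eqP/negbNE/h.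
    by rewrite !mxE oner_eq0.
  have wC : weight_vec e f T0 nu (C *m delta_mx 0 0) by move=> i; case: (sC i).
  have := iffLR (weight_vecP Th _ _) wC k ck; rewrite /tensor_weight => <-.
  by exists (mxtens_unindex k).1, (mxtens_unindex k).2.
move=> dn Vn irrn; apply: (dim_rep_hom cd irrn (C := P *m C)).
- move=> a; rewrite -mulmxA => E; apply: Cinj; by rewrite -[LHS](mulKmx Pu) E mulmx0.
- move=> w; rewrite -[w](mulKVmx Pu); split=> [/tr/CP [a ->]|[a] ].
    by exists a; rewrite mulmxA.
  rewrite -mulmxA => E; apply/tr/CP; exists a.
  by rewrite -(mulKmx Pu (C *m a)) -E mulKmx.
move=> v w sv v0; rewrite -[w](mulKVmx Pu) => /tr sw.
have [irrVn _] := irrn.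
have [phi hphi phiv] := hom_extension H chev cd Th irrVn v0 sv nud sw.
exists (P *m phi); last by rewrite -mulmxA phiv.
by move=> x; rewrite mulmxA TP -mulmxA hphi mulmxA.
Qed.

End Irreducible.

(** * Alternating functions and the affine Weyl group *)

Section Alternating.
Variables (F : numFieldType) (n : nat) (A : 'M[int]_n) (d : 'I_n -> int) (m : int).
Variables (th et : 'rV[int]_n).
Hypothesis H : finite_type A d m th et.
Let hth := ft_high H.
Let A2 := ft_diag H.
Let gfW := gf_weyl hth A2.
Let gfR := gf_root hth A2.
Implicit Types (x y c : 'rV[int]_n) (w : 'M[int]_n) (f t : 'rV[int]_n -> F).

Definition strictly_dominant x := forall i, 0 < x 0 i.

Definition alternating f := forall i x, f (x *m simple_reflection A i) = - f x.

Lemma det_weyl w : weyl_group A w -> \det w = 1 \/ \det w = -1.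
Proof.
move=> [s _ <-]; elim: s => [|i s IH]; first by left; rewrite weyl_word_nil det1.
by rewrite weyl_word_cons det_mulmx det_simple_reflection //; case: IH => ->; [right|left].
Qed.

Lemma det_weyl_inv w : weyl_group A w -> \det (invmx w) = \det w.
Proof. by rewrite det_inv; case/det_weyl => ->. Qed.

Lemma alternating_weyl f w x : alternating f -> weyl_group A w ->
  f (x *m w) = (\det w)%:~R * f x.
Proof.
move=> fa [s _ <-]; elim/last_ind: s x => [|s i IH] x.
  by rewrite weyl_word_nil mulmx1 det1 mul1r.
rewrite weyl_word_rcons mulmxA fa IH det_mulmx det_simple_reflection //.
by rewrite mulrN1 rmorphN mulNr.
Qed.

Lemma eq_opp (a : F) : a = - a -> a = 0.
Proof. by move/eqP; rewrite -subr_eq0 opprK -mulr2n mulrn_eq0 => /eqP. Qed.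

Lemma alternating_wall f x w : alternating f -> weyl_group A w -> \det w = -1 ->
  f (x *m w) = f x -> f x = 0.
Proof.
move=> fa Ww dw; rewrite (alternating_weyl _ fa Ww) dw => E; apply: eq_opp.
by rewrite -[LHS]E rmorphN mulN1r.
Qed.

Lemma alternating_nstrict f x : alternating f -> dominant x -> ~ strictly_dominant x -> f x = 0.
Proof.
move=> fa xd xs; have [i xi] : exists i, x 0 i = 0.
  apply: contrapT => h; apply: xs => i; rewrite lt_def xd andbT.
  by apply/eqP => xi; apply: h; exists i.
apply: (alternating_wall fa (weyl_group_reflection A i)); first exact: det_simple_reflection.
by rewrite mulmx_reflection xi scale0r subr0.
Qed.

Definition character t := (forall x, t x != 0) /\ forall x y, t (x + y) = t x * t y.

Definition weyl_alt t x : F := \sum_(w <- weyl_seq A) (\det w)%:~R * t (x *m w).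

Lemma weyl_alt_alternating t : alternating (weyl_alt t).
Proof.
move=> i x; have Wi := weyl_group_reflection A i.
rewrite /weyl_alt -[in RHS](perm_big _ (perm_weyl_mull hth A2 Wi)) big_map -sumrN.
apply: eq_bigr => w _; rewrite det_mulmx det_simple_reflection // mulN1r rmorphN.
by rewrite mulNr opprK mulmxA.
Qed.

Definition orbit x : seq 'rV[int]_n := undup [seq x *m w | w <- weyl_seq A].

Lemma mem_orbit x y : y \in orbit x <-> exists2 w, weyl_group A w & y = x *m w.
Proof.
rewrite mem_undup; split=> [/mapP [w /(mem_weyl_seq hth A2) Ww ->]|[w Ww ->] ]; first by exists w.
by apply: map_f; exact/(mem_weyl_seq hth A2).
Qed.

Lemma perm_orbit x w : weyl_group A w -> perm_eq [seq y *m w | y <- orbit x] (orbit x).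
Proof.
move=> Ww; have Uw := weyl_group_unit A2 Ww; apply: uniq_perm; last 1 first.
- move=> y; apply/mapP/idP => [ [z /mem_orbit [v Wv ->] ->]|/mem_orbit [v Wv ->] ].
    by apply/mem_orbit; exists (v *m w); [exact: weyl_groupM|rewrite mulmxA].
  exists (x *m v *m invmx w); last by rewrite mulmxKV.
  apply/mem_orbit; exists (v *m invmx w); last by rewrite mulmxA.
  by apply: weyl_groupM => //; exact: weyl_group_inv.
- rewrite map_inj_uniq ?undup_uniq // => y1 y2 /(congr1 (mulmx^~ (invmx w))) /=.
  by rewrite !mulmxK.
- exact: undup_uniq.
Qed.

Lemma weyl_alt_invariant t x (I : Type) (r : seq I) (s : I -> 'rV[int]_n) : character t ->
  (forall w, weyl_group A w -> \sum_(i <- r) t (s i *m w) = \sum_(i <- r) t (s i)) ->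
  weyl_alt t x * \sum_(i <- r) t (s i) = \sum_(i <- r) weyl_alt t (x + s i).
Proof.
move=> [_ tD] sW; rewrite /weyl_alt mulr_suml exchange_big /= big_seq [RHS]big_seq.
apply: eq_bigr => w /(mem_weyl_seq hth A2) Ww; rewrite -(sW w Ww) mulr_sumr.
by apply: eq_bigr => i _; rewrite mulmxDl tD mulrA.
Qed.

Lemma weyl_alt_orbit t x y : character t ->
  weyl_alt t x * \sum_(s <- orbit y) t s = \sum_(s <- orbit y) weyl_alt t (x + s).
Proof.
move=> tc; apply: (@weyl_alt_invariant t x _ (orbit y) id) => // w Ww.
by rewrite -[in RHS](perm_big _ (perm_orbit y Ww)) big_map.
Qed.

(** A stand-in for the Weyl-invariant integral group ring: one finite list of integers and weights
    describes multiplication by [phi], uniformly in the character and in the weight. *)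
Definition integral_multiplier (phi : ('rV[int]_n -> F) -> F) :=
  exists s : seq (int * 'rV[int]_n), forall t, character t -> forall x,
    weyl_alt t x * phi t = \sum_(p <- s) p.1%:~R * weyl_alt t (x + p.2).

Lemma integral_multiplierB phi psi : integral_multiplier phi -> integral_multiplier psi ->
  integral_multiplier (fun t => phi t - psi t).
Proof.
move=> [s sP] [s' sP']; exists (s ++ [seq (- p.1, p.2) | p <- s']) => t tc x.
rewrite mulrBr sP // sP' // big_cat big_map /= -sumrN; congr (_ + _).
by apply: eq_bigr => p _; rewrite rmorphN mulNr.
Qed.

Lemma integral_multiplierZ (z : int) phi : integral_multiplier phi ->
  integral_multiplier (fun t => z%:~R * phi t).
Proof.
move=> [s sP]; exists [seq (z * p.1, p.2) | p <- s] => t tc x.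
by rewrite mulrCA sP // big_map mulr_sumr; apply: eq_bigr => p _; rewrite rmorphM mulrA.
Qed.

Lemma integral_multiplier0 : integral_multiplier (fun=> 0).
Proof. by exists [::] => t _ x; rewrite big_nil mulr0. Qed.

Lemma integral_multiplier_sum (I : Type) (r : seq I) phi :
  (forall i, integral_multiplier (phi i)) -> integral_multiplier (fun t => \sum_(i <- r) phi i t).
Proof.
move=> h; elim: r => [|i r [s sP] ].
  by exists [::] => t _ x; rewrite !big_nil mulr0.
have [s' sP'] := h i; exists (s' ++ s) => t tc x.
by rewrite big_cons mulrDr big_cat /= sP // sP'.
Qed.

Lemma integral_multiplier_orbit y : integral_multiplier (fun t => \sum_(s <- orbit y) t s).
Proof.
exists [seq (1, s) | s <- orbit y] => t tc x; rewrite weyl_alt_orbit // big_map.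
by apply: eq_bigr => s _; rewrite mul1r.
Qed.

(** [x] and [y] have equal norm, so the difference is 2(rho|x - y), and [x - y] is a nonzero element
    of the positive cone. *)
Lemma orbit_norm_lt x y : dominant x -> y \in orbit x -> y != x ->
  gf A (rho n + y) (rho n + y) < gf A (x + rho n) (x + rho n).
Proof.
move=> xd /mem_orbit [w Ww yE] yx; have [c c0 cE] := dominant_ge H xd Ww.
have yy : gf A y y = gf A x x by rewrite yE gfW.
have cn0 : c != 0.
  by apply: contra yx => /eqP c0'; rewrite c0' root_lattice0 -yE in cE; rewrite eq_sym -subr_eq0 cE.
have : 0 < gf A (rho n) (root_lattice A c).
  suff : 0 < 2 * gf A (rho n) (root_lattice A c) by lia.
  have [i ci] : exists i, c 0 i != 0.
    by apply/existsP; apply: contraR cn0 => /existsPn h; apply/eqP/rowP => i; rewrite row0E; apply/eqP/negbNE.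
  rewrite gfR (bigD1 i) //= ltr_wpDr ?sumr_ge0 // => [l _|].
    by rewrite mxE mulr1 mulr_ge0 // ltW // (g_gt0 hth A2).
  by rewrite mxE mulr1 mulr_gt0 ?(g_gt0 hth A2) // lt_def ci c0.
rewrite -cE -yE !gfDl !gfDr gfNr yy (gfC _ x (rho n)) (gfC _ y (rho n)); lia.
Qed.

(* Induction on the norm: the orbit sum of [x] gives [weyl_alt (x + rho)] up to
   terms [weyl_alt (rho + y)] with [|rho + y| < |rho + x|]. *)
Lemma weyl_alt_multiple x : dominant x -> exists2 phi, integral_multiplier phi &
  forall t, character t -> weyl_alt t (x + rho n) = weyl_alt t (rho n) * phi t.
Proof.
have [k] := ubnP (absz (gf A (x + rho n) (x + rho n))); elim: k x => // k IH x xk xd.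
have red y : y \in orbit x -> y != x -> exists2 phi, integral_multiplier phi &
    forall t, character t -> weyl_alt t (rho n + y) = weyl_alt t (rho n) * phi t.
  move=> yo yx; have [w Ww zd] := dominant_conj H (rho n + y).
  have [zs|zs] := pselect (strictly_dominant ((rho n + y) *m w)); last first.
    exists (fun=> 0) => [|t _]; first exact: integral_multiplier0.
    have := alternating_nstrict (weyl_alt_alternating t) zd zs.
    rewrite alternating_weyl //; last exact: weyl_alt_alternating.
    by rewrite mulr0 => /eqP; rewrite mulf_eq0; case: (det_weyl Ww) => ->;
      rewrite ?rmorphN ?oppr_eq0 oner_eq0 => /eqP.
  have [||phi iphi phiE] := IH ((rho n + y) *m w - rho n).
  - rewrite subrK gfW //; have := orbit_norm_lt xd yo yx.
    have := gf_ge0 A (rho n + y); have := gf_ge0 A (x + rho n).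
    move: xk; set a := gf _ _ _; set b := gf _ _ _; lia.
  - by move=> i; have := zs i; rewrite !rowE_ [rho n _ _]mxE; lia.
  exists (fun t => (\det w)%:~R * phi t) => [|t tc]; first exact: integral_multiplierZ.
  rewrite mulrCA -phiE // subrK alternating_weyl //; last exact: weyl_alt_alternating.
  by rewrite mulrA -rmorphM; case: (det_weyl Ww) => ->; rewrite ?mul1r ?mulrNN ?mul1r.
have /boolp.choice [psi psiP] : forall y, exists phi, integral_multiplier phi /\
    (y \in orbit x -> y != x -> forall t, character t -> weyl_alt t (rho n + y) = weyl_alt t (rho n) * phi t).
  move=> y; have [ [yo yx]|h] := pselect (y \in orbit x /\ y != x).
    by have [phi] := red y yo yx; exists phi.
  by exists (fun=> 0); split; [exact: integral_multiplier0|move=> yo yx; case: h].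
have xo : x \in orbit x by apply/mem_orbit; exists 1%:M; rewrite ?mulmx1 //; exact: weyl_group1.
exists (fun t => \sum_(s <- orbit x) t s - \sum_(y <- orbit x | y != x) psi y t).
  apply: integral_multiplierB (integral_multiplier_orbit x) _.
  suff -> : (fun t => \sum_(y <- orbit x | y != x) psi y t) =
      (fun t => \sum_(y <- [seq y <- orbit x | y != x]) psi y t).
    by apply: integral_multiplier_sum => y; case: (psiP y).
  by apply/funext => t; rewrite big_filter.
move=> t tc; rewrite mulrBr weyl_alt_orbit // (bigD1_seq x) ?undup_uniq //= mulr_sumr addrC (addrC x).
rewrite [X in X + _ - _](_ : _ = \sum_(y <- orbit x | y != x) weyl_alt t (rho n) * psi y t).
  by rewrite addrAC subrr add0r.
rewrite big_seq_cond [RHS]big_seq_cond; apply: eq_bigr => y /andP [yo yx].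
by have [_ h] := psiP y; exact: h.
Qed.

(* The sign with which [x] is Weyl-conjugate to [nu + rho], or 0. *)
Definition conj_sign nu x : int := \sum_(w <- weyl_seq A) \det w * ((nu + rho n) *m w == x)%:R.

Lemma strictly_dominant_rho nu : dominant nu <-> strictly_dominant (nu + rho n).
Proof.
by split=> h i; have := h i; rewrite !rowE_ [rho n _ _]mxE; lia.
Qed.

Lemma strictly_dominant_conj x y v w : strictly_dominant x -> dominant y ->
  weyl_group A v -> weyl_group A w -> x *m v = y *m w -> x = y /\ v = w.
Proof.
move=> xs yd Wv Ww E; have Uv := weyl_group_unit A2 Wv; have Uw := weyl_group_unit A2 Ww.
have xd : dominant x by move=> i; exact: ltW.
have Wvw : weyl_group A (v *m invmx w) by apply: weyl_groupM => //; exact: weyl_group_inv.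
have E' : x *m (v *m invmx w) = y by rewrite mulmxA E mulmxK.
have yx : y = x by rewrite -E' (dominant_unique H) // E'.
split=> //; have /(congr1 (mulmx^~ w)) := stabilizer_trivial H xs Wvw (etrans E' yx).
by rewrite mulmxKV // mul1mx.
Qed.

Lemma weyl_alt_conj_sign t x (L : seq 'rV[int]_n) : uniq L -> (forall nu, nu \in L -> dominant nu) ->
  (forall nu w, weyl_group A w -> dominant nu -> nu + rho n = x *m w -> nu \in L) ->
  weyl_alt t x = \sum_(nu <- L) (conj_sign nu x)%:~R * weyl_alt t (nu + rho n).
Proof.
move=> uL Ld Lx; have ta := weyl_alt_alternating t; have [w Ww zd] := dominant_conj H x.
have Uw := weyl_group_unit A2 Ww; have Wi := weyl_group_inv A2 Ww.
have [zs|zs] := pselect (strictly_dominant (x *m w)); last first.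
  have x0 : weyl_alt t x = 0.
    rewrite -[x](mulmxK Uw) alternating_weyl // (alternating_nstrict ta zd zs) ?mulr0 //.
  rewrite x0 big_seq big1 // => nu nuL; rewrite /conj_sign big_seq big1 ?mul0r // => v.
  move/(mem_weyl_seq hth A2) => Wv; case: eqP => [E|_]; last by rewrite mulr0.
  case: zs; have sn : strictly_dominant (nu + rho n) by apply/strictly_dominant_rho/Ld.
  have := strictly_dominant_conj sn zd Wv Wi; rewrite mulmxK // => /(_ E) [<- _]; exact: sn.
pose nu0 := x *m w - rho n; have nE : nu0 + rho n = x *m w by rewrite subrK.
have nu0d : dominant nu0 by apply/strictly_dominant_rho; rewrite nE.
have nu0L : nu0 \in L by exact: Lx Ww nu0d nE.
rewrite (bigD1_seq nu0) //= big_seq_cond big1 ?addr0 => [|nu /andP [nuL nn] ].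
  have -> : conj_sign nu0 x = \det w.
    rewrite /conj_sign (bigD1_seq (invmx w)) ?(uniq_weyl_seq A) //=; last exact/(mem_weyl_seq hth A2).
    rewrite nE mulmxK // eqxx mulr1 det_weyl_inv // big_seq_cond big1 ?addr0 // => v.
    move=> /andP [/(mem_weyl_seq hth A2) Wv vn]; case: eqP => [E|_]; last by rewrite mulr0.
    have := strictly_dominant_conj zs zd Wv Wi; rewrite mulmxK // => /(_ E) [_ vE].
    by rewrite vE eqxx in vn.
  rewrite nE alternating_weyl // mulrA -rmorphM.
  by case: (det_weyl Ww) => ->; rewrite ?mulrNN !mul1r.
rewrite /conj_sign big_seq big1 ?mul0r // => v /(mem_weyl_seq hth A2) Wv.
case: eqP => [E|_]; last by rewrite mulr0.
have sn : strictly_dominant (nu + rho n) by apply/strictly_dominant_rho/Ld.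
have := strictly_dominant_conj sn zd Wv Wi; rewrite mulmxK // => /(_ E) [E' _].
by rewrite -(addrK (rho n) nu) E' -nE addrK eqxx in nn.
Qed.

End Alternating.

(** Dedekind's argument: subtract [u j z] times the relation from its translate by [z], which
    removes the term [j] and multiplies the others by [u i z - u j z]. *)
Lemma characters_independent (T : eqType) (G : zmodType) (F : fieldType) (u : T -> G -> F)
    (s : seq T) (c : T -> F) : uniq s ->
  (forall i, i \in s -> u i 0 = 1 /\ forall x y, u i (x + y) = u i x * u i y) ->
  (forall i j, i \in s -> j \in s -> (forall x, u i x = u j x) -> i = j) ->
  (forall x, \sum_(i <- s) c i * u i x = 0) -> forall i, i \in s -> c i = 0.
Proof.
elim: s c => // j s IH c /= /andP [js us] uM udist ucomb.
have cs i : i \in s -> c i = 0.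
  move=> ins; have [z uz] : exists z, u i z != u j z.
    apply: contrapT => h; have ij : i = j.
      apply: udist; rewrite ?inE ?ins ?eqxx ?orbT // => x.
      by apply/eqP; apply: contrapT => /negP hx; apply: h; exists x.
    by rewrite -ij ins in js.
  have /eqP : c i * (u i z - u j z) = 0.
    apply: (IH (fun i => c i * (u i z - u j z)) us _ _ _ i ins).
    - by move=> l ls; apply: uM; rewrite inE ls orbT.
    - by move=> l l' ls ls'; apply: udist; rewrite inE ?ls ?ls' orbT.
    move=> x; have := ucomb (x + z); have /(congr1 ( *%R (u j z))) := ucomb x.
    rewrite !big_cons mulr0 mulrDr mulr_sumr => E1 E2.
    have [_ uDj] := uM j (mem_head _ _).
    rewrite -[RHS]subr0 -[X in _ = _ - X]E1 -[X in _ = X - _]E2 uDj [u j z * (_ * _)]mulrCA.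
    rewrite [u j z * _]mulrC opprD addrACA subrr add0r -sumrB big_seq [RHS]big_seq.
    apply: eq_bigr => l ls; have [|_ uDl] := uM l; first by rewrite inE ls orbT.
    by rewrite uDl; ring.
  by rewrite mulf_eq0 subr_eq0 (negbTE uz) orbF => /eqP.
move=> i; rewrite inE => /orP [/eqP ->|/cs //].
have := ucomb 0; rewrite big_cons big_seq big1 => [|l /cs ->]; last by rewrite mul0r.
by have [-> _] := uM j (mem_head _ _); rewrite mulr1 addr0.
Qed.

(** * Levels and alcoves *)

Section Level.
Variables (n : nat) (a : 'rV[int]_n).
Implicit Types (x y : 'rV[int]_n).
Definition lev x : int := \sum_i a 0 i * x 0 i.
Lemma levD x y : lev (x + y) = lev x + lev y.
Proof. by rewrite /lev -big_split; apply: eq_bigr => i _; rewrite mxE mulrDr. Qed.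
Lemma levZ (k : int) x : lev (k *: x) = k * lev x.
Proof. by rewrite /lev mulr_sumr; apply: eq_bigr => i _; rewrite mxE mulrCA. Qed.
Lemma levN x : lev (- x) = - lev x.
Proof. by rewrite -scaleN1r levZ mulN1r. Qed.
Lemma levB x y : lev (x - y) = lev x - lev y.
Proof. by rewrite levD levN. Qed.
Lemma lev0 : lev 0 = 0.
Proof. by rewrite /lev big1 // => i _; rewrite mxE mulr0. Qed.
End Level.

(* The affine Weyl group acting on weights is generated by [A]'s Weyl group and
   the translations by [N *: b] for [M b]; [lev a x = N] is the affine wall. *)
Record alcove n (A : 'M[int]_n) (a : 'rV[int]_n) (M : 'rV[int]_n -> Prop) : Prop := Alcove {
  al_pos : forall i, 0 < a 0 i;
  al_B : forall x y, M x -> M y -> M (x - y);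
  al_W : forall i x, M x -> M (x *m simple_reflection A i);
  al_bound : forall x w, dominant x -> weyl_group A w -> `|lev a (x *m w)| <= lev a x;
  al_ge2 : forall x, M x -> dominant x -> x != 0 -> 2 <= lev a x;
  al_refl : exists b w, [/\ M b, weyl_group A w, \det w = -1, lev a b = 2 &
    forall x, x *m w = x - lev a x *: b]
}.

Section Alcove.
Variables (F : numFieldType) (n : nat) (A : 'M[int]_n) (d : 'I_n -> int) (m : int).
Variables (th et : 'rV[int]_n).
Hypothesis H : finite_type A d m th et.
Variables (a : 'rV[int]_n) (M : 'rV[int]_n -> Prop).
Hypothesis al : alcove A a M.
Variable N : int.
Hypothesis N0 : 0 < N.
Let hth := ft_high H.
Let A2 := ft_diag H.
Implicit Types (x y z b c : 'rV[int]_n) (w v : 'M[int]_n) (f t : 'rV[int]_n -> F).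

Lemma al_0 : M 0.
Proof. by have [b [w [Mb _ _ _ _] ] ] := al_refl al; rewrite -(subrr b); exact: (al_B al). Qed.

Lemma al_N b : M b -> M (- b).
Proof. by move=> Mb; rewrite -sub0r; apply: (al_B al) => //; exact: al_0. Qed.

Lemma al_D b b' : M b -> M b' -> M (b + b').
Proof. by move=> Mb Mb'; rewrite -[b']opprK; apply: (al_B al) => //; exact: al_N. Qed.

Lemma al_weyl b w : M b -> weyl_group A w -> M (b *m w).
Proof.
move=> Mb [s _ <-]; elim: s b Mb => [|i s IH] b Mb; first by rewrite weyl_word_nil mulmx1.
by rewrite weyl_word_cons mulmxA; apply: IH; exact: (al_W al).
Qed.

(** Apply [al_bound] to rho and s_i, which moves rho by exactly alpha_i. *)
Lemma lev_simple_ge0 i : 0 <= lev a (simple_root A i).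
Proof.
have rd : dominant (rho n) by move=> j; rewrite mxE.
have := al_bound al rd (weyl_group_reflection A i).
rewrite mulmx_reflection levB levZ [rho n _ _]mxE mul1r ler_norml => /andP [_]; lia.
Qed.

Lemma lev_root_lattice_ge0 c : (forall i, 0 <= c 0 i) -> 0 <= lev a (root_lattice A c).
Proof.
move=> c0; rewrite root_latticeE; elim/big_ind: _ => [|x y x0 y0|i _].
- by rewrite lev0.
- by rewrite levD addr_ge0.
- by rewrite levZ mulr_ge0 ?lev_simple_ge0.
Qed.

Definition affine_alternating f :=
  alternating A f /\ forall b x, M b -> f (x + N *: b) = f x.

Lemma affine_alternating_wall f x : affine_alternating f -> lev a x = N -> f x = 0.
Proof.
move=> [fa fp] xN; have [b [w [Mb Ww dw _ wE] ] ] := al_refl al.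
apply: (alternating_wall H fa Ww dw); rewrite wE xN -scalerN fp //; exact: al_N.
Qed.

(* A weight beyond the affine wall gets shorter when reflected in it. *)
Lemma alcove_dominant x : exists z w b, [/\ weyl_group A w, M b, z = x *m w + N *: b,
  dominant z & lev a z <= N].
Proof.
have [k] := ubnP (absz (gf A x x)); elim: k x => // k IH x xk.
have [w Ww zd] := dominant_conj H x; have zz : gf A (x *m w) (x *m w) = gf A x x by rewrite (gf_weyl hth A2).
have [z zE] : exists z, z = x *m w by eexists.
rewrite -zE in zd zz.
have [zN|zN] := leP (lev a z) N.
  by exists z, w, 0; rewrite scaler0 addr0; split => //; apply: al_0.
have [b [s [Mb Ws ds bL sE] ] ] := al_refl al.
have b0 : b != 0 by apply/eqP => b0; rewrite b0 lev0 in bL.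
have gb := gf_gt0 hth A2 b0.
have bs : b *m s = - b by rewrite sE bL scaler_nat mulr2n opprD addrA subrr sub0r.
have zb : 2 * gf A z b = lev a z * gf A b b.
  have := gf_weyl hth A2 z b Ws; rewrite bs gfNr sE gfBl gfZl; lia.
have [|z' [w' [b' [Ww' Mb' z'E z'd z'N] ] ] ] := IH (z *m s + N *: b).
  suff : gf A (z *m s + N *: b) (z *m s + N *: b) < gf A x x.
    by have := gf_ge0 A (z *m s + N *: b); move: xk; set p := gf _ _ _; set q := gf _ _ _; lia.
  rewrite !gfDl !gfDr !gfZl !gfZr (gfC A b) (gf_weyl hth A2) // zz.
  have -> : gf A (z *m s) b = - gf A z b.
    by rewrite -[b in LHS]opprK -bs gfNr (gf_weyl hth A2).
  (* By [zb] the squared norm drops by exactly this amount. *)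
  have : N * (gf A b b * (lev a z - N)) > 0 by rewrite mulr_gt0 // mulr_gt0 // subr_gt0.
  rewrite mulrN; set g := gf A b b in zb *; set q := gf A z b in zb *; nia.
exists z', (w *m s *m w'), (b *m w' + b'); split => //.
- by apply: weyl_groupM => //; exact: weyl_groupM.
- by apply: al_D => //; exact: al_weyl.
- by rewrite z'E zE mulmxDl scalerDr addrA -scalemxAl !mulmxA.
Qed.

Lemma alcove_reduce x :
  (exists z w b, [/\ weyl_group A w, M b, z = x *m w + N *: b, strictly_dominant z /\ lev a z < N &
    forall f, affine_alternating f -> f x = (\det w)%:~R * f z]) \/
  (forall f, affine_alternating f -> f x = 0).
Proof.
have [z [w [b [Ww Mb zE zd zN] ] ] ] := alcove_dominant x.
have fz f : affine_alternating f -> f x = (\det w)%:~R * f z.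
  move=> [fa fp]; rewrite zE fp // (alternating_weyl H _ fa Ww) mulrA -rmorphM.
  by case: (det_weyl H Ww) => ->; rewrite ?mulrNN !mul1r.
have [zs|zs] := pselect (strictly_dominant z); last first.
  by right=> f fa; rewrite fz // (alternating_nstrict H (proj1 fa) zd zs) mulr0.
have [zl|zl] := ltP (lev a z) N; first by left; exists z, w, b.
right=> f fa; rewrite fz // (affine_alternating_wall fa) ?mulr0 //.
by apply/eqP; rewrite eq_le zN zl.
Qed.

(** Conjugate [b] by [v] to a dominant vector, of level at least 2 if nonzero. Then N times this
    level is the level of [y *m v] minus that of [x *m (w *m v)], and [al_bound] bounds both. *)
Lemma alcove_rigid x y w b : dominant x -> dominant y -> weyl_group A w -> M b ->
  y = x *m w + N *: b -> b = 0 \/ 2 * N <= lev a x + lev a y.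
Proof.
move=> xd yd Ww Mb yE; have [->|b0] := eqVneq b 0; [by left|right].
have [v Wv bd] := dominant_conj H b; have Uv := weyl_group_unit A2 Wv.
have bv0 : b *m v != 0 by apply: contra b0 => /eqP E; rewrite -[b](mulmxK Uv) E mul0mx.
have := al_ge2 al (al_weyl Mb Wv) bd bv0.
have := al_bound al yd Wv; have := al_bound al xd (weyl_groupM Ww Wv).
rewrite [in X in _ -> X -> _]yE mulmxDl -scalemxAl -mulmxA levD levZ !ler_norml.
move=> /andP [h1 _] /andP [_ h2] h3; set p := lev a (x *m (w *m v)) in h1 h2.
set q := lev a (b *m v) in h2 h3; rewrite -yE in h2; nia.
Qed.

(** Two levels below [N] add up to less than 2N, so [alcove_rigid] excludes a translation; what
    remains is uniqueness for the finite group. *)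
Lemma alcove_injective x y w v b : strictly_dominant x -> lev a x < N ->
  strictly_dominant y -> lev a y < N -> weyl_group A w -> weyl_group A v -> M b ->
  x *m w - y *m v = N *: b -> x = y /\ w = v.
Proof.
move=> xs xN ys yN Ww Wv Mb E; have Uv := weyl_group_unit A2 Wv; have Wi := weyl_group_inv A2 Wv.
have xd : dominant x by move=> i; exact: ltW.
have yd : dominant y by move=> i; exact: ltW.
have yE : y = x *m (w *m invmx v) + N *: - (b *m invmx v).
  by rewrite scalerN scalemxAl -E mulmxBl (mulmxK Uv) mulmxA opprB addrC subrK.
have [||E0|] := alcove_rigid xd yd _ _ yE.
- exact: weyl_groupM.
- by apply: al_N; exact: al_weyl.
- apply: (strictly_dominant_conj H xs yd Ww Wv).
  by rewrite [in RHS]yE E0 scaler0 addr0 mulmxA mulmxKV.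
- by move: xN yN; lia.
Qed.

End Alcove.

(** * Alternating sums times a Weyl-invariant family of weights *)

Section WeightFamily.
Variables (F : numFieldType) (n : nat) (A : 'M[int]_n) (d : 'I_n -> int) (m : int).
Variables (th et : 'rV[int]_n).
Hypothesis H : finite_type A d m th et.
Let hth := ft_high H.
Let A2 := ft_diag H.
Variables (D : nat) (wt : 'I_D -> 'rV[int]_n).
Hypothesis wtW : forall w mu, weyl_group A w -> mult wt (mu *m w) = mult wt mu.
Implicit Types (t : 'rV[int]_n -> F) (L : seq 'rV[int]_n).

Lemma count_family w mu : w \in unitmx ->
  count_mem mu [seq wt j *m w | j <- enum 'I_D] = mult wt (mu *m invmx w).
Proof.
move=> Uw; rewrite count_map /mult -sum1dep_card -sum1_count big_enum_cond /=.
apply: eq_bigl => j; apply/eqP/eqP => [<-|->]; first by rewrite mulmxK.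
by rewrite mulmxKV.
Qed.

Lemma sum_family_weyl t w : weyl_group A w -> \sum_j t (wt j *m w) = \sum_j t (wt j).
Proof.
move=> Ww; have U1 : (1%:M : 'M[int]_n) \in unitmx by exact: unitmx1.
have : perm_eq [seq wt j *m w | j <- enum 'I_D] [seq wt j *m 1%:M | j <- enum 'I_D].
  apply/allP => mu _ /=; rewrite !count_family //; last exact: (weyl_group_unit A2).
  by rewrite invmx1 mulmx1 wtW //; exact: weyl_group_inv.
move=> p; rewrite -big_enum -(big_map (fun j => wt j *m w) xpredT t) (perm_big _ p) big_map big_enum /=.
by apply: eq_bigr => j _; rewrite mulmx1.
Qed.

Lemma weyl_alt_family t L : character t -> uniq L -> (forall nu, nu \in L -> dominant nu) ->
  (forall j nu w, weyl_group A w -> dominant nu -> nu + rho n = (rho n + wt j) *m w -> nu \in L) ->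
  weyl_alt A t (rho n) * \sum_j t (wt j) =
  \sum_(nu <- L) (\sum_(w <- weyl_seq A) (\det w)%:~R * (mult wt (nu + rho n - rho n *m w))%:R) *
    weyl_alt A t (nu + rho n).
Proof.
move=> tc uL Ld Lc.
rewrite (weyl_alt_invariant H _ tc); last by move=> w Ww; exact: sum_family_weyl.
under eq_bigr => j _ do rewrite (weyl_alt_conj_sign H t uL Ld (Lc j)).
rewrite exchange_big; apply: eq_bigr => nu _; rewrite -mulr_suml; congr (_ * _).
under eq_bigr => j _ do rewrite /conj_sign rmorph_sum /=.
rewrite exchange_big /=.
(* Expansion puts [w] on [nu + rho], whereas [singular_count] has it on rho; inverting [w] and using
   the invariance of multiplicities reconciles the two. *)
have perm_inv : perm_eq [seq invmx w | w <- weyl_seq A] (weyl_seq A).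
  apply: uniq_perm; rewrite ?(uniq_weyl_seq A) // ?map_inj_uniq ?(uniq_weyl_seq A) //.
    exact: (can_inj (@invmxK _ _)).
  move=> w; apply/mapP/idP => [ [v /(mem_weyl_seq hth A2) Wv ->]|/(mem_weyl_seq hth A2) Ww].
    by apply/(mem_weyl_seq hth A2); exact: weyl_group_inv.
  by exists (invmx w); rewrite ?invmxK //; apply/(mem_weyl_seq hth A2); exact: weyl_group_inv.
rewrite -[in RHS](perm_big _ perm_inv) big_map big_seq [RHS]big_seq.
apply: eq_bigr => w /(mem_weyl_seq hth A2) Ww; rewrite (det_weyl_inv H Ww).
have Uw := weyl_group_unit A2 Ww.
under eq_bigr => j _ do rewrite rmorphM /=.
rewrite -mulr_sumr; congr (_ * _); rewrite -[in RHS](wtW _ Ww) mulmxBl mulmxKV //.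
rewrite /mult -sum1dep_card natr_sum [RHS]big_mkcond /=; apply: eq_bigr => j _.
rewrite (_ : ((nu + rho n) *m w == rho n + wt j) = (wt j == (nu + rho n) *m w - rho n)); first by case: ifP.
by rewrite eq_sym [RHS]eq_sym subr_eq [rho n + _]addrC eq_sym.
Qed.

Definition dominantb (x : 'rV[int]_n) : bool := [forall i, 0 <= x 0 i].

Lemma dominantP x : reflect (dominant x) (dominantb x).
Proof. exact: forallP. Qed.

Lemma family_support L : (forall nu, nu \in L -> dominant nu) -> exists L' : seq 'rV[int]_n,
  [/\ uniq L', forall nu, nu \in L' -> dominant nu, forall nu, nu \in L -> nu \in L' &
  forall j nu w, weyl_group A w -> dominant nu -> nu + rho n = (rho n + wt j) *m w -> nu \in L'].
Proof.
move=> Ld; pose S := [seq (rho n + wt j) *m w - rho n | j <- enum 'I_D, w <- weyl_seq A].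
exists (undup [seq nu <- L ++ S | dominantb nu]); split=> [||nu nuL|j nu w Ww nud nuE].
- exact: undup_uniq.
- by move=> nu; rewrite mem_undup mem_filter => /andP [/dominantP].
- by rewrite mem_undup mem_filter mem_cat nuL andbT; apply/dominantP/Ld.
rewrite mem_undup mem_filter mem_cat; apply/andP; split; first exact/dominantP.
rewrite -(addrK (rho n) nu) nuE; apply/orP; right.
by apply: allpairs_f; [rewrite mem_enum|exact/(mem_weyl_seq hth A2)].
Qed.

End WeightFamily.

(** * Fusion coefficients for a pairing of two affine Weyl groups *)

Section Pairing.
Variables (F : numFieldType) (n : nat).
Variables (A : 'M[int]_n) (d : 'I_n -> int) (m : int) (th et : 'rV[int]_n).
Hypothesis H : finite_type A d m th et.
Variables (a : 'rV[int]_n) (M : 'rV[int]_n -> Prop).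
Hypothesis al : alcove A a M.
Variables (A' : 'M[int]_n) (d' : 'I_n -> int) (m' : int) (th' et' : 'rV[int]_n).
Hypothesis H' : finite_type A' d' m' th' et'.
Variables (a' : 'rV[int]_n) (M' : 'rV[int]_n -> Prop).
Hypothesis al' : alcove A' a' M'.
Variable N : int.
Hypothesis N0 : 0 < N.
Let hth := ft_high H.
Let A2 := ft_diag H.
Variable e : 'rV[int]_n -> 'rV[int]_n -> F.
Implicit Types (x y z b : 'rV[int]_n) (w v : 'M[int]_n).
Hypothesis e_char : forall y, character (e y).
Hypothesis e_add : forall y1 y2 x, e (y1 + y2) x = e y1 x * e y2 x.
Hypothesis e_refl : forall i y x, e (y *m simple_reflection A' i) x = e y (x *m simple_reflection A i).
Hypothesis e_per : forall y b, M b -> e y (N *: b) = 1.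
Hypothesis e_per' : forall x b, M' b -> e (N *: b) x = 1.
Hypothesis e_nd : forall x, (forall y, e y x = 1) -> exists2 b, M b & x = N *: b.
Hypothesis e_nd' : forall y, (forall x, e y x = 1) -> exists2 b, M' b & y = N *: b.

Definition alcove_point y := strictly_dominant y /\ lev a' y < N.

Lemma e_word s y x : e (y *m weyl_word A' s) x = e y (x *m weyl_word A (rev s)).
Proof.
elim: s y => [|i s IH] y; first by rewrite !weyl_word_nil !mulmx1.
by rewrite weyl_word_cons mulmxA IH e_refl rev_cons weyl_word_rcons mulmxA.
Qed.

Lemma character0 (t : 'rV[int]_n -> F) : character t -> t 0 = 1.
Proof.
by move=> [t0 tD]; apply: (mulIf (t0 0)); rewrite -tD addr0 mul1r.
Qed.

Lemma characterB (t : 'rV[int]_n -> F) x y : character t -> t (x - y) = t x / t y.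
Proof. by move=> [t0 tD]; apply: (mulIf (t0 y)); rewrite -tD subrK mulfVK. Qed.

Lemma e0 x : e 0 x = 1.
Proof.
by have [t0 _] := e_char 0; apply: (mulIf (t0 x)); rewrite -e_add addr0 mul1r.
Qed.

Lemma e_sub y1 y2 x : e (y1 - y2) x = e y1 x / e y2 x.
Proof. by have [t0 _] := e_char y2; apply: (mulIf (t0 x)); rewrite -e_add subrK mulfVK. Qed.

Lemma weyl_alt_affine y : affine_alternating A M N (weyl_alt A (e y)).
Proof.
split=> [|b x Mb]; first exact: (weyl_alt_alternating H).
rewrite /weyl_alt big_seq [RHS]big_seq; apply: eq_bigr => w /(mem_weyl_seq hth A2) Ww.
have [_ eD] := e_char y; rewrite mulmxDl eD -scalemxAl e_per ?mulr1 //.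
exact: (al_weyl al).
Qed.

(** A reflection of [y] passes through the pairing to the right of every [w], where it permutes the
    group and changes the signs. *)
Lemma weyl_alt_affine' x : affine_alternating A' M' N (fun y => weyl_alt A (e y) x).
Proof.
split=> [i y|b y Mb].
  rewrite /weyl_alt -[in RHS](perm_big _ (perm_weyl_mulr hth A2 (weyl_group_reflection A i))) big_map -sumrN.
  apply: eq_bigr => w _; rewrite det_mulmx det_simple_reflection // mulrN1 rmorphN.
  by rewrite mulNr opprK e_refl mulmxA.
by rewrite /weyl_alt; apply: eq_bigr => w _; rewrite e_add e_per' ?mulr1.
Qed.

(* A combination vanishing at the alcove points vanishes at all points, where
   the characters involved are pairwise distinct. *)
Lemma weyl_alt_independent (L : seq 'rV[int]_n) (b : 'rV[int]_n -> F) : uniq L ->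
  (forall x, x \in L -> strictly_dominant x /\ lev a x < N) ->
  (forall y, alcove_point y -> \sum_(x <- L) b x * weyl_alt A (e y) x = 0) ->
  forall x, x \in L -> b x = 0.
Proof.
move=> uL Ls van.
pose f y := \sum_(x <- L) b x * weyl_alt A (e y) x.
have f0 y : f y = 0.
  have fa : affine_alternating A' M' N f.
    split=> [i z|c z Mc]; rewrite /f -?sumrN; apply: eq_bigr => x _.
      by rewrite -mulrN; congr (_ * _); have [h _] := weyl_alt_affine' x; rewrite h.
    by congr (_ * _); have [_ h] := weyl_alt_affine' x; rewrite h.
  have [ [z [w [c [_ _ _ zp h] ] ] ]|h] := alcove_reduce F H' al' N0 y; last exact: h.
  by rewrite h // [f z](van z zp) mulr0.
pose P := [seq (x, w) | x <- L, w <- weyl_seq A].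
pose u (p : 'rV[int]_n * 'M[int]_n) y := e y (p.1 *m p.2).
have PP p : p \in P -> p.1 \in L /\ weyl_group A p.2.
  by case/allpairsP => q [qL /(mem_weyl_seq hth A2) Wq ->].
have c0 := @characters_independent _ _ _ u P (fun p => b p.1 * (\det p.2)%:~R).
move=> x xL; have p1 : (x, 1%:M) \in P.
  by apply: allpairs_f => //; apply/(mem_weyl_seq hth A2); exact: weyl_group1.
have /eqP : b (x, 1%:M : 'M[int]_n).1 * (\det (x, 1%:M : 'M[int]_n).2)%:~R = 0.
  apply: c0 p1.
  - by apply: allpairs_uniq => [||[? ?] [? ?] ] //; exact: uniq_weyl_seq.
  - by move=> p _; split=> [|y1 y2]; [exact: e0|exact: e_add].
  - move=> [p w] [q v] /PP /= [pL Ww] /PP /= [qL Wv] pq.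
    have [c Mc cE] : exists2 c, M c & p *m w - q *m v = N *: c.
      apply: e_nd => y; have := pq y; rewrite /u /= (characterB _ _ (e_char y)) => ->.
      by rewrite divff //; have [h _] := e_char y.
    have [ps pN] := Ls p pL; have [qs qN] := Ls q qL.
    by have [-> ->] := alcove_injective H al N0 ps pN qs qN Ww Wv Mc cE.
  move=> y; rewrite -[RHS](f0 y) /f big_allpairs_dep /=; apply: eq_bigr => z _.
  by rewrite /weyl_alt mulr_sumr; apply: eq_bigr => w _; rewrite mulrA.
by rewrite /= det1 mulr1 => /eqP.
Qed.

Hypothesis rhoN : lev a (rho n) < N.

(** Every alternating sum at [y] is a multiple of the one for rho. If all vanished, the characters
    of [x] obtained by twisting [e y] with the group elements would be dependent, though they are
    distinct inside the alcove. *)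
Lemma weyl_alt_rho_neq0 y : alcove_point y -> weyl_alt A (e y) (rho n) != 0.
Proof.
move=> [ys yN]; apply/eqP => J0.
have ea := weyl_alt_alternating H (e y).
have Jx x : weyl_alt A (e y) x = 0.
  have [w Ww zd] := dominant_conj H x; have Uw := weyl_group_unit A2 Ww.
  rewrite -[x](mulmxK Uw) (alternating_weyl H _ ea); last exact: weyl_group_inv.
  have [zs|zs] := pselect (strictly_dominant (x *m w)); last first.
    by rewrite (alternating_nstrict H ea zd zs) mulr0.
  have [|phi _ phiE] := @weyl_alt_multiple F _ _ _ _ _ _ H (x *m w - rho n).
    by apply/strictly_dominant_rho; rewrite subrK.
  by move: (phiE _ (e_char y)); rewrite subrK J0 mul0r => ->; rewrite mulr0.
pose u w x := e y (x *m w).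
have rs : strictly_dominant (rho n) by move=> i; rewrite mxE.
have d0 : (\det (1%:M : 'M[int]_n))%:~R = 0 :> F.
  apply: (@characters_independent _ _ _ u (weyl_seq A) (fun w => (\det w)%:~R)).
  - exact: uniq_weyl_seq.
  - move=> w _; rewrite /u mul0mx; split=> [|x1 x2]; first exact: character0.
    by have [_ eD] := e_char y; rewrite mulmxDl eD.
  - move=> w1 w2 /(mem_weyl_seq hth A2) W1 /(mem_weyl_seq hth A2) W2 u12.
    have [s1 _ E1] := W1; have [s2 _ E2] := W2.
    pose v1 := weyl_word A' (rev s1); pose v2 := weyl_word A' (rev s2).
    have ev1 z x : e (z *m v1) x = e z (x *m w1) by rewrite /v1 e_word revK E1.
    have ev2 z x : e (z *m v2) x = e z (x *m w2) by rewrite /v2 e_word revK E2.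
    have [c Mc cE] : exists2 c, M' c & y *m v1 - y *m v2 = N *: c.
      apply: e_nd' => x; have := u12 x; rewrite e_sub ev1 ev2 /u => ->.
      by rewrite divff //; have [h _] := e_char y.
    have [_ v12] := alcove_injective H' al' N0 ys yN ys yN (weyl_group_word _ _) (weyl_group_word _ _) Mc cE.
    (* [v1 = v2] concerns words in the other group; the return to [w1 = w2] goes through the
       pairing, with rho as a second interior point. *)
    have [b Mb bE] : exists2 b, M b & rho n *m w1 - rho n *m w2 = N *: b.
      apply: e_nd => z; rewrite (characterB _ _ (e_char z)) -ev1 -ev2 /v1 v12 -/v2 divff //.
      by have [h _] := e_char (z *m v2).
    by have [_ ->] := alcove_injective H al N0 rs rhoN rs rhoN W1 W2 Mb bE.
  - by move=> x; exact: Jx.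
  by apply/(mem_weyl_seq hth A2); exact: weyl_group1.
by move/eqP: d0; rewrite det1 oner_eq0.
Qed.

Variables (k : int) (PL : seq 'rV[int]_n).
Hypothesis PLu : uniq PL.
Hypothesis PLP : forall x, x \in PL <-> dominant x /\ lev a x <= k.
Hypothesis rhoE : lev a (rho n) = N - 1 - k.

Lemma level_rho x : x \in PL <-> strictly_dominant (x + rho n) /\ lev a (x + rho n) < N.
Proof.
rewrite PLP levD rhoE -strictly_dominant_rho; split=> [ [h l]|[h l] ]; split=> //; lia.
Qed.

Definition weyl_chi (x y : 'rV[int]_n) : F := weyl_alt A (e y) (x + rho n) / weyl_alt A (e y) (rho n).

Lemma fusion_unique (b : 'rV[int]_n -> F) :
  (forall y, alcove_point y -> \sum_(x <- PL) b x * weyl_chi x y = 0) -> forall x, x \in PL -> b x = 0.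
Proof.
move=> h x xL; rewrite -(addrK (rho n) x).
apply: (weyl_alt_independent (L := [seq z + rho n | z <- PL]) (b := fun z => b (z - rho n))).
- by rewrite map_inj_uniq //; exact: addIr.
- by move=> z /mapP [z' z'L ->]; apply/level_rho.
- move=> y yp; rewrite big_map; have := h y yp => /(congr1 ( *%R^~ (weyl_alt A (e y) (rho n)))) /=.
  rewrite mul0r mulr_suml => E; rewrite -[RHS]E; apply: eq_bigr => z _.
  by rewrite addrK /weyl_chi mulrA mulfVK // weyl_alt_rho_neq0.
by apply/mapP; exists x.
Qed.

(** The coefficients serve all affine alternating functions at once. The second clause records the
    origin of a coefficient that is not a Kronecker delta: an affine conjugate different from [x],
    which [fusion_tensor] will exclude by level. *)
Lemma alcove_expand x : exists b : 'rV[int]_n -> int,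
  (forall f, affine_alternating A M N f -> f x = \sum_(z <- PL) (b z)%:~R * f (z + rho n) :> F) /\
  (forall z, z \in PL -> b z = (x == z + rho n)%:R \/
    x != z + rho n /\ exists w c, [/\ weyl_group A w, M c & z + rho n = x *m w + N *: c]).
Proof.
have [xL|xL] := boolP (x - rho n \in PL).
  exists (fun z => (x == z + rho n)%:R); split=> [f _|z _]; last by left.
  rewrite (bigD1_seq _ xL) //= subrK eqxx mul1r big1 ?addr0 // => z zx.
  by case: eqP => [E|_]; [rewrite E addrK eqxx in zx|rewrite mul0r].
have [ [z [w [c [Ww Mc zE [zs zN] h] ] ] ]|h] := alcove_reduce F H al N0 x; last first.
  exists (fun=> 0); split=> [f fa|z zL].
    by rewrite h // big1 // => z _; rewrite mul0r.
  by left; case: eqP => [E|//]; rewrite E addrK zL in xL.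
have zL : z - rho n \in PL by apply/level_rho; rewrite subrK.
exists (fun y => \det w * (z == y + rho n)%:R); split=> [f fa|y yL].
  rewrite h // (bigD1_seq _ zL) //= subrK eqxx mulr1 big1 ?addr0 // => y yz.
  by case: eqP => [E|_]; [rewrite E addrK eqxx in yz|rewrite mulr0 mul0r].
have xy : x != y + rho n by apply: contraNneq xL => ->; rewrite addrK.
case: (z =P y + rho n) => [E|_]; last by left; rewrite (negbTE xy) mulr0.
by right; split=> //; exists w, c; rewrite -E.
Qed.

Definition fusion_row (lam mu : 'rV[int]_n) (c : 'rV[int]_n -> F) : Prop :=
  forall y, alcove_point y ->
    weyl_chi lam y * weyl_chi mu y = \sum_(z <- PL) c z * weyl_chi z y.

Lemma fusion_row_eq lam mu c (b : 'rV[int]_n -> F) : fusion_row lam mu c ->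
  (forall y, alcove_point y -> weyl_chi lam y * weyl_chi mu y * weyl_alt A (e y) (rho n) =
    \sum_(z <- PL) b z * weyl_alt A (e y) (z + rho n)) ->
  forall z, z \in PL -> c z = b z.
Proof.
move=> hc hb z zL; apply/eqP; rewrite -subr_eq0; apply/eqP.
apply: (fusion_unique (b := fun z => c z - b z)) zL => y yp.
under eq_bigr => x _ do rewrite mulrBl.
rewrite sumrB -hc //; apply/eqP; rewrite subr_eq0; apply/eqP.
apply: (mulIf (weyl_alt_rho_neq0 yp)); rewrite hb // mulr_suml; apply: eq_bigr => x _.
by rewrite /weyl_chi -!mulrA mulVf ?mulr1 // weyl_alt_rho_neq0.
Qed.

Lemma fusion_integral lam mu c : dominant lam -> fusion_row lam mu c ->
  forall z, z \in PL -> exists k : int, c z = k%:~R.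
Proof.
move=> lamd hc; have [phi [s sP] phiE] := @weyl_alt_multiple F _ _ _ _ _ _ H lam lamd.
have [b bP] := boolp.choice alcove_expand.
move=> z zL; exists (\sum_(p <- s) p.1 * b (mu + rho n + p.2) z); rewrite rmorph_sum /=.
apply: (fusion_row_eq (b := fun z => \sum_(p <- s) (p.1 * b (mu + rho n + p.2) z)%:~R) hc) zL => y yp.
have ec := e_char y; have J0 := weyl_alt_rho_neq0 yp.
rewrite /weyl_chi phiE // [X in X / _]mulrC mulfK // -mulrA mulfVK // mulrC sP //.
under [RHS]eq_bigr => x _ do rewrite mulr_suml.
rewrite exchange_big; apply: eq_bigr => p _.
have [E _] := bP (mu + rho n + p.2); rewrite (E _ (weyl_alt_affine y)).
by rewrite mulr_sumr; apply: eq_bigr => x _; rewrite rmorphM mulrA.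
Qed.

Lemma fusion_tensor lam mu c (L : seq 'rV[int]_n) (r : 'rV[int]_n -> nat) nu :
  fusion_row lam mu c -> uniq L -> (forall x, x \in L -> dominant x) ->
  (forall x, (0 < r x)%N -> lev a x <= lev a (lam + mu)) ->
  (forall y, alcove_point y -> weyl_chi lam y * weyl_chi mu y * weyl_alt A (e y) (rho n) =
    \sum_(x <- L) (r x)%:R * weyl_alt A (e y) (x + rho n)) ->
  nu \in PL -> nu \in L -> lev a (lam + mu + nu) <= 2 * k -> c nu = (r nu)%:R.
Proof.
move=> hc uL Ld rlev hL nuP nuL nuk; have [b bP] := boolp.choice alcove_expand.
rewrite (fusion_row_eq (b := fun z => \sum_(x <- L) (r x)%:R * (b (x + rho n) z)%:~R) hc _ nuP); last first.
  move=> y yp; rewrite hL //; under [RHS]eq_bigr => x _ do rewrite mulr_suml.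
  rewrite exchange_big; apply: eq_bigr => x _.
  have [E _] := bP (x + rho n); rewrite (E _ (weyl_alt_affine y)).
  by rewrite mulr_sumr; apply: eq_bigr => z _; rewrite mulrA.
rewrite (bigD1_seq nu) //= big_seq_cond big1 ?addr0 => [|x /andP [xL xnu] ].
  have [_ /(_ nu nuP) [->|[/eqP //] ] ] := bP (nu + rho n).
  by rewrite eqxx mulr1.
have [->|r0] := posnP (r x); first by rewrite mul0r.
have [_ /(_ nu nuP) [->|[xn [w [g [Ww Mg E] ] ] ] ] ] := bP (x + rho n).
  by rewrite (inj_eq (addIr _)) (negbTE xnu) mulr0.
have xs : strictly_dominant (x + rho n) by apply/strictly_dominant_rho/Ld.
have ns : strictly_dominant (nu + rho n) by have [] := iffLR (level_rho nu) nuP.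
have xd : dominant (x + rho n) by move=> i; exact: ltW.
have nd : dominant (nu + rho n) by move=> i; exact: ltW.
have [g0|] := alcove_rigid H al N0 xd nd Ww Mg E.
  case/eqP: xn; rewrite E g0 scaler0 addr0.
  by apply/esym/(dominant_unique H xd Ww); rewrite -[_ *m w]addr0 -(scaler0 _ N) -g0 -E.
(* Each rho adds [N - 1 - k], so the two levels add up to at most 2k + 2(N - 1 - k) = 2N - 2. *)
have := rlev x r0; move: nuk; rewrite !levD rhoE; lia.
Qed.

End Pairing.

Definition row_span n (S : 'M[int]_n) (x : 'rV[int]_n) : Prop := exists q : 'rV[int]_n, x = q *m S.

(** * The two kinds of alcoves *)

Section CorootAlcove.
Variables (n : nat) (A : 'M[int]_n) (d : 'I_n -> int) (m : int) (th et : 'rV[int]_n).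
Hypothesis H : finite_type A d m th et.
Let hth := ft_high H.
Let A2 := ft_diag H.

Let A2t i : A^T i i = 2.
Proof. by rewrite mxE A2. Qed.

Lemma alcove_coroot : alcove A et (row_span A^T).
Proof.
split=> [i|x y [q ->] [q' ->]|i x [q ->]|x w xd Ww|x [q ->] xd x0|].
- exact: lt_le_trans (highest_ge1 (ft_cohigh H) A2t i).
- by exists (q - q'); rewrite mulmxBl.
- by exists (q - root_lattice A q 0 i *: delta_mx 0 i); exact: root_lattice_reflection.
- exact: (cohighest_bound H).
- apply: (cohighest_level_ge2 H xd); apply: contra x0 => /eqP ->; by rewrite mul0mx.
have [ [i [_ [s _ <-] etE] ] _] := ft_cohigh H.
(* [v] carries the highest coroot to the simple coroot [i]: the level of [x] is the [i]-th
   coordinate of [x *m v], and the reflection sought is the conjugate of s_i by [v]. *)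
pose v := weyl_word A (rev s); have Wv : weyl_group A v := weyl_group_word A _.
have Uv := weyl_group_unit A2 Wv; have Wi := weyl_group_inv A2 Wv.
have etv : et = delta_mx 0 i *m v^T.
  apply: (root_lattice_inj (ft_cohigh H)); rewrite etE -root_lattice_delta root_lattice_word.
  by rewrite trmxK.
have levE x : lev et x = (x *m v) 0 i.
  have -> : (x *m v) 0 i = (x *m v *m (delta_mx 0 i : 'rV[int]_n)^T) 0 0.
    by rewrite [RHS]mxE (bigD1 i) //= big1 ?addr0 => [|j ji]; rewrite !mxE ?eqxx ?mulr1 // (negbTE ji) mulr0.
  by rewrite -mulmxA -[v]trmxK -trmx_mul -etv [RHS]mxE; apply: eq_bigr => j _; rewrite mxE mulrC.
exists (simple_root A i *m invmx v), (v *m simple_reflection A i *m invmx v); split.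
- have [c cE] := root_lattice_weyl (delta_mx 0 i) Wi.
  by exists c; rewrite -root_lattice_delta cE.
- by apply: weyl_groupM => //; apply: weyl_groupM => //; exact: weyl_group_reflection.
- by rewrite !det_mulmx mulrAC -det_mulmx mulmxV // det1 mul1r det_simple_reflection.
- by rewrite levE mulmxKV // simple_rootE A2.
by move=> x; rewrite !mulmxA mulmx_reflection mulmxBl mulmxK // -scalemxAl levE.
Qed.

Variables (S : 'M[int]_n) (a : 'rV[int]_n) (e : int).
Hypothesis e0 : 0 < e.
Hypothesis SE : forall i j, e * d i * S i j = m * A j i.
Hypothesis aE : forall i, m * a 0 i = e * th 0 i * d i.

Let d0 := d_gt0 H.
Let m0 := ft_m H.

(** For the invariant form in which long roots have norm 2e, row [i] of [S] is 2
    alpha_i/(alpha_i|alpha_i), a simple coroot seen as a weight, and [a] holds the coordinates of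
    theta in these rows when theta is long. *)
Let row_span_coord q j : e * d j * (q *m S) 0 j = m * root_lattice A^T q 0 j.
Proof.
rewrite mxE root_lattice_coord !mulr_sumr; apply: eq_bigr => i _; rewrite mxE.
have E : d i * (e * d j * S i j) = d i * (m * A i j).
  have -> : d i * (e * d j * S i j) = d j * (e * d i * S i j) by ring.
  by rewrite SE mulrCA -(ft_sym H) mulrCA.
by move/(mulfI (lt0r_neq0 (d0 i))): E => E; rewrite mulrCA E; ring.
Qed.

Let row_span_reflection j x : row_span S x -> row_span S (x *m simple_reflection A j).
Proof.
move=> [q ->]; exists (q - root_lattice A^T q 0 j *: delta_mx 0 j).
rewrite mulmx_reflection mulmxBl; congr (_ - _).
rewrite -scalemxAl -rowE; apply/rowP => l; rewrite !rowE_ simple_rootE [row _ _ _ _]mxE.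
apply: (mulfI (lt0r_neq0 (mulr_gt0 e0 (d0 j)))).
by rewrite mulrA row_span_coord mulrCA SE; ring.
Qed.

Let lev_gf i x : 2 * (e * d i * gf A x (root_lattice A th)) = g A i * (m * lev a x).
Proof.
have := gf_root hth A2 x th => E.
have -> : 2 * (e * d i * gf A x (root_lattice A th)) = e * d i * (2 * gf A x (root_lattice A th)) by ring.
rewrite E /lev !mulr_sumr; apply: eq_bigr => j _.
have -> : e * d i * (th 0 j * x 0 j * g A j) = e * th 0 j * x 0 j * (g A j * d i) by ring.
by rewrite (g_proportional H) [m * _]mulrA aE; ring.
Qed.

Lemma alcove_form : alcove A a (row_span S).
Proof.
have [i [w0 Ww0 [thE _] ] ] := highest_connected hth A2.
have Wi := weyl_group_inv A2 Ww0; have Uw := weyl_group_unit A2 Ww0.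
have gi := g_gt0 hth A2 i.
have K0 : 0 < g A i * m by rewrite mulr_gt0.
have levE x : m * lev a x = e * d i * (x *m invmx w0) 0 i.
  have := lev_gf i x; rewrite thE.
  have -> : gf A x (simple_root A i *m w0) = gf A (x *m invmx w0) (simple_root A i).
    by rewrite -[RHS](gf_weyl hth A2 _ _ Ww0) mulmxKV.
  have -> y : 2 * (e * d i * gf A y (simple_root A i)) = e * d i * (2 * gf A y (simple_root A i)) by ring.
  rewrite (gf_simple hth A2) mulrA [RHS]mulrC => E.
  by apply: (mulIf (lt0r_neq0 gi)); rewrite -E.
split=> [j|x y [q ->] [q' ->]|j x [q ->]|x w xd Ww|x [q ->] xd x0|].
- have : 0 < m * a 0 j by rewrite aE mulr_gt0 // mulr_gt0 // (lt_le_trans _ (highest_ge1 hth A2 j)).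
  by rewrite pmulr_rgt0.
- by exists (q - q'); rewrite mulmxBl.
- by apply: row_span_reflection; exists q.
- have Wwi := weyl_group_inv A2 Ww.
  have gxw y : gf A (y *m w) (root_lattice A th) = gf A y (root_lattice A th *m invmx w).
    by rewrite -(gf_weyl hth A2 _ _ Wwi) mulmxK ?(weyl_group_unit A2).
  have [c cE] := root_lattice_weyl th Wwi.
  have rc : is_root A (root_lattice A c) by rewrite -cE; apply: is_rootM Wwi; exact: (proj1 hth).
  have cb := root_bound hth A2 rc.
  have bound : `|2 * gf A x (root_lattice A c)| <= 2 * gf A x (root_lattice A th).
    rewrite !(gf_root hth A2); apply: (le_trans (ler_norm_sum _ _ _)); apply: ler_sum => j _.
    rewrite !normrM (ger0_norm (xd j)) (ger0_norm (ltW (g_gt0 hth A2 j))).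
    by rewrite ler_pM2r ?(g_gt0 hth A2) // ler_wpM2r // ler_norml.
  have ed : 0 < e * d i by rewrite mulr_gt0.
  have := lev_gf i (x *m w); have := lev_gf i x; rewrite gxw cE.
  rewrite !mulrA => E1 E2.
  have E1' : g A i * m * lev a x = e * d i * (2 * gf A x (root_lattice A th)) by rewrite -E1; ring.
  have E2' : g A i * m * lev a (x *m w) = e * d i * (2 * gf A x (root_lattice A c)) by rewrite -E2; ring.
  rewrite -(ler_pM2l K0) E1' -[X in X * `|_|](gtr0_norm K0) -normrM E2' normrM (gtr0_norm ed).
  by rewrite ler_pM2l.
(* In the dual system [q] is a root lattice vector, and the level is its pairing with [th], the
   highest coroot of that system; so [cohighest_level_ge2] applies. *)
- have q0 : q != 0 by apply: contra x0 => /eqP ->; rewrite mul0mx.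
  have qd : dominant (root_lattice A^T q).
    move=> j; have := row_span_coord q j; have := xd j; have := mulr_gt0 e0 (d0 j) => ed xj E.
    have : 0 <= m * root_lattice A^T q 0 j by rewrite -E mulr_ge0 // ltW.
    by rewrite pmulr_rge0.
  have := cohighest_level_ge2 (finite_type_tr H) qd q0.
  suff -> : \sum_j th 0 j * root_lattice A^T q 0 j = lev a (q *m S) by [].
  apply: (mulfI (lt0r_neq0 m0)); rewrite /lev !mulr_sumr; apply: eq_bigr => j _.
  by rewrite mulrCA -row_span_coord [RHS]mulrA aE; ring.
exists (delta_mx 0 i *m S *m w0), (invmx w0 *m simple_reflection A i *m w0); split.
- have M0 : row_span S (delta_mx 0 i *m S) by exists (delta_mx 0 i).
  have [s _ <-] := Ww0; elim: s (delta_mx 0 i *m S) M0 => [|j s IH] y My.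
    by rewrite weyl_word_nil mulmx1.
  by rewrite weyl_word_cons mulmxA; apply: IH; exact: row_span_reflection.
- by apply: weyl_groupM => //; apply: weyl_groupM => //; exact: weyl_group_reflection.
- by rewrite !det_mulmx mulrAC -det_mulmx mulVmx // det1 mul1r det_simple_reflection.
- apply: (mulfI (lt0r_neq0 m0)); rewrite levE mulmxK // -rowE [row _ _ _ _]mxE SE A2; ring.
move=> x; rewrite !mulmxA mulmx_reflection mulmxBl mulmxKV //; congr (_ - _).
rewrite -scalemxAl scalemxAl scalemxAl; congr (_ *m _).
rewrite -rowE; apply/rowP => l; rewrite !rowE_ simple_rootE [row _ _ _ _]mxE.
apply: (mulfI (lt0r_neq0 m0)); rewrite [in RHS]mulrA levE mulrCA -SE; ring.
Qed.

End CorootAlcove.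

(** * The exponential pairing *)

Section Expi.
Variable R : realType.
Implicit Types (x : R).

Lemma expi0 : expi 0 = 1 :> R[i].
Proof. by rewrite /expi cos0 sin0. Qed.

Lemma expi_nat k x : expi (x *+ k) = expi x ^+ k.
Proof.
elim: k => [|k IH]; first by rewrite mulr0n expi0.
by rewrite mulrS expiD IH exprS.
Qed.

Lemma expi_int (z : int) : expi (2 * pi * z%:~R) = 1 :> R[i].
Proof.
have E k : expi (2 * pi * k%:R) = 1 :> R[i].
  by rewrite mulr_natr expi_nat /expi mulr_natl cos2pi sin2pi expr1n.
case: z => k; first by rewrite E.
rewrite NegzE rmorphN mulrN; apply: (mulIf (expi_neq0 (2 * pi * k.+1%:R))).
by rewrite -expiD addNr expi0 mul1r E.
Qed.

(** Subtract the integral part. By the double angle formula the fractional part [f] has sin (pi f) =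
    0, while the sine is positive for 0 < f < 1. *)
Lemma expi_eq1 x : expi (2 * pi * x) = 1 -> exists z : int, x = z%:~R.
Proof.
move=> x1; exists (Num.floor x); set f := x - (Num.floor x)%:~R.
have /andP [fl fu] := floor_itv x.
have f0 : 0 <= f by rewrite subr_ge0.
have f1 : f < 1 by rewrite ltrBlDl -[1]/(1%:~R) -rmorphD.
have : expi (2 * pi * f) = 1.
  by rewrite -[LHS]mulr1 -[X in _ * X = _](expi_int (Num.floor x)) -expiD -mulrDr subrK.
have -> : 2 * pi * f = (pi * f) *+ 2 by rewrite mulr2n; ring.
rewrite /expi => -[c1 _]; have := cos2Dsin2 (pi * f); move: c1; rewrite cos_mulr2n.
have [fz|fn0] := eqVneq f 0.
  by move=> _ _; apply/eqP; rewrite -subr_eq0 -/f fz.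
have : 0 < sin (pi * f).
  apply: sin_gt0_pi; apply/andP; split; first by rewrite mulr_gt0 ?pi_gt0 // lt_def fn0.
  by rewrite -[ltRHS]mulr1 ltr_pM2l ?pi_gt0.
rewrite !expr2; nra.
Qed.
End Expi.

Lemma real_vecD (R : realType) n (x y : 'rV[int]_n) : real_vec R (x + y) = real_vec R x + real_vec R y.
Proof. exact: map_mxD. Qed.

Lemma real_vecZ (R : realType) n (z : int) (x : 'rV[int]_n) : real_vec R (z *: x) = z%:~R *: real_vec R x.
Proof. exact: map_mxZ. Qed.

Lemma real_vecM (R : realType) n (x : 'rV[int]_n) (w : 'M[int]_n) :
  real_vec R (x *m w) = real_vec R x *m map_mx intr w.
Proof. exact: map_mxM. Qed.

Lemma real_vec_inj (R : realType) n : injective (@real_vec R n).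
Proof.
move=> x y /matrixP E; apply/matrixP => i j; have := E i j; rewrite !mxE; exact: intr_inj.
Qed.

Section ExpiPairing.
Variables (R : realType) (n : nat) (A A' S S' : 'M[int]_n) (G : 'M[R]_n) (N : nat).
Hypothesis N0 : (0 < N)%N.
Hypothesis GS : G *m (map_mx intr S)^T = 1%:M.
Hypothesis SG : map_mx intr S' *m G = 1%:M.
Hypothesis Grefl : forall i, map_mx intr (simple_reflection A' i) *m G =
  G *m (map_mx intr (simple_reflection A i))^T.
Implicit Types (x y b : 'rV[int]_n).

Definition expi_pairing y x : R[i] := expi (2 * pi / N%:R * bform G (real_vec R y) (real_vec R x)).

Lemma expi_pairing_add y1 y2 x : expi_pairing (y1 + y2) x = expi_pairing y1 x * expi_pairing y2 x.
Proof. by rewrite /expi_pairing -expiD -mulrDr /bform real_vecD !mulmxDl [X in _ * X]mxE. Qed.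

Lemma expi_pairing_char y : character (expi_pairing y).
Proof.
split=> [x|x1 x2]; first exact: expi_neq0.
by rewrite /expi_pairing -expiD -mulrDr /bform real_vecD linearD mulmxDr [X in _ * X]mxE.
Qed.

Lemma expi_pairing_refl i y x : expi_pairing (y *m simple_reflection A' i) x =
  expi_pairing y (x *m simple_reflection A i).
Proof.
congr (expi (_ * _)); rewrite /bform !real_vecM trmx_mul !mulmxA.
by rewrite -[_ *m G]mulmxA Grefl !mulmxA.
Qed.

Let N0' : N%:R != 0 :> R. Proof. by rewrite pnatr_eq0 -lt0n. Qed.

Lemma expi_pairing_per y b : row_span S b -> expi_pairing y (N%:Z *: b) = 1.
Proof.
move=> [q ->]; rewrite /expi_pairing /bform real_vecZ real_vecM linearZ /= -scalemxAr trmx_mul.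
rewrite mulmxA -[_ *m _ *m (map_mx _ S)^T]mulmxA GS mulmx1.
rewrite (_ : real_vec R y *m (real_vec R q)^T = map_mx intr (y *m q^T)); last first.
  by rewrite map_mxM map_trmx.
rewrite !mxE -(expi_int R (\sum_j y 0 j * q^T j 0)); congr expi.
by rewrite -!mulrA; congr (_ * (_ * _)); rewrite mulKf.
Qed.

Lemma expi_pairing_per' x b : row_span S' b -> expi_pairing (N%:Z *: b) x = 1.
Proof.
move=> [q ->]; rewrite /expi_pairing /bform real_vecZ real_vecM -!scalemxAl.
rewrite -[_ *m _ *m G]mulmxA SG mulmx1.
rewrite (_ : real_vec R q *m (real_vec R x)^T = map_mx intr (q *m x^T)); last first.
  by rewrite map_mxM map_trmx.
rewrite !mxE -(expi_int R (\sum_j q 0 j * x^T j 0)); congr expi.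
by rewrite -!mulrA; congr (_ * (_ * _)); rewrite mulKf.
Qed.

Let SG1 : (map_mx intr S)^T *m G = 1%:M. Proof. exact: mulmx1C. Qed.
Let GS1 : G *m map_mx intr S' = 1%:M. Proof. exact: mulmx1C. Qed.

Let real_vec_delta i : real_vec R (delta_mx 0 i : 'rV[int]_n) = delta_mx 0 i.
Proof. exact: map_delta_mx. Qed.

Let pairing_int p : expi (2 * pi / N%:R * p) = 1 :> R[i] -> exists z : int, p = N%:R * z%:~R.
Proof.
rewrite -mulrA => /expi_eq1 [z zE]; exists z; by rewrite -zE mulVKf.
Qed.

(** Testing on fundamental weights puts every entry of G x^T in N times the integers, and the
    transpose of [S] inverts [G]. *)
Lemma expi_pairing_nd x : (forall y, expi_pairing y x = 1) -> exists2 b, row_span S b & x = N%:Z *: b.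
Proof.
move=> h; have /boolp.choice [z zP] : forall i, exists z : int, (G *m (real_vec R x)^T) i 0 = N%:R * z%:~R.
  move=> i; have /pairing_int [z zE] := h (delta_mx 0 i); exists z.
  by rewrite -zE /bform real_vec_delta -mulmxA -rowE [RHS]mxE.
exists ((\row_i z i) *m S); first by exists (\row_i z i).
apply: (@real_vec_inj R); rewrite real_vecZ real_vecM; apply: trmx_inj.
rewrite linearZ /= trmx_mul -[LHS]mul1mx -SG1 -mulmxA scalemxAr; congr (_ *m _).
by apply/matrixP => i j; rewrite ord1 zP !mxE.
Qed.

Lemma expi_pairing_nd' y : (forall x, expi_pairing y x = 1) -> exists2 b, row_span S' b & y = N%:Z *: b.
Proof.
move=> h; have /boolp.choice [z zP] : forall i, exists z : int, (real_vec R y *m G) 0 i = N%:R * z%:~R.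
  move=> i; have /pairing_int [z zE] := h (delta_mx 0 i); exists z.
  by rewrite -zE /bform real_vec_delta trmx_delta -colE [RHS]mxE.
exists ((\row_i z i) *m S'); first by exists (\row_i z i).
apply: (@real_vec_inj R); rewrite real_vecZ real_vecM.
rewrite -[LHS]mulmx1 -GS1 mulmxA scalemxAl; congr (_ *m _).
by apply/matrixP => i j; rewrite ord1 zP !mxE.
Qed.

End ExpiPairing.

Section Alternant.
Variables (F : numFieldType) (n : nat) (A : 'M[int]_n) (d : 'I_n -> int) (m : int).
Variables (th et : 'rV[int]_n).
Hypothesis H : finite_type A d m th et.

(** Every word for [w] has the parity given by the determinant, and a minimal word exists, so
    [weyl_length] is not the default value. *)
Lemma weyl_length_sign w : weyl_group A w -> (-1) ^+ weyl_length A w = (\det w)%:~R :> F.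
Proof.
move=> [s _ sw]; pose P l := `[< exists2 s, size s = l & weyl_word A s = w >].
have Pex : exists l, P l by exists (size s); apply/asboolP; exists s.
have [l0 /asboolP [s0 s0l s0w] l0min] := ex_minnP Pex.
have : [set l | (exists2 s, size s = l & weyl_word A s = w) /\
    forall s, weyl_word A s = w -> (l <= size s)%N] (weyl_length A w).
  apply: xgetPex; exists l0; split; first by exists s0.
  by move=> s' s'w; apply: l0min; apply/asboolP; exists s'.
move=> [ [u <- <-] _]; elim: u => [|i u IH]; first by rewrite weyl_word_nil det1.
rewrite weyl_word_cons det_mulmx det_simple_reflection; last exact: ft_diag H.
by rewrite exprS IH rmorphM rmorphN.
Qed.
End Alternant.

Lemma alternantE (R : realType) X d m th et (H : finite_type (finite_cartan X) d m th et)
    (lam : 'rV[int]_(affine_rank X)) (t : _ -> R[i]) :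
  alternant lam t = weyl_alt (finite_cartan X) t (lam + rho _).
Proof.
have Wf := weyl_finite (ft_high H) (ft_diag H).
rewrite /alternant fsbig_finite // /weyl_alt big_seq [RHS]big_seq; apply: eq_bigr => w Ww.
by rewrite (weyl_length_sign _ H) //; apply/(mem_weyl_seq (ft_high H) (ft_diag H)).
Qed.

(** * Highest roots of the affine types *)

Section HighestRoot.
Variables (n : nat) (A : 'M[int]_n) (d : 'I_n -> int) (m : int) (th et : 'rV[int]_n).
Hypothesis H : finite_type A d m th et.
Let hth := ft_high H.
Let A2 := ft_diag H.

(* [q] is the coroot of the long root [c]; the highest root pairs with it to at
   least 2, so by Cauchy-Schwarz it is [c]. *)
Lemma highest_root_eq (c q : 'rV[int]_n) : (forall i, c 0 i * d i = m * q 0 i) ->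
  dominant (root_lattice A c) -> \sum_j c 0 j * d j * root_lattice A c 0 j = 2 * m ->
  th = c /\ forall i w, weyl_group A w -> root_lattice A th = simple_root A i *m w -> d i = m.
Proof.
move=> cq cd cn; have m0 := ft_m H; have d0 := d_gt0 H.
have qE j : m * root_lattice A^T q 0 j = d j * root_lattice A c 0 j.
  rewrite !root_lattice_coord !mulr_sumr; apply: eq_bigr => i _; rewrite mxE.
  by rewrite mulrCA -cq mulrA (ft_sym H) mulrCA mulrC; ring.
have qd : dominant (root_lattice A^T q).
  move=> j; have : 0 <= m * root_lattice A^T q 0 j by rewrite qE mulr_ge0 // ltW.
  by rewrite pmulr_rge0.
have q0 : q != 0.
  apply/eqP => q0; move: cn; rewrite big1; first by lia.
  by move=> j _; rewrite cq q0 row0E mulr0 mul0r.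
have q2 := cohighest_level_ge2 (finite_type_tr H) qd q0.
have key i w : weyl_group A w -> root_lattice A th = simple_root A i *m w -> c = th /\ d i = m.
  move=> Ww thE; have gi := g_gt0 hth A2 i.
  pose X := gf A (root_lattice A c) (root_lattice A c).
  pose Y := gf A (root_lattice A c) (root_lattice A th).
  have Z : gf A (root_lattice A th) (root_lattice A th) = g A i by rewrite thE (gf_weyl hth A2).
  have XE : X * d i = g A i * m.
    apply: (mulfI (_ : (2 : int) != 0)) => //; rewrite mulrA (gf_root hth A2) mulr_suml mulrCA -cn mulr_sumr.
    apply: eq_bigr => j _.
    have -> : c 0 j * root_lattice A c 0 j * g A j * d i = c 0 j * root_lattice A c 0 j * (g A j * d i) by ring.
    by rewrite (g_proportional H); ring.
  have YE : Y * d i >= g A i * m.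
    have : 2 * Y * d i = g A i * (m * \sum_j th 0 j * root_lattice A^T q 0 j).
      rewrite (gf_root hth A2) mulr_suml !mulr_sumr; apply: eq_bigr => j _.
      have -> : th 0 j * root_lattice A c 0 j * g A j * d i = th 0 j * root_lattice A c 0 j * (g A j * d i) by ring.
      by rewrite (g_proportional H) [m * _]mulrCA qE; ring.
    have : g A i * m * 2 <= g A i * m * (\sum_j th 0 j * root_lattice A^T q 0 j).
      by rewrite ler_pM2l // mulr_gt0.
    set Sg := \sum_j _; rewrite -mulrA; lia.
  have dm : g A i * d i <= g A i * m.
    by rewrite ler_pM2l //; case: (ft_len H i) => ->; lia.
  have nE : gf A (root_lattice A (c - th)) (root_lattice A (c - th)) = X - 2 * Y + g A i.
    by rewrite root_latticeB !gfBl !gfBr Z (gfC A (root_lattice A th)) -/X -/Y; ring.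
  (* With X d = g m, Y d >= g m and d <= m, the norm X - 2Y + g multiplied by d is at most 0. *)
  have n0 : gf A (root_lattice A (c - th)) (root_lattice A (c - th)) = 0.
    have n1 := gf_ge0 A (root_lattice A (c - th)).
    have n2 : gf A (root_lattice A (c - th)) (root_lattice A (c - th)) * d i <= 0.
      by rewrite nE mulrDl mulrBl -mulrA XE; lia.
    by apply/eqP; rewrite eq_le n1 andbT; move: n2; rewrite pmulr_lle0.
  have cth : c = th.
    have /(gf_eq0 hth A2) E := n0.
    have /(root_lattice_inj hth)/eqP : root_lattice A (c - th) = root_lattice A 0.
      by rewrite E root_lattice0.
    by rewrite subr_eq0 => /eqP.
  split=> //; apply: (mulfI (lt0r_neq0 gi)); rewrite -XE /X cth Z //.
have [i [w Ww [thE _] ] ] := highest_connected hth A2.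
by split=> [|i' w' Ww' /(key i' w' Ww') []//]; have [-> _] := key i w Ww thE.
Qed.

End HighestRoot.

(** * The Gram matrix of the normalized form *)

Section Gram.
Variables (R : realType) (n : nat) (A : 'M[int]_n) (d : 'I_n -> int) (m : int).
Variables (th et : 'rV[int]_n).
Hypothesis H : finite_type A d m th et.
Variable G : 'M[R]_n.
Hypothesis Gsym : G^T = G.
Hypothesis Ginv : forall w, weyl_group A w -> forall x y : 'rV[R]_n,
  bform G (x *m map_mx intr w) (y *m map_mx intr w) = bform G x y.
Variables (e : int) (S : 'M[int]_n).
Hypothesis Gth : bform G (real_vec R (root_lattice A th)) (real_vec R (root_lattice A th)) = 2 * e%:~R.
Hypothesis long : forall i w, weyl_group A w -> root_lattice A th = simple_root A i *m w -> d i = m.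
Hypothesis e0 : 0 < e.
Hypothesis SE : forall i j, e * d i * S i j = m * A j i.
Let hth := ft_high H.
Let A2 := ft_diag H.
Let al i := real_vec R (simple_root A i).
Implicit Types x y : 'rV[R]_n.

Let bformC x y : bform G x y = bform G y x.
Proof.
have E : y *m G *m x^T = (x *m G *m y^T)^T by rewrite !trmx_mul trmxK Gsym mulmxA.
by rewrite /bform E [RHS]mxE.
Qed.

Let bformDl x y z : bform G (x + y) z = bform G x z + bform G y z.
Proof. by rewrite /bform !mulmxDl [LHS]mxE. Qed.

Let bformZl (k : R) x z : bform G (k *: x) z = k * bform G x z.
Proof. by rewrite /bform -!scalemxAl [LHS]mxE. Qed.

Let bformZr (k : R) x z : bform G z (k *: x) = k * bform G z x.
Proof. by rewrite bformC bformZl bformC. Qed.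

Let form_simple i x : 2 * bform G x (al i) = x 0 i * bform G (al i) (al i).
Proof.
have := Ginv (weyl_group_reflection A i) x (al i).
have -> : al i *m map_mx intr (simple_reflection A i) = (-1) *: al i.
  by rewrite /al -real_vecM simple_root_reflection // -scaleN1r real_vecZ rmorphN.
have -> : x *m map_mx intr (simple_reflection A i) = x + (- x 0 i) *: al i.
  rewrite /simple_reflection map_mxB map_mx1 map_mxM map_delta_mx mulmxBr mulmx1 mulmxA -colE.
  congr (_ + _); apply/rowP => j; rewrite !mxE big_ord1 !mxE; ring.
rewrite bformZr bformDl bformZl; lra.
Qed.

Let r i : R := bform G (al i) (al i) / 2.

Let form_simpleE i x : bform G x (al i) = x 0 i * r i.
Proof. by rewrite /r; have := form_simple i x; lra. Qed.

(** The normalization fixes the norm of a simple root conjugate to theta, which is long; symmetry of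
    the form carries the ratio along the connected diagram. *)
Let rE j : r j * m%:~R = e%:~R * (d j)%:~R.
Proof.
have [i [w Ww [thE conn] ] ] := highest_connected hth A2.
have ri : r i = e%:~R.
  by have := Gth; rewrite thE real_vecM Ginv // /r -/(al i); lra.
rewrite -ri -(long Ww thE); apply: (conn (fun j => r j * (d i)%:~R = r i * (d j)%:~R)) => // l j' rl Ajl.
have rs : (A l j')%:~R * r l = (A j' l)%:~R * r j'.
  by have := bformC (al j') (al l); rewrite !form_simpleE /al !mxE => ->.
have ds : (d l)%:~R * (A l j')%:~R = (d j')%:~R * (A j' l)%:~R :> R.
  by rewrite -!rmorphM (ft_sym H).
have nz : (A j' l)%:~R != 0 :> R by rewrite intr_eq0.
apply: (mulfI nz); rewrite mulrA -rs mulrAC -mulrA -/(r i).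
rewrite [_ * r l]mulrC rl; have -> : (A l j')%:~R * (r i * (d l)%:~R) = r i * ((d l)%:~R * (A l j')%:~R) by ring.
by rewrite ds; ring.
Qed.

Lemma gram_span : G *m (map_mx intr S)^T = 1%:M.
Proof.
apply/matrixP => j i.
have nz : (e * d i)%:~R != 0 :> R by rewrite intr_eq0 lt0r_neq0 // mulr_gt0 // (d_gt0 H).
apply: (mulfI nz).
have -> : (G *m (map_mx intr S)^T) j i = bform G (delta_mx 0 j) (row i (map_mx intr S)).
  rewrite /bform -mulmxA -rowE [RHS]mxE [LHS]mxE [RHS]mxE; apply: eq_bigr => k _.
  by congr (_ * _); rewrite !mxE.
rewrite -bformZr (_ : _ *: row i _ = m%:~R *: al i); last first.
  by apply/rowP => j'; rewrite !mxE -!rmorphM SE.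
rewrite bformZr form_simpleE !mxE eqxx andTb [i == j]eq_sym.
case: (j =P i) => _; last by rewrite mul0r !mulr0.
by rewrite mul1r mulr1 mulrC rE -rmorphM.
Qed.

Lemma span_gram : map_mx intr S *m G = 1%:M.
Proof. by rewrite -[LHS]trmxK trmx_mul Gsym gram_span trmx1. Qed.

Let bformE (M : 'M[R]_n) a b : bform M (delta_mx 0 a) (delta_mx 0 b) = M a b.
Proof. by rewrite /bform -rowE trmx_delta -colE [LHS]mxE [LHS]mxE. Qed.

Lemma gram_reflection i : map_mx intr (simple_reflection A i) *m G =
  G *m (map_mx intr (simple_reflection A i))^T.
Proof.
set s := map_mx _ _; have ss : s *m s = 1%:M by rewrite -map_mxM simple_reflectionK // map_mx1.
have sGs : s *m G *m s^T = G.
  apply/matrixP => a b; have := Ginv (weyl_group_reflection A i) (delta_mx 0 a) (delta_mx 0 b).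
  rewrite -/s; have -> : bform G (delta_mx 0 a *m s) (delta_mx 0 b *m s) =
      bform (s *m G *m s^T) (delta_mx 0 a) (delta_mx 0 b) by rewrite /bform trmx_mul !mulmxA.
  by rewrite !bformE.
by rewrite -[in RHS]sGs -!mulmxA -trmx_mul ss trmx1 mulmx1.
Qed.

End Gram.

(** * Certificates read off the Dynkin diagrams *)

Definition sumz (T : Type) (f : T -> int) (s : seq T) : int := foldr (fun x acc => f x + acc) 0 s.

Definition swap_bond (b : bond) : bond := let: (u, v, p, q) := b in (u, v, q, p).

Definition bond_entries (bs : seq bond) (i j : nat) : int :=
  if i == j then 2 else - (sumn [seq bond_entry i j b | b <- bs])%:Z.

Definition bond_term (c : nat -> int) (j : nat) (b : bond) : int :=
  let: (u, v, p, q) := b in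
  (if u == j then p%:Z * c v else 0) + (if v == j then q%:Z * c u else 0).

Definition bond_row (bs : seq bond) (c : nat -> int) (j : nat) : int :=
  2 * c j - sumz (bond_term c j) bs.

Definition wf_bond (n : nat) (b : bond) : bool :=
  let: (u, v, _, _) := b in [&& u != v, (u <= n)%N & (v <= n)%N].

Lemma finite_cartanE X i j : finite_cartan X i j = bond_entries (affine_bonds X) i.+1 j.+1.
Proof. by rewrite !mxE. Qed.

Lemma sum_single n (v : nat) (K : int) : (v <= n)%N ->
  \sum_(i < n.+1) (if v == i then K else 0) = K.
Proof.
move=> vn; rewrite (bigD1 (Ordinal (vn : (v < n.+1)%N))) //= eqxx big1 ?addr0 // => i /eqP iv.
by case: eqP => // E; case: iv; apply: val_inj.
Qed.

(** The product of the Cartan matrix with [c], bond by bond. The value 0 at vertex 0 silences the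
    affine bonds, so the affine list serves for the finite matrix. *)
Lemma bond_row_sum bs n (c : nat -> int) j : all (wf_bond n) bs -> c 0%N = 0 -> (j <= n)%N ->
  \sum_(i < n) bond_entries bs j i.+1 * c i.+1 = bond_row bs c j.
Proof.
move=> wf c0 jn.
have -> : \sum_(i < n) bond_entries bs j i.+1 * c i.+1 = \sum_(i < n.+1) bond_entries bs j i * c i.
  by rewrite big_ord_recl c0 mulr0 add0r.
rewrite /bond_row; elim: bs wf => [_|[ [ [u v] p] q] bs IH /= /andP [/and3P [uv un vn] wf] ].
  rewrite subr0 -[RHS](sum_single _ jn); apply: eq_bigr => i _.
  by rewrite /bond_entries; case: eqP => [->|_] //=; rewrite mul0r.
have E (i : 'I_n.+1) : bond_entries ((u, v, p, q) :: bs) j i * c i = bond_entries bs j i * c i -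
   ((if v == i then (if u == j then p%:Z * c v else 0) else 0) +
    (if u == i then (if v == j then q%:Z * c u else 0) else 0)).
  rewrite /bond_entries /=; case: (j =P i) => [ji|ji].
    rewrite -ji; case: (v =P j) => [vj|_]; case: (u =P j) => [uj|_]; try ring.
    by move: uv; rewrite uj vj eqxx.
  case: (u =P j) => [uj|_]; case: (v =P i) => [vi|_] /=; case: (u =P i) => [ui|_];
    case: (v =P j) => [vj|_] /=; rewrite ?PoszD; subst => //; try (by case: ji); try ring.
rewrite (eq_bigr _ (fun i _ => E i)) sumrB IH // big_split /= !sum_single //; ring.
Qed.

Lemma bond_entries_swap bs n i j : all (wf_bond n) bs ->
  bond_entries (map swap_bond bs) i j = bond_entries bs j i.
Proof.
move=> wf; rewrite /bond_entries eq_sym; case: eqP => // ji; congr (- _%:Z).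
elim: bs wf => // [ [ [ [u v] p] q] bs IH] /= /andP [/and3P [uv _ _] wf]; rewrite IH //; congr (_ + _)%N.
case: (u =P i) => [ui|_]; case: (v =P j) => [vj|_] //=; case: (u =P j) => [uj|_]; case: (v =P i) => [vi|_] //=.
all: by subst; rewrite ?eqxx in uv; case: ji.
Qed.

Lemma bond_entries_sym bs n (d : nat -> int) i j : all (wf_bond n) bs -> (0 < i)%N -> (0 < j)%N ->
  all (fun b : bond => let: (u, v, p, q) := b in (0 < u)%N ==> (0 < v)%N ==> (d u * p%:Z == d v * q%:Z)) bs ->
  d i * bond_entries bs i j = d j * bond_entries bs j i.
Proof.
move=> wf i0 j0; rewrite /bond_entries eq_sym; case: (j =P i) => [->//|ji].
elim: bs wf => [|[ [ [u v] p] q] bs IH] /=; first by move=> _ _; rewrite oppr0 !mulr0.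
move=> /andP [/and3P [uv _ _] wf] /andP [sym syms]; rewrite !PoszD !opprD !mulrDr IH //; congr (_ + _).
move: sym; case: (u =P i) => [ui|_]; case: (v =P j) => [vj|_] //=; case: (u =P j) => [uj|_]; 
  case: (v =P i) => [vi|_] //=; rewrite ?oppr0 ?mulr0 //; subst; rewrite ?i0 ?j0 /=; try (by case: ji).
all: by move=> /eqP E; rewrite !mulrN E.
Qed.

(* [c] is the candidate for the highest root, [q] its coroot, and [lw] lists
   the nonzero coordinates of [c] in the fundamental weights. *)
Record root_checks (bs : seq bond) (n : nat) (m : int) (d c q : nat -> int)
    (lw : seq (nat * int)) : Prop := RootChecks {
  rc_wf : all (wf_bond n) bs;
  rc_m : 0 < m;
  rc_d : all (fun j => (d j == 1) || (d j == m)) (iota 1 n);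
  rc_sym : all (fun b : bond => let: (u, v, p, q) := b in
    (0 < u)%N ==> (0 < v)%N ==> (d u * p%:Z == d v * q%:Z)) bs;
  rc_c0 : c 0%N == 0;
  rc_q : all (fun j => c j * d j == m * q j) (iota 1 n);
  rc_lw : all (fun p : nat * int => [&& (0 < p.1)%N, (p.1 <= n)%N & 0 <= p.2]) lw;
  rc_row : all (fun j => bond_row bs c j == sumz (fun p : nat * int => if p.1 == j then p.2 else 0) lw) (iota 1 n);
  rc_norm : sumz (fun p : nat * int => p.2 * (c p.1 * d p.1)) lw == 2 * m
}.

Section Checks.
Variables (bs : seq bond) (n : nat) (m : int) (d c q : nat -> int) (lw : seq (nat * int)).
Hypothesis rc : root_checks bs n m d c q lw.
Variable A : 'M[int]_n.
Hypothesis AE : forall i j, A i j = bond_entries bs i.+1 j.+1.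

Let iotaP (P : pred nat) : all P (iota 1 n) -> forall i : 'I_n, P i.+1.
Proof. by move=> /allP h i; apply: h; rewrite mem_iota add1n ltnS /=; exact: ltn_ord. Qed.

Lemma checks_finite_type th et : is_highest_root A th -> is_highest_root A^T et ->
  finite_type A (fun i => d i.+1) m th et.
Proof.
move=> hth het; split=> //.
- by move=> i; rewrite AE /bond_entries eqxx.
- move=> i j ij; rewrite AE /bond_entries eqSS -[(i == j :> nat)]/(i == j) (negbTE ij).
  by rewrite oppr_le0.
- exact: rc_m rc.
- by move=> i; case/orP: (iotaP (rc_d rc) i) => /eqP ->; [left|right].
- by move=> i j; rewrite !AE; exact: bond_entries_sym (rc_wf rc) _ _ (rc_sym rc).
Qed.

Lemma checks_highest th et : finite_type A (fun i => d i.+1) m th et ->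
  [/\ forall i, th 0 i = c i.+1, forall i, th 0 i * d i.+1 = m * q i.+1 &
  forall i w, weyl_group A w -> root_lattice A th = simple_root A i *m w -> d i.+1 = m].
Proof.
move=> H; pose c' : 'rV[int]_n := \row_i c i.+1; pose q' : 'rV[int]_n := \row_i q i.+1.
have cq i : c' 0 i * d i.+1 = m * q' 0 i by rewrite !mxE; apply/eqP/(iotaP (rc_q rc) i).
pose L j := sumz (fun p : nat * int => if p.1 == j then p.2 else 0) lw.
have cL j : root_lattice A c' 0 j = L j.+1.
  rewrite root_lattice_coord /L -[RHS](eqP (iotaP (rc_row rc) j)).
  rewrite -(bond_row_sum (rc_wf rc) (eqP (rc_c0 rc)) (ltn_ord j)).
  by apply: eq_bigr => i _; rewrite AE mxE.
have lwP := rc_lw rc.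
have L0 j : 0 <= L j.
  rewrite /L; elim: (lw) lwP => //= p l IH /andP [/and3P [_ _ p0] lP].
  by rewrite addr_ge0 ?IH //; case: ifP.
have nE : \sum_j c' 0 j * d j.+1 * L j.+1 = 2 * m.
  rewrite -(eqP (rc_norm rc)) /L; elim: (lw) lwP => [_|p l IH /= /andP [/and3P [p1 pn _] lP] ] /=.
    by rewrite big1 // => j _; rewrite mulr0.
  under eq_bigr => j _ do rewrite mulrDr.
  rewrite big_split /= IH //; congr (_ + _).
  case: p p1 pn => [ [//|k] v] /= _ kn; rewrite (bigD1 (Ordinal kn)) //= eqxx mxE big1 ?addr0.
    by rewrite mulrC.
  move=> j /eqP jk; case: eqP => [ [E]|_]; last by rewrite mulr0.
  by case: jk; apply: val_inj.
have [||th_c long] := highest_root_eq H cq.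
- by move=> j; rewrite cL.
- by rewrite -nE; apply: eq_bigr => j _; rewrite cL.
split=> // i; first by rewrite th_c mxE.
by rewrite th_c cq mxE.
Qed.

End Checks.

Ltac split_ifs := repeat (case: ifP => ?; try (exfalso; lia)).

Lemma sumz_chain c j i l : sumz (bond_term c j) (chain i l) =
  (if (i <= j < i + l)%N then c j.+1 else 0) + (if (i < j <= i + l)%N then c j.-1 else 0).
Proof.
elim: l i => [|l IH] i; first by rewrite addn0 /=; do 2!(case: ifP => [|_]; first by lia).
rewrite /chain /= -/(chain i.+1 l) IH !mul1r.
case: (i =P j) => [E|ij]; case: (i.+1 =P j) => [E'|ij']; try subst j;
  try (exfalso; lia); split_ifs; rewrite /= ?addr0 ?add0r // addrC //.
Qed.

Lemma all_chain (P : pred bond) i l : (forall j, (i <= j < i + l)%N -> P (j, j.+1, 1, 1)%N) -> all P (chain i l).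
Proof. by move=> h; apply/allP => b /mapP [j]; rewrite mem_iota => /h hj ->. Qed.

Lemma swap_chain i l : map swap_bond (chain i l) = chain i l.
Proof. by rewrite /chain -map_comp; apply: eq_map. Qed.

(** Labels of the infinite families are constant up to a few vertices: [s] everywhere, minus the
    corrections in [l], and 0 at vertex 0. *)
Definition labels (s : int) (l : seq (nat * int)) (j : nat) : int :=
  if j == 0%N then 0 else s - sumz (fun p => if p.1 == j then p.2 else 0) l.

Lemma sum_labels n s l : all (fun p : nat * int => (0 < p.1 <= n)%N) l ->
  \sum_(i < n) labels s l i.+1 = s * n%:Z - sumz (fun p => p.2) l.
Proof.
move=> lP; rewrite /labels sumrB sumr_const card_ord -mulr_natr natz; congr (_ - _).
elim: l lP => [|[ [//|k] v] l IH] /= => [_|/andP [kn lP] ]; first by rewrite big1.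
rewrite big_split /= IH //; congr (_ + _).
rewrite (bigD1 (Ordinal kn)) //= eqxx big1 ?addr0 // => j /eqP jk.
by case: eqP => [ [E]|//]; case: jk; apply: val_inj.
Qed.

Ltac check_classical :=
  split; rewrite /= ?all_cat /=;
  repeat match goal with
  | |- is_true (_ && _) => apply/andP; split
  | |- is_true (all _ (chain _ _)) => apply: all_chain => ? ?
  | |- is_true (all _ (iota _ _)) => apply/allP => j; rewrite mem_iota => ?
  end;
  rewrite /bond_row /labels /= ?sumz_chain /=; try lia;
  split_ifs; try lia.

Lemma checks_B1 n : (3 <= n)%N -> root_checks (affine_bonds (Aff_B1 n)) n 2
  (labels 2 [:: (n, 1)]) (labels 2 [:: (1%N, 1)]) (labels 2 [:: (1%N, 1); (n, 1)]) [:: (2%N, 1)].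
Proof. move=> n3; check_classical. Qed.

Lemma checks_C1 n : (2 <= n)%N -> root_checks (affine_bonds (Aff_C1 n)) n 2
  (labels 1 [:: (n, -1)]) (labels 2 [:: (n, 1)]) (labels 1 [::]) [:: (1%N, 2)].
Proof. move=> n2; check_classical. Qed.

Lemma checks_A2_even n : (2 <= n)%N -> root_checks (affine_bonds (Aff_A2_even n)) n 2
  (labels 1 [:: (n, -1)]) (labels 2 [:: (n, 1)]) (labels 1 [::]) [:: (1%N, 2)].
Proof. move=> n2; check_classical. Qed.

Lemma checks_A2_odd n : (3 <= n)%N -> root_checks (affine_bonds (Aff_A2_odd n)) n 2
  (labels 1 [:: (n, -1)]) (labels 2 [:: (n, 1)]) (labels 1 [::]) [:: (1%N, 2)].
Proof. move=> n3; check_classical. Qed.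

Lemma checks_A2_odd_swap n : (3 <= n)%N -> root_checks (map swap_bond (affine_bonds (Aff_A2_odd n))) n 2
  (labels 2 [:: (n, 1)]) (labels 2 [:: (1%N, 1)]) (labels 2 [:: (1%N, 1); (n, 1)]) [:: (2%N, 1)].
Proof. move=> n3; rewrite /= swap_chain; check_classical. Qed.

Lemma checks_D2 n : (3 <= n)%N -> root_checks (affine_bonds (Aff_D2 n)) n 2
  (labels 2 [:: (n, 1)]) (labels 2 [:: (1%N, 1)]) (labels 2 [:: (1%N, 1); (n, 1)]) [:: (2%N, 1)].
Proof. move=> n3; check_classical. Qed.

Lemma checks_D2_swap n : (3 <= n)%N -> root_checks (map swap_bond (affine_bonds (Aff_D2 n))) n 2
  (labels 1 [:: (n, -1)]) (labels 2 [:: (n, 1)]) (labels 1 [::]) [:: (1%N, 2)].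
Proof. move=> n3; rewrite /= swap_chain; check_classical. Qed.

Lemma checks_D1 n : (4 <= n)%N -> root_checks (affine_bonds (Aff_D1 n)) n 1
  (labels 1 [::]) (labels 2 [:: (1%N, 1); ((n - 1)%N, 1); (n, 1)])
  (labels 2 [:: (1%N, 1); ((n - 1)%N, 1); (n, 1)]) [:: (2%N, 1)].
Proof. move=> n4; check_classical. Qed.

Lemma checks_A1 n : (1 <= n)%N -> root_checks (affine_bonds (Aff_A1 n)) n 1
  (labels 1 [::]) (labels 1 [::]) (labels 1 [::]) [:: (1%N, 1); (n, 1)].
Proof.
(* For n = 1 the diagram is not a cycle, and both listed weights sit at vertex 1, where they add up
   to 2. *)
move=> n1; rewrite /=; case: (n =P 1%N) => [->|n1']; last by check_classical.
by split; vm_compute.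
Qed.

Definition list_labels (s : seq nat) (j : nat) : int := if j is j'.+1 then (nth 0%N s j')%:Z else 0.

Lemma even_bond_entries bs i j : all (fun b => ~~ odd (bond_entry i j b)) bs ->
  exists s : int, bond_entries bs i j = 2 * s.
Proof.
move=> h; rewrite /bond_entries; case: eqP => _; first by exists 1.
have [k ->] : exists k, sumn [seq bond_entry i j b | b <- bs] = (2 * k)%N; last by exists (- k%:Z); lia.
elim: bs h => [_|b bs IH /= /andP [be /IH [k ->] ] ]; first by exists 0%N.
by exists ((bond_entry i j b)./2 + k)%N; lia.
Qed.

(** [e] is half the norm of theta. The equations say that rho has level h - 1 and that the simple
    coroots, seen through the form, are integral weights. *)
Definition form_data (X : affine_type) (m : int) (d q : nat -> int) : Prop :=
  exists e : int, [/\ 0 < e, (theta_norm X)%:Z = 2 * e,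
    e * \sum_(i < affine_rank X) q i.+1 = (dual_coxeter X)%:Z - 1 &
    forall i j : 'I_(affine_rank X), exists s, e * d i.+1 * s = m * finite_cartan X j i].

Lemma form_data1 X m d c q lw : root_checks (affine_bonds X) (affine_rank X) m d c q lw ->
  theta_norm X = 2%N -> \sum_(i < affine_rank X) q i.+1 = (dual_coxeter X)%:Z - 1 -> form_data X m d q.
Proof.
move=> rc t2 qs; exists 1; rewrite t2 !mul1r; split=> // i j.
have hi : i.+1 \in iota 1 (affine_rank X) by rewrite mem_iota add1n ltnS /=; exact: ltn_ord.
have /orP [] := allP (rc_d rc) _ hi => /eqP ->.
  by exists (m * finite_cartan X j i); rewrite !mul1r.
by exists (finite_cartan X j i); rewrite mul1r.
Qed.

Lemma type_dataP X : admissible X -> exists m d c q lw,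
  [/\ root_checks (affine_bonds X) (affine_rank X) m d c q lw,
  form_case X -> form_data X m d q &
  ~~ form_case X -> exists m' d' c' q' lw',
    [/\ root_checks (map swap_bond (affine_bonds X)) (affine_rank X) m' d' c' q' lw',
    \sum_(i < affine_rank X) c i.+1 = (dual_coxeter X)%:Z - 1 &
    \sum_(i < affine_rank X) c' i.+1 = (dual_coxeter X)%:Z - 1] ].
Proof.
case: X => [n|n|n|n||||||n|n|n||] /= Xa.
- have rc := checks_A1 Xa; do 5!eexists; split; [exact: rc|move=> _|by [] ].
  by apply: (form_data1 rc) => //; rewrite sum_labels //=; lia.
- have rc := checks_B1 Xa; do 5!eexists; split; [exact: rc|move=> _|by [] ].
  by apply: (form_data1 rc) => //; rewrite sum_labels /=; lia.
- have rc := checks_C1 Xa; do 5!eexists; split; [exact: rc|move=> _|by [] ].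
  by apply: (form_data1 rc) => //; rewrite sum_labels //=; lia.
- have rc := checks_D1 Xa; do 5!eexists; split; [exact: rc|move=> _|by [] ].
  by apply: (form_data1 rc) => //; rewrite sum_labels /=; lia.
- have rc : root_checks (affine_bonds Aff_E61) 6 1 (fun=> 1) (list_labels [:: 1; 2; 3; 2; 1; 2]%N)
    (list_labels [:: 1; 2; 3; 2; 1; 2]%N) [:: (6%N, 1)] by split; vm_compute.
  do 5!eexists; split; [exact: rc|move=> _|by [] ].
  by apply: (form_data1 rc) => //; rewrite !big_ord_recl big_ord0.
- have rc : root_checks (affine_bonds Aff_E71) 7 1 (fun=> 1) (list_labels [:: 2; 3; 4; 3; 2; 1; 2]%N)
    (list_labels [:: 2; 3; 4; 3; 2; 1; 2]%N) [:: (1%N, 1)] by split; vm_compute.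
  do 5!eexists; split; [exact: rc|move=> _|by [] ].
  by apply: (form_data1 rc) => //; rewrite !big_ord_recl big_ord0.
- have rc : root_checks (affine_bonds Aff_E81) 8 1 (fun=> 1) (list_labels [:: 2; 3; 4; 5; 6; 4; 2; 3]%N)
    (list_labels [:: 2; 3; 4; 5; 6; 4; 2; 3]%N) [:: (1%N, 1)] by split; vm_compute.
  do 5!eexists; split; [exact: rc|move=> _|by [] ].
  by apply: (form_data1 rc) => //; rewrite !big_ord_recl big_ord0.
- have rc : root_checks (affine_bonds Aff_F41) 4 2 (list_labels [:: 2; 2; 1; 1]%N)
    (list_labels [:: 2; 3; 4; 2]%N) (list_labels [:: 2; 3; 2; 1]%N) [:: (1%N, 1)] by split; vm_compute.
  do 5!eexists; split; [exact: rc|move=> _|by [] ].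
  by apply: (form_data1 rc) => //; rewrite !big_ord_recl big_ord0.
- have rc : root_checks (affine_bonds Aff_G21) 2 3 (list_labels [:: 3; 1]%N)
    (list_labels [:: 2; 3]%N) (list_labels [:: 2; 1]%N) [:: (1%N, 1)] by split; vm_compute.
  do 5!eexists; split; [exact: rc|move=> _|by [] ].
  by apply: (form_data1 rc) => //; rewrite !big_ord_recl big_ord0.
- have rc := checks_A2_even Xa; do 5!eexists; split; [exact: rc|move=> _|by [] ].
  exists 2; split=> //; first by rewrite sum_labels //=; lia.
  move=> i j; rewrite finite_cartanE /labels /= addr0.
  case: eqP => [ni|_]; last by exists (bond_entries (affine_bonds (Aff_A2_even n)) j.+1 i.+1); ring.
  (* Here e = m = 2, so at the long root [n] integrality requires an even Cartan column; its only
     off-diagonal entry is -2. *)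
  have [|s ->] := @even_bond_entries (affine_bonds (Aff_A2_even n)) j.+1 i.+1; last by exists s; ring.
  rewrite -ni /=; apply/and3P; split; [split_ifs => //; lia|split_ifs => //; lia|].
  by apply: all_chain => l ll /=; split_ifs => //; lia.
- have rc := checks_A2_odd Xa; have rc' := checks_A2_odd_swap Xa.
  do 5!eexists; split; [exact: rc|by []|move=> _]; do 5!eexists; split; first exact: rc'.
    by rewrite sum_labels /=; lia.
  by rewrite sum_labels /=; lia.
- have rc := checks_D2 Xa; have rc' := checks_D2_swap Xa.
  do 5!eexists; split; [exact: rc|by []|move=> _]; do 5!eexists; split; first exact: rc'.
    by rewrite sum_labels /=; lia.
  by rewrite sum_labels /=; lia.
- have rc : root_checks (affine_bonds Aff_E62) 4 2 (list_labels [:: 1; 1; 2; 2]%N)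
    (list_labels [:: 2; 4; 3; 2]%N) (list_labels [:: 1; 2; 3; 2]%N) [:: (4%N, 1)] by split; vm_compute.
  have rc' : root_checks (map swap_bond (affine_bonds Aff_E62)) 4 2 (list_labels [:: 2; 2; 1; 1]%N)
    (list_labels [:: 2; 3; 4; 2]%N) (list_labels [:: 2; 3; 2; 1]%N) [:: (1%N, 1)] by split; vm_compute.
  do 5!eexists; split; [exact: rc|by []|move=> _]; do 5!eexists; split; first exact: rc'.
    by rewrite !big_ord_recl big_ord0.
  by rewrite !big_ord_recl big_ord0.
- have rc : root_checks (affine_bonds Aff_D43) 2 3 (list_labels [:: 1; 3]%N)
    (list_labels [:: 3; 2]%N) (list_labels [:: 1; 2]%N) [:: (2%N, 1)] by split; vm_compute.
  have rc' : root_checks (map swap_bond (affine_bonds Aff_D43)) 2 3 (list_labels [:: 3; 1]%N)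
    (list_labels [:: 2; 3]%N) (list_labels [:: 2; 1]%N) [:: (1%N, 1)] by split; vm_compute.
  do 5!eexists; split; [exact: rc|by []|move=> _]; do 5!eexists; split; first exact: rc'.
    by rewrite !big_ord_recl big_ord0.
  by rewrite !big_ord_recl big_ord0.
Qed.

Lemma finite_level n (a : 'rV[int]_n) (k : nat) : (forall i, 0 < a 0 i) ->
  finite_set [set x : 'rV[int]_n | dominant x /\ lev a x <= k%:Z].
Proof.
move=> a0; pose g (M : 'rV['I_k.+1]_n) : 'rV[int]_n := map_mx (fun o : 'I_k.+1 => (o : nat)%:Z) M.
apply: (@sub_finite_set _ _ (g @` [set: 'rV['I_k.+1]_n])); last first.
  by apply: finite_image; exact: finite_finset.
move=> x [xd xk]; exists (\row_i inord (absz (x 0 i))) => //.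
apply/rowP => i; rewrite !mxE inordK ?gez0_abs //.
suff : x 0 i <= k%:Z by have := xd i; lia.
apply: le_trans xk; rewrite /lev (bigD1 i) //= -[leLHS]addr0; apply: lerD.
  by have := a0 i; have := xd i; nia.
by apply: sumr_ge0 => j _; rewrite mulr_ge0 // ltW.
Qed.

(** * Fusion coefficients *)

Section IrreducibleCharacter.
Variables (F : numFieldType) (n : nat) (A : 'M[int]_n) (g : lieAlgebra F).
Variables (d : 'I_n -> int) (m : int) (th et : 'rV[int]_n).
Hypothesis H : finite_type A d m th et.
Variables (e f : 'I_n -> g).
Hypothesis chev : chevalley_generators A e f.
Hypothesis simple : simple_lie g.

Lemma irrep_character dd (V : lie_rep g dd) lam P (Pu : P \in unitmx) (wt : 'I_dd -> 'rV[int]_n) (t : 'rV[int]_n -> F) :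
  is_irrep e f lam V -> diagonal_rep e f (conj_rep V Pu) wt -> dominant lam -> character t ->
  weyl_alt A t (rho n) * \sum_j t (wt j) = weyl_alt A t (lam + rho n).
Proof.
move=> irrV Vh lamd tc.
have [|L [uL Ld lamL Lc] ] := family_support H wt (L := [:: lam]).
  by move=> nu; rewrite inE => /eqP ->.
rewrite (weyl_alt_family H (fun w mu => mult_weyl H chev Vh mu) tc uL Ld Lc).
rewrite (bigD1_seq lam) //=; last by apply: lamL; rewrite inE.
rewrite (irrep_count H chev simple irrV Vh lamd) eqxx mul1r big_seq_cond big1 ?addr0 // => nu /andP [nuL nl].
by rewrite (irrep_count H chev simple irrV Vh (Ld nu nuL)) (negbTE nl) mul0r.
Qed.

Lemma sum_tensor_weight dl dm (wl : 'I_dl -> 'rV[int]_n) (wm : 'I_dm -> 'rV[int]_n) (t : 'rV[int]_n -> F) :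
  character t -> (\sum_i t (wl i)) * (\sum_j t (wm j)) = \sum_l t (tensor_weight wl wm l).
Proof.
move=> [_ tD]; rewrite mulr_suml; under eq_bigr => i _ do rewrite mulr_sumr.
rewrite pair_big /= (reindex (@mxtens_unindex dl dm)) /=; last first.
  by exists (@mxtens_index dl dm) => x _; [exact: mxtens_unindexK|exact: mxtens_indexK].
by apply: eq_bigr => l _; rewrite /tensor_weight tD.
Qed.

End IrreducibleCharacter.

(** * Transfer to the coefficients on [Sigma] *)

Section Assembly.
Variables (R : realType) (X : affine_type) (D : root_datum R X) (k : nat).
Let A := finite_cartan X.
Let n := affine_rank X.
Let N : nat := (k + dual_coxeter X)%N.
Variables (d : 'I_n -> int) (m : int).
Hypothesis H : finite_type A d m (theta D) (highest_coroot D).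
Variables (A' : 'M[int]_n) (d' : 'I_n -> int) (m' : int) (th' et' : 'rV[int]_n).
Hypothesis H' : finite_type A' d' m' th' et'.
Variables (S S' : 'M[int]_n) (a a' : 'rV[int]_n) (G : 'M[R]_n).
Hypothesis al : alcove A a (row_span S).
Hypothesis al' : alcove A' a' (row_span S').
Hypothesis GS : G *m (map_mx intr S)^T = 1%:M.
Hypothesis SG : map_mx intr S' *m G = 1%:M.
Hypothesis Grefl : forall i, map_mx intr (simple_reflection A' i) *m G =
  G *m (map_mx intr (simple_reflection A i))^T.
Hypothesis N0 : (0 < N)%N.
Hypothesis arho : lev a (rho n) = (dual_coxeter X)%:Z - 1.
Hypothesis levelE : forall x, level D x = (lev a x)%:~R.
Hypothesis SigmaP : forall y, alcove_point a' N%:Z y -> Sigma D k (expi_pairing G N y).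

Variable c : 'rV[int]_n -> 'rV[int]_n -> 'rV[int]_n -> R[i].
Hypothesis hc : fusion_coefficients D k c.

Let e := @expi_pairing R n G N.
Let NZ : 0 < N%:Z. Proof. by lia. Qed.
Let PL : seq 'rV[int]_n := finmap.enum_fset (fset_set (P_level D k)).

Let P_levelE x : P_level D k x <-> dominant x /\ lev a x <= k%:Z.
Proof. by rewrite /P_level /= levelE; split=> -[xd xk]; split=> //; move: xk; rewrite -(ler_int R). Qed.

Let finite_P_level : finite_set (P_level D k).
Proof.
apply: (@sub_finite_set _ _ _ _ (finite_level k (al_pos al))) => x /P_levelE //.
Qed.

Let PLP x : x \in PL <-> dominant x /\ lev a x <= k%:Z.
Proof.
rewrite -P_levelE /PL; split=> h.
  by have := in_fset_set finite_P_level x; rewrite h => /esym h'; rewrite -in_setE h'.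
by rewrite (in_fset_set finite_P_level) in_setE.
Qed.

Let PLu : uniq PL. Proof. exact: finmap.fset_uniq. Qed.
Let e_char := @expi_pairing_char R n G N.
Let e_add := @expi_pairing_add R n G N.
Let e_refl := expi_pairing_refl N Grefl.
Let e_per := expi_pairing_per N0 GS.
Let e_per' := expi_pairing_per' N0 SG.
Let e_nd := @expi_pairing_nd R n S G N N0 GS.
Let e_nd' := @expi_pairing_nd' R n S' G N N0 SG.
Let rhoN : lev a (rho n) < N%:Z. Proof. by rewrite arho /N; lia. Qed.
Let rhoE : lev a (rho n) = N%:Z - 1 - k%:Z. Proof. by rewrite arho /N; lia. Qed.

Let J0 := weyl_alt_rho_neq0 H al H' al' NZ e_char e_add e_refl e_nd e_nd' rhoN.

Let hrow lam mu : P_level D k lam -> P_level D k mu -> fusion_row A a' N%:Z e PL lam mu (c lam mu).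
Proof.
move=> hlam hmu y yp; have := hc hlam hmu (SigmaP yp).
rewrite fsbig_finite // /chi !(alternantE H) add0r /weyl_chi -/A -/n -/e => ->.
by apply: eq_bigr => z _; rewrite !(alternantE H) ?add0r.
Qed.

Lemma fusion_coefficient_int lam mu nu : P_level D k lam -> P_level D k mu -> P_level D k nu ->
  exists z : int, c lam mu nu = z%:~R.
Proof.
move=> hlam hmu /P_levelE/PLP nuL; have [lamd _] := iffLR (P_levelE lam) hlam.
exact: (fusion_integral H al H' al' NZ e_char e_add e_refl e_per e_per' e_nd e_nd' rhoN PLu PLP rhoE
  lamd (hrow hlam hmu) nuL).
Qed.

Lemma fusion_coefficient_hom lam mu nu : P_level D k lam -> P_level D k mu -> P_level D k nu ->
  level D (lam + mu + nu) <= (2 * k)%:R ->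
  forall (g : lieAlgebra R[i]) (ge gf : 'I_n -> g), simple_lie g -> chevalley_generators A ge gf ->
  forall dl dm dn (Vl : lie_rep g dl) (Vm : lie_rep g dm) (Vn : lie_rep g dn),
  is_irrep ge gf lam Vl -> is_irrep ge gf mu Vm -> is_irrep ge gf nu Vn ->
  c lam mu nu = (\dim (rep_hom Vn (tensor_rep Vl Vm)))%:R.
Proof.
move=> hlam hmu hnu hk g ge gf simple chev dl dm dn Vl Vm Vn irrl irrm irrn.
have [lamd _] := iffLR (P_levelE lam) hlam; have [mud _] := iffLR (P_levelE mu) hmu.
have [nud _] := iffLR (P_levelE nu) hnu; have nuL := iffRL (PLP nu) (iffLR (P_levelE nu) hnu).
have [Pl [Plu [wl [hl wlE] ] ] ] := irrep_diagonal chev irrl.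
have [Pm [Pmu [wm [hm wmE] ] ] ] := irrep_diagonal chev irrm.
(* The multiplicity is extended by 0 off the dominant weights, since [fusion_tensor] asks for its
   level bound at every weight with positive multiplicity. *)
have /boolp.choice [r rP] : forall x, exists r : nat, (dominant x ->
    [/\ r%:R = \sum_(w <- weyl_seq A) (\det w)%:~R *
      (mult (tensor_weight wl wm) (x + rho n - rho n *m w))%:R :> R[i],
    (0 < r)%N -> exists i j, x = wl i + wm j &
    forall dn (Vn : lie_rep g dn), is_irrep ge gf x Vn ->
      \dim (rep_hom Vn (tensor_rep Vl Vm)) = r]) /\ (~ dominant x -> r = 0%N).
  move=> x; have [xd|xn] := pselect (dominant x); last by exists 0%N.
  by have [r hr] := tensor_count H chev simple irrl irrm hl hm xd; exists r.
have [/(_ nud) [_ _ /(_ _ _ irrn) ->] _] := rP nu.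
have Th := tensor_diagonal hl hm.
have [|L [uL Ld nuLL Lc] ] := family_support H (tensor_weight wl wm) (L := [:: nu]).
  by move=> x; rewrite inE => /eqP ->.
apply: (fusion_tensor H al H' al' NZ e_char e_add e_refl e_per e_per' e_nd e_nd' rhoN PLu PLP rhoE
  (hrow hlam hmu) uL Ld _ _ nuL).
- move=> x r0; have [xd|xn] := pselect (dominant x); last first.
    by have [_ /(_ xn) r00] := rP x; rewrite r00 in r0.
  have [/(_ xd) [_ /(_ r0) [i [j ->] ] _] _] := rP x.
  have [b b0 ->] := wlE i; have [b' b'0 ->] := wmE j.
  have := lev_root_lattice_ge0 al NZ b0; have := lev_root_lattice_ge0 al NZ b'0.
  rewrite !levD !levN; lia.
- move=> y yp; have ec := e_char y; have J0y := J0 yp.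
  rewrite /weyl_chi -(irrep_character H chev simple irrl hl lamd ec).
  rewrite -(irrep_character H chev simple irrm hm mud ec).
  rewrite ![_ * (\sum_ _ _) / _]mulrAC divff // !mul1r (sum_tensor_weight wl wm ec) mulrC.
  rewrite (weyl_alt_family H (fun w mu => mult_weyl H chev Th mu) ec uL Ld Lc).
  rewrite big_seq [RHS]big_seq; apply: eq_bigr => x xL.
  by have [/(_ (Ld x xL)) [-> _ _] _] := rP x.
- by apply: nuLL; rewrite inE.
by move: hk; rewrite levelE -[(2 * k)%:R]/((2 * k)%N%:Z%:~R) ler_int PoszM.
Qed.

End Assembly.

Lemma dual_coxeter_gt0 X : admissible X -> (0 < dual_coxeter X)%N.
Proof. by case: X => //= n; lia. Qed.

(** As rho has level h - 1, a level below k + h, that is at most k + h - 1, becomes at most k after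
    subtracting rho. *)
Lemma alcove_point_rho n (a y : 'rV[int]_n) (N h k : int) : lev a (rho n) = h - 1 -> N = k + h ->
  alcove_point a N y -> dominant (y - rho n) /\ lev a (y - rho n) <= k.
Proof.
move=> ar NE [ys yN]; split; last by rewrite levB ar; lia.
by move=> i; have := ys i; rewrite !rowE_ [rho n _ _]mxE; lia.
Qed.

(* In both cases the points of [Sigma] are [expi (2 pi y G x^T / (k + h))] for [y]
   in the interior of an alcove: [G] is the Gram matrix of the form, with dual
   system [A' = A], or the inverse Cartan matrix, with [A' = A^T]. *)
Lemma assembly_data (R : realType) X (D : root_datum R X) (k : nat) : admissible X ->
  exists d m, finite_type (finite_cartan X) d m (theta D) (highest_coroot D) /\
  exists A' d' m' th' et' S S' a a' (G : 'M[R]_(affine_rank X)),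
  [/\ finite_type A' d' m' th' et', alcove (finite_cartan X) a (row_span S),
      alcove A' a' (row_span S'), lev a (rho _) = (dual_coxeter X)%:Z - 1 &
      forall x, level D x = (lev a x)%:~R] /\
  [/\ G *m (map_mx intr S)^T = 1%:M, map_mx intr S' *m G = 1%:M,
      forall i, map_mx intr (simple_reflection A' i) *m G =
        G *m (map_mx intr (simple_reflection (finite_cartan X) i))^T &
      forall y, alcove_point a' (k + dual_coxeter X)%N%:Z y ->
        Sigma D k (expi_pairing G (k + dual_coxeter X) y)].
Proof.
move=> Xa; have [m [d [c [q [lw [rc fdata ndata] ] ] ] ] ] := type_dataP Xa.
pose A := finite_cartan X; have AE := @finite_cartanE X.
have H := checks_finite_type rc AE (theta_highest D) (highest_corootP D).
have [thc thq long] := checks_highest rc AE H.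
exists (fun i => d i.+1), m; split=> //.
have [Xf|Xf] := boolP (form_case X).
- have [e [e0 te qs SEx] ] := fdata Xf.
  have /boolp.choice [s sP] : forall p : 'I_(affine_rank X) * 'I_(affine_rank X),
    exists s, e * d p.1.+1 * s = m * A p.2 p.1 by move=> p; exact: SEx.
  pose S : 'M[int]_(affine_rank X) := \matrix_(i, j) s (i, j).
  have SE (i j : 'I_(affine_rank X)) : e * d i.+1 * S i j = m * A j i by rewrite mxE; exact: sP (i, j).
  pose a : 'rV[int]_(affine_rank X) := \row_i (e * q i.+1).
  have aE i : m * a 0 i = e * theta D 0 i * d i.+1 by rewrite mxE mulrCA -thq mulrA.
  have al := alcove_form H e0 SE aE.
  have Ginv := @form_invariant _ _ D Xf; have Gsym := @form_sym _ _ D Xf.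
  have Gth : bform (Defs.form D) (real_vec R (root_lattice A (theta D))) (real_vec R (root_lattice A (theta D))) = 2 * e%:~R.
    by rewrite (@form_normalized _ _ D Xf) -[(theta_norm X)%:R]/((theta_norm X)%:Z%:~R) te rmorphM.
  have GS := gram_span H Gsym Ginv Gth long e0 SE.
  have ar : lev a (rho _) = (dual_coxeter X)%:Z - 1.
    by rewrite -qs /lev mulr_sumr; apply: eq_bigr => i _; rewrite !mxE mulr1.
  (* Theta is the combination [a] of the rows of [S], which [G] inverts; hence the level defined
     through the form is [lev a]. *)
  have tha : root_lattice A (theta D) = a *m S.
    apply/rowP => j; apply: (mulfI (lt0r_neq0 (ft_m H))).
    rewrite root_lattice_coord [in RHS]mxE !mulr_sumr; apply: eq_bigr => i _.
    have -> : m * (A j i * theta D 0 i) = theta D 0 i * (m * A j i) by ring.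
    by rewrite -SE [RHS]mulrA aE; ring.
  exists A, (fun i => d i.+1), m, (theta D), (highest_coroot D), S, S, a, a, (Defs.form D); split; split=> //.
  + move=> x; rewrite /level /theta_check Xf /pairing trmx_mul Gsym tha real_vecM trmx_mul.
    rewrite [Defs.form D *m _]mulmxA GS mul1mx mxE /lev rmorph_sum; apply: eq_bigr => i _.
    by rewrite !mxE rmorphM mulrC.
  + exact: (span_gram H Gsym Ginv Gth long e0 SE).
  + exact: (gram_reflection H Ginv).
  move=> y yp; rewrite /Sigma Xf; have [yd yk] := alcove_point_rho ar (PoszD _ _) yp.
  exists (y - rho _).
    split=> //; rewrite /level /theta_check Xf /pairing trmx_mul Gsym tha real_vecM trmx_mul.
    rewrite [Defs.form D *m _]mulmxA GS mul1mx mxE (_ : \sum_j _ = (lev a (y - rho _))%:~R).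
      by rewrite -[k%:R]/(k%:Z%:~R) ler_int.
    by rewrite /lev rmorph_sum; apply: eq_bigr => i _; rewrite !mxE rmorphM mulrC.
  by apply/funext => x; rewrite /form_point addrC subrK.
have [m' [d' [c' [q' [lw' [rc' cs cs'] ] ] ] ] ] := ndata Xf.
have A'E i j : A^T i j = bond_entries (map swap_bond (affine_bonds X)) i.+1 j.+1.
  by rewrite mxE AE (bond_entries_swap _ _ (rc_wf rc)).
have H' : finite_type A^T (fun i => d' i.+1) m' (highest_coroot D) (theta D).
  apply: (checks_finite_type rc' A'E (highest_corootP D)); rewrite trmxK; exact: theta_highest.
have [etc _ _] := checks_highest rc' A'E H'.
have Ur : (map_mx intr A : 'M[R]_(affine_rank X)) \in unitmx.
  rewrite unitmxE unitfE det_map_mx intr_eq0 -det_tr.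
  exact: (det_cartan_neq0 (ft_high H)).
have arho : lev (highest_coroot D) (rho _) = (dual_coxeter X)%:Z - 1.
  by rewrite -cs' /lev; apply: eq_bigr => i _; rewrite etc !mxE mulr1.
have arho' : lev (theta D) (rho _) = (dual_coxeter X)%:Z - 1.
  by rewrite -cs /lev; apply: eq_bigr => i _; rewrite thc !mxE mulr1.
exists A^T, (fun i => d' i.+1), m', (highest_coroot D), (theta D), A^T, A^T^T.
exists (highest_coroot D), (theta D), (invmx (map_mx intr A)); split; split=> //.
- exact: (alcove_coroot H).
- exact: (alcove_coroot H').
- move=> x; rewrite /level /theta_check (negbTE Xf) /pairing mxE /lev rmorph_sum.
  by apply: eq_bigr => i _; rewrite !mxE rmorphM mulrC.
- by rewrite map_trmx trmxK mulVmx.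
- by rewrite trmxK mulmxV.
- move=> i; have := simple_reflection_tr A^T i; rewrite !trmxK => E.
  have {}E : map_mx intr A *m map_mx intr (simple_reflection A^T i) =
      (map_mx intr (simple_reflection A i))^T *m map_mx intr A :> 'M[R]_(affine_rank X).
    by rewrite -map_mxM E map_mxM map_trmx.
  by rewrite -[LHS](mulKmx Ur) [_ *m (_ *m invmx _)]mulmxA E -!mulmxA mulmxV // mulmx1.
move=> y yp; rewrite /Sigma (negbTE Xf); have [yd yk] := alcove_point_rho arho' (PoszD _ _) yp.
exists (y - rho _).
  split=> //; apply: le_trans yk; rewrite /lev le_eqVlt; apply/orP; left.
  by apply/eqP; apply: eq_bigr => i _; rewrite mulrC.
apply/funext => x; rewrite /coweight_point addrC subrK /expi_pairing; congr (expi (_ * _)).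
rewrite /pairing /coweight /bform -/A.
set B := invmx _; have -> : real_vec R x *m (real_vec R y *m B)^T = (real_vec R y *m B *m (real_vec R x)^T)^T.
  by rewrite [RHS]trmx_mul trmxK.
by rewrite [LHS]mxE.
Qed.

Theorem theorem2p2 (R : realType) (X : affine_type) (hX : admissible X)
    (D : root_datum R X) (k : nat)
    (c : 'rV[int]_(affine_rank X) -> 'rV[int]_(affine_rank X) ->
         'rV[int]_(affine_rank X) -> R[i])
    (hc : fusion_coefficients D k c)
    (lam mu nu : 'rV[int]_(affine_rank X))
    (hlam : P_level D k lam) (hmu : P_level D k mu) (hnu : P_level D k nu) :
  (exists z : int, c lam mu nu = z%:~R) /\
  (level D (lam + mu + nu) <= (2 * k)%:R ->
   forall (g : lieAlgebra R[i]) (e f : 'I_(affine_rank X) -> g),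
     simple_lie g -> chevalley_generators (finite_cartan X) e f ->
   forall (dl dm dn : nat)
     (Vl : lie_rep g dl) (Vm : lie_rep g dm) (Vn : lie_rep g dn),
     is_irrep e f lam Vl -> is_irrep e f mu Vm -> is_irrep e f nu Vn ->
     c lam mu nu = (\dim (rep_hom Vn (tensor_rep Vl Vm)))%:R).
Proof.
have [d [m [H [A' [d' [m' [th' [et' [S [S' [a [a' [G [ [H' al al' ar lE] [GS SG Gr Sg] ] ] ] ] ] ] ] ] ] ] ] ] ] ] := assembly_data D k hX.
have N0 : (0 < k + dual_coxeter X)%N by rewrite addn_gt0 dual_coxeter_gt0 // orbT.
split; first exact: (fusion_coefficient_int H H' al al' GS SG Gr N0 ar lE Sg hc hlam hmu hnu).
exact: (fusion_coefficient_hom H H' al al' GS SG Gr N0 ar lE Sg hc hlam hmu hnu).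
Qed.
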